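(* Let $n\in\mathbb Z^+$, let $D$ be a Hadamard plan of index $n$, and let $\rho\in\mathbb R$. Let $\{A_\iota\}_{\iota\in I}$ be a coherently $\rho$-rotated family of instances (or a coherently $\rho$-rotated family of unimodularized instances) of $D$. Then $\mathrm{CDF}(A_\iota)$ tends to \[1+\frac{1}{3(n-1)}+\frac{1}{n-1}\Phi(2\rho)\] as $\mathrm{SDC}(A_\iota)$ tends to infinity. For fixed $n$, this limit achieves its global minimum value $1+\frac{1}{6(n-1)}$ if and only if $\rho\in\{(2m+1)/4: m\in\mathbb Z\}$.
   Context: An aperiodic sequence is a function $f:\mathbb Z\to\mathbb C$ with finitely many nonzero values. For aperiodic $f,g$ and $s\in\mathbb Z$, $C_{f,g}(s)=\sum_{j\in\mathbb Z}f_{j+s}\overline{g_j}$. A codebook is a finite set of aperiodic sequences; $\mathrm{SDC}(F)=\min_{f\in F}C_{f,f}(0)$. For nonzero $f,g$, $\mathrm{CDF}(f,g)=\sum_{s\in\mathbb Z}|C_{f,g}(s)|^2/(C_{f,f}(0)C_{g,g}(0))$, and for a codebook $F$ of nonzero sequences, $\mathrm{CDF}(F)=|F|^{-2}\sum_{f,g\in F}\mathrm{CDF}(f,g)$ (the sum includes $f=g$). A periodic sequence of length $\ell$ is $g:\mathbb Z/\ell\mathbb Z\to\mathbb C$; its rotation $g^{(r)}$ ($r\in\mathbb Z$) is the aperiodic sequence with $g^{(r)}_j=g_{r+j}$ for $0\le j\le\ell-1$ and $0$ otherwise. For each prime $p$, $\alpha_p$ is a fixed primitive element of $\mathbb F_p$,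 and for $n\mid p-1$, $\mathbb F_p^{*n}$ is the subgroup of $n$th powers. A cyclotomic pattern of index $n$ is $d:\mathbb Z/n\mathbb Z\to\mathbb C$; for a prime $p\equiv1\pmod n$ the periodic sequence of length $p$ from $d$ is $f$ with $f_0=0$ and $f_h=d_k$ for $h\in\alpha_p^k\mathbb F_p^{*n}$; if $d$ is unimodular, a unimodularized periodic sequence of length $p$ from $d$ is obtained from $f$ by replacing $f_0$ with a complex number of modulus $1$. A cyclotomic plan of index $n$ is a finite set of cyclotomic patterns of index $n$. A Hadamard plan of index $n$ is a cyclotomic plan $D$ of index $n$ with exactly $n-1$ patterns, each unimodular (all entries of modulus $1$) and balanced (entries sum to $0$), and pairwise orthogonal in $\mathbb C^n$. A family $\{A_\iota\}_{\iota\in I}$ is a coherently $\rho$-rotated family of instances (resp. unimodularized instances) of $D$ if there are primes $p_\iota\equiv1\pmod n$ with $\{p_\iota\}$ unbounded and functions $r_\iota:D\to\mathbb Z$ such that $A_\iota=\{f_{\iota,d}^{(r_\iota(d))}:d\in D\}$, where $f_{\iota,d}$ is the periodic sequence (resp. a unimodularized periodic sequence) of length $p_\iota$ from $d$, and for every $d\in D$, $r_\iota(d)/p_\iota\to\rho$ as $p_\iota\to\infty$. $\Phi:\mathbb R\to\mathbb R$ is the function of period $1$ with $\Phi(x)=2(x-\tfrac12)^2-\tfrac16$ for $0\le x\le1$. *)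

(* Defs.v *)
From HB Require Import structures.
From mathcomp Require Import all_boot all_order all_algebra all_field.
From mathcomp Require Import finmap all_classical all_reals.
From mathcomp.real_closed Require Import complex.

Set Implicit Arguments.
Unset Strict Implicit.
Unset Printing Implicit Defensive.

Import Order.TTheory GRing.Theory Num.Theory.
Local Open Scope ring_scope.
Local Open Scope classical_set_scope.

Section Defs.
Variable R : realType.

Definition cabs2 (z : R[i]) : R := complex.Re z ^+ 2 + complex.Im z ^+ 2.

(* aperiodic sequences: functions Z -> C (finitely supported in all uses);
   sums over Z are finitely supported sums (fsbigop). *)
Definition crosscorr (f g : int -> R[i]) (s : int) : R[i] :=
  \sum_(j \in [set: int]) f (j + s) * conjc (g j).

(* C_{f,f}(0) = sum_j |f_j|^2, a nonnegative real *)
Definition energy (f : int -> R[i]) : R := complex.Re (crosscorr f f 0).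

(* SDC(F) = min_{f in F} C_{f,f}(0)  (inf of a finite set = its min) *)
Definition SDC (F : set (int -> R[i])) : R := inf [set energy f | f in F].

Definition CDF2 (f g : int -> R[i]) : R :=
  (\sum_(s \in [set: int]) cabs2 (crosscorr f g s)) / (energy f * energy g).

Definition card_cb (F : set (int -> R[i])) : R := \sum_(f \in F) (1 : R).

Definition CDF (F : set (int -> R[i])) : R :=
  (card_cb F ^+ 2)^-1 * \sum_(f \in F) \sum_(g \in F) CDF2 f g.

(* rotation g^{(r)} of a periodic sequence g of length p (Z/pZ = 'F_p, p prime) *)
Definition rotation (p : nat) (g : 'F_p -> R[i]) (r : int) : int -> R[i] :=
  fun j => if (0 <= j) && (j < p%:Z) then g ((r + j)%:~R) else 0.

Definition periodic_from (n p : nat) (a : 'F_p) (d : 'I_n -> R[i])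
    (f : 'F_p -> R[i]) : Prop :=
  f 0 = 0 /\
  forall (k : 'I_n) (y : 'F_p), y != 0 -> f (a ^+ k * y ^+ n) = d k.

Definition unimod_periodic_from (n p : nat) (a : 'F_p) (d : 'I_n -> R[i])
    (f : 'F_p -> R[i]) : Prop :=
  `|f 0| = 1 /\
  forall (k : 'I_n) (y : 'F_p), y != 0 -> f (a ^+ k * y ^+ n) = d k.

Definition hadamard_plan (n : nat) (D : {fset {ffun 'I_n -> R[i]}}) : Prop :=
  [/\ (#|` D|)%fset = n.-1,
      (forall d, d \in D -> forall k, `|d k| = 1),
      (forall d, d \in D -> \sum_(k < n) d k = 0) &
      (forall d d', d \in D -> d' \in D -> d != d' ->
         \sum_(k < n) d k * conjc (d' k) = 0)].

(* A is a coherently rho-rotated family of instances (unimod = false) or of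
   unimodularized instances (unimod = true) of D, where alpha p is the fixed
   primitive element of F_p. *)
Definition coherently_rotated (unimod : bool) (alpha : forall p : nat, 'F_p)
    (n : nat) (D : {fset {ffun 'I_n -> R[i]}}) (rho : R)
    (I : Type) (A : I -> set (int -> R[i])) : Prop :=
  exists (p : I -> nat) (r : I -> {ffun 'I_n -> R[i]} -> int)
         (f : forall i : I, {ffun 'I_n -> R[i]} -> 'F_(p i) -> R[i]),
    [/\ (forall i, prime (p i) /\ p i = 1 %[mod n]),
        (forall M : nat, exists i, (M < p i)%N),
        (forall i d, d \in D ->
           if unimod then unimod_periodic_from (alpha (p i)) d (f i d)
           else periodic_from (alpha (p i)) d (f i d)),
        (forall i, A i = [set rotation (f i d) (r i d) | d in [set` D]]) &
        (forall d, d \in D -> forall eps : R, 0 < eps ->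
           exists M : nat, forall i, (M < p i)%N ->
             `|(r i d)%:~R / (p i)%:R - rho| < eps)].

End Defs.

Definition Phi (R : realType) (x : R) : R :=
  let t := x - (Num.floor x)%:~R in 2 * (t - 2^-1) ^+ 2 - 6^-1.

(* Main.v *)
(* By Parseval, the sum of |C_{f,g}(s)|^2 over f, g and s is (1/2p) times the sum
   over the 2p-th roots of unity of (sum_f |f^|^2)^2. Since a Hadamard plan is a
   tight frame for the balanced vectors, sum_d f_d(x) conj f_d(y) is the kernel
   K(x,y) = n[x,y in the same class] - 1, whose Fourier transform is pK; this
   evaluates the even roots exactly. At the odd roots f^ is interpolated from the
   even ones with a kernel c whose l1 norm is O(log p), and the fourth moment
   becomes a sum of four factors c against E = sum_a K(a-x,a-x') K(a-y,a-y').
   Stepanov's method shows that E = o(p / log^4 p) unless x = x' and y = y', or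
   {x,x'} = {y,y'}. The degenerate quadruples are evaluated through
   sum |c|^2 = 1, sum |c|^4 -> 1/3 and |sum_x c(x)^2 e(2rx/p)|^2; the last one is
   where Phi(2 rho) comes from. Unequal rotations and unimodular entries at 0
   perturb the spectrum by a negligible amount in l4 norm. *)
Require Import Defs.
From HB Require Import structures.
From mathcomp Require Import all_boot all_order all_algebra all_field.
From mathcomp Require Import finmap all_classical all_reals.
From mathcomp Require Import topology normedtype trigo.
From mathcomp.real_closed Require Import complex.
From mathcomp Require Import ring lra zify.
Set Implicit Arguments.
Unset Strict Implicit.
Unset Printing Implicit Defensive.
Import Order.TTheory GRing.Theory Num.Theory.
Local Open Scope ring_scope.

(** * Stepanov's method *)

(** Each of the four factors [c] costs its l1 norm, of order log p, so E must beat p by more than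
    log^4 p, uniformly in the quadruple. Stepanov's method leaves an error n^2 p / k as long as k^2
    is small against p for fixed n; with p < 2^l, taking k = l^5 leaves l^4 / l^5 = 1/l. The method
    bounds counts only from above. A lower bound comes from treating all n classes of a ratio
    together: their total is known, so n - 1 upper bounds force the remaining count up. A codebook
    is a set, so its n - 1 sequences must be shown distinct before its cardinality and its sums are
    known; the same estimate of E supplies this. All energies equal p - 1 or p, so a large SDC means
    a large p. *)

Lemma size_roots_mult (F : fieldType) (M : nat) (s : seq F) (q : {poly F}) :
  q != 0 -> uniq s -> (forall x, x \in s -> ('X - x%:P) ^+ M %| q) ->
  (size s * M < size q)%N.
Proof.
elim: s q => [|x s IH] q q0 /=; first by rewrite mul0n size_poly_gt0.
case/andP=> xs us H.
have /dvdpP[q' Eq] := H x (mem_head _ _).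
have q'0 : q' != 0 by apply: contra_neq q0 => q'0; rewrite Eq q'0 mul0r.
have X0 : ('X - x%:P) ^+ M != 0 :> {poly F} by rewrite expf_neq0 // polyXsubC_eq0.
have lt : (size s * M < size q')%N.
  apply: IH => // y ys; have := H y; rewrite inE ys orbT => /(_ isT).
  rewrite Eq Gauss_dvdpl // coprimep_expl // coprimep_expr //.
  rewrite coprimep_XsubC root_XsubC; apply: contraNneq xs => E.
  by first [rewrite E | rewrite -E].
rewrite Eq size_mul // size_exp_XsubC addnS mulSn; move: lt.
rewrite /= -(ltn_add2l M) => lt.
by rewrite addnC in lt *; rewrite [X in (_ < X)%N]addnC in lt; exact: lt.
Qed.

(* Iterating theta u instead of the derivative detects multiplicities at points
   where u is nonzero while keeping the factors g1 ^+ a and g2 ^+ b intact. *)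
Definition theta (F : fieldType) (u q : {poly F}) := u * q^`().

(** Each application lowers the order at [s] by exactly one: the value of the cofactor at [s] is
    multiplied by [u.[s]] and by the current order, which is nonzero in the field because it is less
    than [p]. *)
Lemma theta_iter_order (F : fieldType) (p : nat) (u q : {poly F}) (s : F) (j : nat) :
  p \in [pchar F] -> (j < p)%N -> u.[s] != 0 -> q.[s] != 0 ->
  (iter j (theta u) (q * ('X - s%:P) ^+ j)).[s] != 0.
Proof.
move=> hp; elim: j q => [|j IH] q jp us qs; first by rewrite expr0 mulr1.
rewrite iterSr.
have -> : theta u (q * ('X - s%:P) ^+ j.+1) =
    (u * (q^`() * ('X - s%:P) + q *+ j.+1)) * ('X - s%:P) ^+ j.
  rewrite /theta derivM deriv_exp derivXsubC /= -mulr_natl exprS.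
  by rewrite -(mulr_natl q); ring.
apply: IH => //; first by apply: ltn_trans jp.
rewrite hornerM mulf_neq0 //.
have -> : (q^`() * ('X - s%:P) + q *+ j.+1).[s] = j.+1%:R * q.[s].
  by rewrite hornerD hornerMn hornerM hornerXsubC subrr mulr0 add0r mulr_natl.
by rewrite mulf_neq0 // -(dvdn_pcharf hp) gtnNdvd.
Qed.

Lemma dvdp_of_theta (F : fieldType) (p : nat) (u q : {poly F}) (s : F) (M : nat) :
  p \in [pchar F] -> (M <= p)%N -> u.[s] != 0 -> q != 0 ->
  (forall r, (r < M)%N -> (iter r (theta u) q).[s] = 0) ->
  ('X - s%:P) ^+ M %| q.
Proof.
move=> hp Mp us q0 H.
have [j [q' + Eq]] := multiplicity_XsubC q s; rewrite q0 /= => q's.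
have [Mj|jM] := leqP M j; first by rewrite Eq dvdp_mull // dvdp_exp2l.
have /eqP := H j jM; rewrite Eq; apply: contraLR => _.
by apply: (theta_iter_order hp) => //; apply: leq_trans Mp.
Qed.

Section Stepanov.
Variables (F : fieldType) (p n m k : nat) (g1 g2 : {poly F}) (al tau : F).
Hypothesis hp : p \in [pchar F].
Hypothesis pnm : p.-1 = (n * m)%N.
Hypothesis (sg1 : (size g1 <= n.+1)%N) (sg2 : (size g2 <= n.+1)%N).

(** The action of [theta (g1 * g2)] on the cofactor of ['X^(p * e) * g1 ^+ a * g2 ^+ b]. The
    exponent [e] is absent because p-th powers have derivative zero. *)
Definition twisted (a b : nat) (w : {poly F}) :=
  g1 * g2 * w^`() + w * ((g1^`() * g2) *+ a + (g1 * g2^`()) *+ b).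

Lemma derivX_mul (g : {poly F}) a : g * (g ^+ a)^`() = (g^`() * g ^+ a) *+ a.
Proof.
case: a => [|a]; first by rewrite expr0 derivC mulr0 mulr0n.
by rewrite deriv_exp /= mulrnAr exprS; congr (_ *+ _); ring.
Qed.

Lemma theta_twisted a b e w :
  theta (g1 * g2) (w * ('X^(p * e) * g1 ^+ a * g2 ^+ b)) =
  twisted a b w * ('X^(p * e) * g1 ^+ a * g2 ^+ b).
Proof.
have Xp0 : ('X^(p * e))^`() = 0 :> {poly F}.
  rewrite derivXn -mulr_natl natrM.
  have -> : p%:R = 0 :> {poly F} by rewrite -polyC_natr (pcharf0 hp).
  by rewrite !mul0r.
rewrite /theta !derivM Xp0 mul0r add0r /twisted.
have D1 := derivX_mul g1 a; have D2 := derivX_mul g2 b.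
have -> : g1 * g2 * (w^`() * ('X^(p * e) * g1 ^+ a * g2 ^+ b) +
     w * ('X^(p * e) * (g1 ^+ a)^`() * g2 ^+ b +
          'X^(p * e) * g1 ^+ a * (g2 ^+ b)^`())) =
   g1 * g2 * (w^`() * ('X^(p * e) * g1 ^+ a * g2 ^+ b)) +
   w * 'X^(p * e) * ((g1 * (g1 ^+ a)^`()) * g2 * g2 ^+ b +
                    g1 * g1 ^+ a * (g2 * (g2 ^+ b)^`())) by ring.
by rewrite D1 D2; ring.
Qed.

Lemma iter_theta_twisted r a b e w :
  iter r (theta (g1 * g2)) (w * ('X^(p * e) * g1 ^+ a * g2 ^+ b)) =
  iter r (twisted a b) w * ('X^(p * e) * g1 ^+ a * g2 ^+ b).
Proof. by elim: r => //= r ->; rewrite theta_twisted. Qed.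

(** The growth does not depend on [a] and [b], which may be of order [p]; this is what keeps the
    number of vanishing conditions small. *)
Lemma size_twisted a b w : (size (twisted a b w) <= size w + 2 * n)%N.
Proof.
have sd (q : {poly F}) : (size q^`() <= (size q).-1)%N.
  have [->|q0] := eqVneq q 0; first by rewrite deriv0 size_poly0.
  by rewrite -ltnS prednK ?lt_size_deriv ?size_poly_gt0.
have M (q1 q2 : {poly F}) := size_polyMleq q1 q2.
have sD1 := sd g1; have sD2 := sd g2; have sDw := sd w.
apply: leq_trans (size_polyD _ _) _; rewrite geq_max; apply/andP; split.
  have [->|w0] := eqVneq w 0; first by rewrite deriv0 mulr0 size_poly0.
  move: w0; rewrite -size_poly_gt0 => w0.
  apply: leq_trans (M _ _) _; have := M g1 g2; lia.
apply: leq_trans (M _ _) _.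
suff : (size ((g1^`() * g2) *+ a + (g1 * g2^`()) *+ b)%R <= (2 * n).+1)%N by lia.
apply: leq_trans (size_polyD _ _) _; rewrite geq_max.
apply/andP; split; rewrite -scaler_nat; apply: leq_trans (size_scale_leq _ _) _;
  apply: leq_trans (M _ _) _; lia.
Qed.

Variables (h : {poly F}) (S : seq F).
(** A simple zero of [g1] at 0, where [g2] does not vanish, gives [g1 ^+ (m * i)] order exactly
    [m * i] there, and this separates the [phi j]. The shift [tau] allows points that are translates
    of elements of the prime field by an element outside it. *)
Hypothesis (g1h : g1 = 'X * h) (h0 : h.[0] != 0) (g20 : g2.[0] != 0).
Hypothesis (m0 : (0 < m)%N) (n0 : (0 < n)%N) (k0 : (0 < k)%N).
Hypothesis uS : uniq S.
Hypothesis HS : forall s, s \in S ->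
  [/\ s ^+ p = s + tau, (g1 * g2).[s] != 0 & g1.[s] ^+ m = al * g2.[s] ^+ m].
Hypothesis pk : (n * k * (2 * n * (n * k) + k.+1) < p.-1)%N.

(** In mixed radix an index [j < U] is a triple [kk j <= k], [ii j < n], [ll j < m]. [Rp r j] is
    what remains on [S] of the r-th iterate of [phi j] after the common factor [g2 ^+ (m * n.-1)] is
    removed. [W] bounds its size: [m] from the power of ['X], [2 * n] for each of fewer than [n * k]
    steps, [k] from the power of ['X + tau%:P]. *)
Let M := (n * k)%N.
Let W := (m + 2 * n * (n * k) + k)%N.
Let U := (k.+1 * p.-1)%N.
Let kk (j : nat) := (j %/ p.-1)%N.
Let ii (j : nat) := ((j %% p.-1) %/ m)%N.
Let ll (j : nat) := ((j %% p.-1) %% m)%N.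
Let tw (r j : nat) := iter r (twisted (m * ii j) (m * (n.-1 - ii j))) 'X^(ll j).
Let phi j := 'X^(ll j) *
   ('X^(p * kk j) * g1 ^+ (m * ii j) * g2 ^+ (m * (n.-1 - ii j))).
Let Rp r j := (al ^+ ii j) *: (tw r j * ('X + tau%:P) ^+ kk j).

Let p1 : (0 < p.-1)%N. Proof. by apply: leq_ltn_trans pk. Qed.

Let ii_lt j : (ii j < n)%N.
Proof. by rewrite /ii ltn_divLR // -pnm ltn_mod. Qed.

Let kk_le j : (j < U)%N -> (kk j <= k)%N.
Proof. by move=> jU; rewrite -ltnS /kk ltn_divLR. Qed.

Let size_Rp r j : (r < M)%N -> (j < U)%N -> (size (Rp r j) <= W)%N.
Proof.
move=> rM jU; apply: leq_trans (size_scale_leq _ _) _.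
have sX : size ('X + tau%:P) = 2%N.
  by have := size_XsubC (- tau); rewrite polyCN opprK.
have sX' : (size (('X + tau%:P) ^+ kk j) <= k.+1)%N.
  apply: leq_trans (size_poly_exp_leq _ _) _.
  by rewrite sX mul1n ltnS kk_le.
have : (size (tw r j) <= m + 2 * n * r)%N.
  rewrite /tw; elim: (r) => [|r' IH] /=.
    by rewrite size_polyXn muln0 addn0 /ll ltn_mod.
  by apply: leq_trans (size_twisted _ _ _) _; lia.
have := size_polyMleq (tw r j) (('X + tau%:P) ^+ kk j).
move: rM; rewrite /M /W; nia.
Qed.

Let kernel_vector : exists2 v : 'I_U -> F, (exists j, v j != 0) &
  forall r, (r < M)%N -> \sum_(j < U) v j *: Rp r j = 0.
Proof.
pose A := \matrix_(j < U, q < M * W) (Rp (q %/ W) j)`_(q %% W).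
have W0 : (0 < W)%N by rewrite /W; lia.
(* Both sides contain n m k; what remains to compare is n k (2 n n k + k) with n m = p - 1, and [pk]
   has this shape. *)
have MW : (M * W < U)%N.
  by move: pk; rewrite /M /W /U pnm; nia.
have kA : (0 < \rank (kermx A))%N.
  rewrite mxrank_ker subn_gt0; apply: leq_ltn_trans MW; exact: rank_leq_col.
have [i ki] : exists i, row i (kermx A) != 0.
  apply/existsP; rewrite -[[exists i, _]]negbK negb_exists; apply/forallP => H.
  have : kermx A = 0.
    by apply/row_matrixP => i; have := H i; rewrite negbK row0 => /eqP.
  by move: kA => /[swap] ->; rewrite mxrank0.
pose v := row i (kermx A).
have vA : v *m A = 0 by rewrite -row_mul mulmx_ker row0.
exists (fun j => v 0 j).
  exact/rV0Pn.
move=> r rM; apply/polyP => e; rewrite coef0 coef_sum.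
have [eW|We] := ltnP e W; last first.
  apply: big1 => j _; rewrite coefZ nth_default ?mulr0 //.
  exact: leq_trans (size_Rp rM (ltn_ord j)) We.
have qlt : (r * W + e < M * W)%N.
  apply: (@leq_trans (r.+1 * W)%N); last by rewrite leq_pmul2r.
  by rewrite mulSn addnC ltn_add2r.
have /rowP /(_ (Ordinal qlt)) := vA; rewrite mxE [RHS]mxE => vAq; rewrite -[RHS]vAq.
apply: eq_bigr => j _; rewrite coefZ [A _ _]mxE /=.
by rewrite divnMDl // modnMDl divn_small // modn_small // addn0.
Qed.

(* The auxiliary polynomial is a combination of the phi j, which vanish at 0 to
   pairwise distinct orders and are therefore linearly independent. On S, where
   s ^+ p = s + tau and g1 ^+ m = al * g2 ^+ m, the iterates of theta reduce to
   polynomials Rp of small degree, so vanishing to order n * k on all of S is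
   fewer linear conditions than there are coefficients. *)
Theorem stepanov_bound : (size S * (n * k) <= p * (k + n))%N.
Proof.
have [v [j1 vj1] Hv] := kernel_vector.
pose Psi := \sum_(j < U) v j *: phi j.
have itE r : iter r (theta (g1 * g2)) Psi =
    \sum_(j < U) v j *: iter r (theta (g1 * g2)) (phi j).
  elim: r => //= r ->; rewrite /theta raddf_sum mulr_sumr.
  by apply: eq_bigr => j _; rewrite /= derivZ scalerAr.
have Psi0 : Psi != 0.
  case: (@arg_minnP _ j1 (fun j : 'I_U => v j != 0) (fun j => val j) vj1) => j0 vj0 minj0.
  pose ord j := (p * kk j + j %% p.-1)%N.
  have phiE j : phi j = 'X^(ord j) * (h ^+ (m * ii j) * g2 ^+ (m * (n.-1 - ii j))).
    have -> : ord j = (p * kk j + (m * ii j + ll j))%N.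
      by rewrite /ord [in LHS](divn_eq (j %% p.-1) m) -/(ii j) -/(ll j) [(m * _)%N]mulnC.
    by rewrite /phi g1h exprMn !exprD; ring.
  have ord_lt (i j : 'I_U) : (i < j)%N -> (ord i < ord j)%N.
    move=> ij; have kij : (kk i <= kk j)%N by apply: leq_div2r; apply: ltnW.
    move: (ltn_pmod i p1) (ltn_pmod j p1) (divn_eq i p.-1) (divn_eq j p.-1).
    rewrite /ord -/(kk i) -/(kk j); nia.
  apply/eqP => /polyP /(_ (ord j0)); rewrite coef0 coef_sum.
  rewrite (bigD1 j0) //= big1 ?addr0.
    rewrite coefZ phiE coefXnM ltnn subnn -horner_coef0 hornerM !horner_exp.
    by apply/eqP; rewrite !mulf_neq0 ?expf_neq0.
  move=> j jj0; have [->|vj] := eqVneq (v j) 0; first by rewrite scale0r coef0.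
  rewrite coefZ phiE coefXnM ord_lt ?mulr0 //.
  by rewrite ltn_neqAle minj0 // andbT eq_sym.
have HM s : s \in S -> ('X - s%:P) ^+ M %| Psi.
  move=> sS; have [sp gs gm] := HS sS.
  (* Iterates of [theta] detect the order of vanishing only up to the characteristic. *)
  have Mp : (M <= p)%N.
    have := pk; rewrite -/M.
    have : (M <= M * (2 * n * M + k.+1))%N by rewrite leq_pmulr // addnS.
    lia.
  apply: (dvdp_of_theta hp Mp gs) => // r rM.
  rewrite itE horner_sum.
  transitivity (g2.[s] ^+ (m * n.-1) * (\sum_(j < U) v j *: Rp r j).[s]).
    rewrite horner_sum mulr_sumr; apply: eq_bigr => j _.
    rewrite /phi iter_theta_twisted -/(tw r j) !hornerE /=.
    rewrite exprM sp.
    have -> : g1.[s] ^+ (m * ii j) = al ^+ ii j * g2.[s] ^+ (m * ii j).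
      by rewrite exprM gm exprMn -exprM.
    have -> : (m * n.-1 = m * ii j + m * (n.-1 - ii j))%N.
      by rewrite -mulnDr subnKC // -ltnS prednK.
    by rewrite exprD; ring.
  by rewrite Hv // horner0 mulr0.
have lt := size_roots_mult Psi0 uS HM.
rewrite -ltnS; apply: leq_trans lt _.
apply: leq_trans (size_sum _ _ _) _; apply/bigmax_leqP => j _.
apply: leq_trans (size_scale_leq _ _) _.
have sM (q1 q2 : {poly F}) := size_polyMleq q1 q2.
have sE (g : {poly F}) a : (size g <= n.+1)%N -> (size (g ^+ a) <= (n * a).+1)%N.
  move=> sg; apply: leq_trans (size_poly_exp_leq _ _) _.
  by rewrite ltnS leq_mul2r; apply/orP; right; lia.
have := sM 'X^(ll j) ('X^(p * kk j) * g1 ^+ (m * ii j) * g2 ^+ (m * (n.-1 - ii j))).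
have := sM ('X^(p * kk j) * g1 ^+ (m * ii j)) (g2 ^+ (m * (n.-1 - ii j))).
have := sM 'X^(p * kk j) (g1 ^+ (m * ii j)).
have := sE g1 (m * ii j)%N sg1; have := sE g2 (m * (n.-1 - ii j))%N sg2.
rewrite !size_polyXn /phi.
have := ii_lt j; have := kk_le (ltn_ord j).
have : (ll j < m)%N by rewrite ltn_mod.
(* The exponents of [g1] and [g2] always add up to m (n - 1), so these factors have total degree at
   most (p - 1)(n - 1), whatever [ii j] is. *)
have e1 : (n * (m * ii j) + n * (m * (n.-1 - ii j)) <= p.-1 * n.-1)%N.
  rewrite -mulnDr -mulnDr subnKC; last by rewrite -ltnS prednK.
  by rewrite mulnA -pnm.
have e2 : (m <= p.-1)%N by rewrite pnm leq_pmull.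
have e3 : (p.-1 * n.-1 + p.-1 <= p * n)%N by nia.
have : (p * kk j <= p * k)%N by rewrite leq_mul2l kk_le ?orbT.
move: e1 e2 e3; rewrite mulnDr.
move: (p.-1 * n.-1)%N (n * (m * ii j))%N (n * (m * (n.-1 - ii j)))%N.
move: (p * kk j)%N (p * k)%N (p * n)%N.
lia.
Qed.
End Stepanov.

(** * Joint distribution of power residue classes *)

(** For the expected sizes N = m / n, C1 = C2 = m and C3 = n m the combination cancels. The upper
    bound on [N] costs n p / k; the lower one, obtained by subtracting n - 1 upper bounds, costs n
    (n - 1) p / k, which is within n^2 p / k. The 16 n^2 absorbs the bounded exceptions. *)
Lemma generic_arith (p n m k N C1 C2 C3 : nat) :
  p = (n * m).+1 -> (0 < m)%N -> (0 < n)%N ->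
  (n * N * (n * k) <= p * (k + n))%N ->
  (n * m.-1 * (n * k) <= n * N * (n * k) + n.-1 * (p * (k + n)) + 2 * n * (n * k))%N ->
  (m.-1 <= C1 + 2)%N -> (m.-1 <= C2 + 2)%N -> (C1 <= m.-1)%N -> (C2 <= m.-1)%N ->
  (p - 2 <= C3 + 2)%N -> (C3 <= p - 2)%N ->
  k%:Z * `|n%:Z ^+ 2 * N%:Z - n%:Z * C1%:Z - n%:Z * C2%:Z + C3%:Z| <=
  n%:Z ^+ 2 * p%:Z + 16 * k%:Z * n%:Z ^+ 2.
Proof.
move=> pE; case: m pE => // m pE _; case: n pE => // n pE _ /= H1 H2 B1 B2 B3 B4 B5 B6.
have {}B5 : (n.+1 * m.+1 <= C3 + 3)%N by lia.
have {}B6 : (C3 + 1 <= n.+1 * m.+1)%N by lia.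
have D1 : (k * (n.+1 * m) <= k * (n.+1 * (C1 + 2)))%N by rewrite !leq_mul2l B1 !orbT.
have D2 : (k * (n.+1 * m) <= k * (n.+1 * (C2 + 2)))%N by rewrite !leq_mul2l B2 !orbT.
have D3 : (k * (n.+1 * C1) <= k * (n.+1 * m))%N by rewrite !leq_mul2l B3 !orbT.
have D4 : (k * (n.+1 * C2) <= k * (n.+1 * m))%N by rewrite !leq_mul2l B4 !orbT.
have D5 : (k * (n.+1 * m.+1) <= k * (C3 + 3))%N by rewrite !leq_mul2l B5 !orbT.
have D6 : (k * (C3 + 1) <= k * (n.+1 * m.+1))%N by rewrite !leq_mul2l B6 !orbT.
rewrite -{1}[k%:Z]ger0_norm // -normrM ler_norml pE.
rewrite pE in H1 H2.
have k0 : 0 <= k%:Z by []. have n0 : 0 <= n%:Z by []. have m0 : 0 <= m%:Z by [].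
have kn := mulr_ge0 k0 n0; have nn := mulr_ge0 n0 n0; have cabs := mulr_ge0 n0 m0.
have knn := mulr_ge0 k0 nn; have nnm := mulr_ge0 n0 cabs; have nnn := mulr_ge0 n0 nn.
have nnnm := mulr_ge0 nn cabs.
have H1' : (n%:Z + 1) * N%:Z * ((n%:Z + 1) * k%:Z) <=
  ((n%:Z + 1) * (m%:Z + 1) + 1) * (k%:Z + n%:Z + 1).
  by move: H1; lia.
have H2' : (n%:Z + 1) * m%:Z * ((n%:Z + 1) * k%:Z) <=
  (n%:Z + 1) * N%:Z * ((n%:Z + 1) * k%:Z) +
  n%:Z * (((n%:Z + 1) * (m%:Z + 1) + 1) * (k%:Z + n%:Z + 1)) +
  2 * (n%:Z + 1) * ((n%:Z + 1) * k%:Z).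
  by move: H2; lia.
have D1' : k%:Z * ((n%:Z + 1) * m%:Z) <= k%:Z * ((n%:Z + 1) * (C1%:Z + 2)) by lia.
have D2' : k%:Z * ((n%:Z + 1) * m%:Z) <= k%:Z * ((n%:Z + 1) * (C2%:Z + 2)) by lia.
have D3' : k%:Z * ((n%:Z + 1) * C1%:Z) <= k%:Z * ((n%:Z + 1) * m%:Z) by lia.
have D4' : k%:Z * ((n%:Z + 1) * C2%:Z) <= k%:Z * ((n%:Z + 1) * m%:Z) by lia.
have D5' : k%:Z * ((n%:Z + 1) * (m%:Z + 1)) <= k%:Z * (C3%:Z + 3) by lia.
have D6' : k%:Z * (C3%:Z + 1) <= k%:Z * ((n%:Z + 1) * (m%:Z + 1)) by lia.
have e1 : n.+1%:Z = n%:Z + 1 by lia.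
have e2 : (n.+1 * m.+1).+1%:Z = (n%:Z + 1) * (m%:Z + 1) + 1 by lia.
rewrite e2 e1.
move: k0 n0 m0 kn nn cabs knn nnm nnn nnnm H1' H2' D1' D2' D3' D4' D5' D6'.
clear.
move: (n%:Z) (m%:Z) (k%:Z) (N%:Z) (C1%:Z) (C2%:Z) (C3%:Z) => {n m k N C1 C2 C3} n m k N C1 C2 C3.
move=> *; apply/andP; split; lra.
Qed.

Section CyclotomicCount.
Variables (p n m k : nat) (a0 : 'F_p).
Hypothesis pp : prime p.
Hypothesis pnm : p.-1 = (n * m)%N.
Hypothesis n0 : (0 < n)%N.
Hypothesis m0 : (0 < m)%N.
Hypothesis ha0 : (p.-1).-primitive_root a0.
Hypothesis k0 : (0 < k)%N.
Hypothesis pk : (n * k * (2 * n * (n * k) + k.+1) < p.-1)%N.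

Let p0 : (0 < p)%N. Proof. exact: prime_gt0. Qed.

Lemma Fp_expp (x : 'F_p) : x ^+ p = x.
Proof. by rewrite -{2}(expf_card x) card_Fp. Qed.

Lemma Fp_exp_pred (x : 'F_p) : x != 0 -> x ^+ (n * m) = 1.
Proof.
move=> x0; apply: (mulfI x0); rewrite -exprS -pnm prednK // mulr1; exact: Fp_expp.
Qed.

(* Stepanov's bound is applied over an algebraic closure, after translating an
   n-th root of u0 / u1 to the origin. *)
Lemma card_fermat_quotient (u0 u1 v0 v1 al : 'F_p) :
  u0 != 0 -> u1 != 0 -> u0 * v1 != u1 * v0 ->
  (#|[set s : 'F_p | ([&& u0 - u1 * s ^+ n != 0, v0 - v1 * s ^+ n != 0 &
       (u0 - u1 * s ^+ n) ^+ m == al * (v0 - v1 * s ^+ n) ^+ m])%R]| * (n * k)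
   <= p * (k + n))%N.
Proof.
move=> u00 u10 det; set T := [set _ | _].
have [L [io _]] := countable_algebraic_closure 'F_p.
have hp : p \in [pchar L] by apply: (rmorph_pchar io); exact: pchar_Fp.
have io0 x : (io x == 0) = (x == 0) by rewrite fmorph_eq0.
have [s0 /eqP s0n] : exists s, s ^+ n == io (u0 / u1).
  have [|s] := @closed_rootP L ('X^n - (io (u0 / u1))%:P) _.
    by rewrite size_XnsubC //; case: (n) n0.
  by rewrite rootE hornerD hornerN hornerC hornerXn subr_eq0; exists s.
have s00 : s0 != 0.
  apply/eqP => s00; move: s0n; rewrite s00 expr0n gtn_eqF //=.
  by move/esym/eqP; rewrite io0 mulf_eq0 invr_eq0 (negPf u00) (negPf u10).
(* The substitution moves the root [s0] of u0 - u1 X^n to 0. It is a simple root because n < p, and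
   [det] keeps the other polynomial nonzero there. Frobenius fixes s but possibly not [s0], whence
   [tau] is s0 - s0^p below. *)
pose g (u0 u1 : 'F_p) := (io u0)%:P - (io u1) *: ('X + s0%:P) ^+ n.
have gE a b s : (g a b).[io s - s0] = io (a - b * s ^+ n).
  rewrite /g !hornerE /= subrK rmorphB rmorphM rmorphXn //.
have sX : size ('X + s0%:P) = 2%N.
  by have := size_XsubC (- s0); rewrite polyCN opprK.
have sg a b : (size (g a b) <= n.+1)%N.
  apply: leq_trans (size_polyD _ _) _; rewrite geq_max size_polyN; apply/andP; split.
    by apply: leq_trans (size_polyC_leq1 _) _.
  apply: leq_trans (size_scale_leq _ _) _; apply: leq_trans (size_poly_exp_leq _ _) _.
  by rewrite sX mul1n.
have g0E a b : (g a b).[0] = io (a - b * (u0 / u1)).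
  by rewrite /g !hornerE /= ?add0r s0n rmorphB !rmorphM ?mulrA.
have g1h : exists2 h, g u0 u1 = 'X * h & h.[0] != 0.
  have /factor_theorem [h hE] : root (g u0 u1) 0.
    by rewrite rootE g0E mulrC divfK // subrr rmorph0.
  exists h; first by rewrite hE subr0 mulrC.
  have : (g u0 u1)^`().[0] = h.[0] by rewrite hE subr0 derivM derivX mulr1 !hornerE.
  move=> <-; rewrite /g derivB derivC derivZ deriv_exp derivD derivX derivC.
  rewrite addr0 mul1r sub0r hornerN hornerZ hornerMn oppr_eq0.
  rewrite -mulr_natl.
  rewrite !mulf_neq0 ?io0 //.
    rewrite -(dvdn_pcharf hp) gtnNdvd //.
    have : (n <= p.-1)%N by rewrite pnm leq_pmulr.
    by move: p0; lia.
  by rewrite !hornerE /= ?add0r expf_neq0.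
case: g1h => h g1h h0.
have g20 : (g v0 v1).[0] != 0.
  rewrite g0E io0 subr_eq0; apply: contraNneq det => ->.
  by rewrite mulrCA [u1 * _]mulrC -!mulrA mulVf ?mulr1 // mulrC.
pose S := [seq io s - s0 | s <- enum T].
have uS : uniq S.
  by rewrite map_inj_uniq ?enum_uniq // => x y /addIr /fmorph_inj.
have HS s : s \in S ->
  [/\ s ^+ p = s + (s0 - s0 ^+ p), (g u0 u1 * g v0 v1).[s] != 0
    & (g u0 u1).[s] ^+ m = io al * (g v0 v1).[s] ^+ m].
  case/mapP => x; rewrite mem_enum inE => /and3P[x1 x2 /eqP x3] ->.
  split.
  - rewrite -(pFrobenius_autE hp) pFrobenius_autB_comm; last exact: mulrC.
    by rewrite !pFrobenius_autE -rmorphXn Fp_expp addrA subrK.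
  - by rewrite hornerM !gE mulf_neq0 ?io0.
  - by rewrite !gE -!rmorphXn -rmorphM x3.
have := stepanov_bound hp pnm (sg _ _) (sg _ _) g1h h0 g20 m0 n0 k0 uS HS pk.
by rewrite /S size_map -cardE.
Qed.

Let ha_m : m.-primitive_root (a0 ^+ n).
Proof.
have d : (m %| p.-1)%N by rewrite pnm dvdn_mull.
by have := dvdn_prim_root ha0 d; rewrite pnm mulnK.
Qed.

Let ha_n : n.-primitive_root (a0 ^+ m).
Proof.
have d : (n %| p.-1)%N by rewrite pnm dvdn_mulr.
by have := dvdn_prim_root ha0 d; rewrite pnm mulKn.
Qed.

Lemma Fp_powP (z : 'F_p) : z ^+ m = 1 -> exists w, z = w ^+ n.
Proof.
move=> zm.
have [i ->] := prim_rootP ha_m zm.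
by exists (a0 ^+ i); rewrite -!exprM mulnC.
Qed.

Lemma card_roots_ge (z : 'F_p) : z ^+ m = 1 -> (n <= #|[set s : 'F_p | (s ^+ n == z)%R]|)%N.
Proof.
move=> zm; have [w zw] := Fp_powP zm.
have w0 : w != 0.
  apply/eqP => w0; move: zm; rewrite zw w0 -exprM expr0n muln_eq0.
  by rewrite !gtn_eqF //= => /esym/eqP; rewrite oner_eq0.
pose f (i : 'I_n) := w * (a0 ^+ m) ^+ i.
have fi : injective f.
  move=> i j /(mulfI w0) /eqP; rewrite (eq_prim_root_expr ha_n) !modn_small //.
  by move/eqP/val_inj.
rewrite -[X in (X <= _)%N]card_ord -(card_imset _ fi); apply: subset_leq_card.
apply/fintype.subsetP => s /imsetP[i _ ->]; rewrite inE /f exprMn -zw [_ ^+ i ^+ n]exprAC.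
by rewrite (prim_expr_order ha_n) expr1n mulr1.
Qed.

Lemma card_roots_m : #|[set h : 'F_p | (h ^+ m == 1)%R]| = m.
Proof.
pose f (i : 'I_m) := (a0 ^+ n) ^+ i.
have fi : injective f.
  move=> i j /eqP; rewrite (eq_prim_root_expr ha_m) !modn_small //.
  by move/eqP/val_inj.
rewrite -[RHS]card_ord -(card_imset _ fi); apply: eq_card => h; rewrite inE.
apply/eqP/imsetP => [/(prim_rootP ha_m)[i ->]|[i _ ->]]; first by exists i.
by rewrite /f [_ ^+ i ^+ m]exprAC (prim_expr_order ha_m) expr1n.
Qed.

Definition same_coset_set (y y' : 'F_p) :=
  [set a : 'F_p | ([&& a - y != 0, a - y' != 0 & (a - y) ^+ m == (a - y') ^+ m])%R].

(** The Moebius map sending a to (a - y) / (a - y') carries this set bijectively onto the m-th roots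
    of unity other than 1; the value 1 belongs to the point at infinity. *)
Lemma card_same_coset_set y y' : y != y' -> #|same_coset_set y y'| = m.-1.
Proof.
move=> yy.
pose f (a : 'F_p) := (a - y) / (a - y').
have fi : {in same_coset_set y y' &, injective f}.
  move=> a b; rewrite !inE => /and3P[a1 a2 _] /and3P[b1 b2 _].
  move/eqP; rewrite /f eqr_div // -subr_eq0.
  have -> : (a - y) * (b - y') - (b - y) * (a - y') = (y - y') * (a - b) by ring.
  by rewrite mulf_eq0 !subr_eq0 (negPf yy) => /eqP.
rewrite -(card_in_imset fi) -card_roots_m.
rewrite [in RHS](cardsD1 1) inE expr1n eqxx /=.
apply: eq_card => h; rewrite !inE; apply/imsetP/andP.
  case=> a; rewrite inE => /and3P[a1 a2 /eqP a3] ->; rewrite /f expr_div_n a3.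
  rewrite divff ?expf_neq0 // eqxx; split => //.
  rewrite -subr_eq0 -(divff a2) -mulrBl mulf_neq0 ?invr_eq0 //.
  by rewrite opprB addrC subrKA subr_eq0 eq_sym.
case=> h1 /eqP hm.
have h1' : 1 - h != 0 by rewrite subr_eq0 eq_sym.
have h0 : h != 0.
  by apply/eqP => h0; move: hm; rewrite h0 expr0n gtn_eqF.
pose a := (y - h * y') / (1 - h).
have e1 : a - y = h * (y - y') / (1 - h).
  by rewrite /a -[X in _ - X](mulfK h1') -mulrBl; congr (_ / _); ring.
have e2 : a - y' = (y - y') / (1 - h).
  by rewrite /a -[X in _ - X](mulfK h1') -mulrBl; congr (_ / _); ring.
have e20 : a - y' != 0 by rewrite e2 mulf_neq0 ?invr_eq0 // subr_eq0.
have e3 : a - y = h * (a - y') by rewrite e1 e2 mulrA.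
exists a; last by rewrite /f e3 mulfK.
by rewrite inE e3 e20 mulf_neq0 //= exprMn hm mul1r.
Qed.

Definition two_ratio_set (x x' y y' al : 'F_p) :=
  [set a in same_coset_set y y' |
     ([&& a - x != 0, a - x' != 0 & (a - x) ^+ m == al * (a - x') ^+ m])%R].

(* Writing (a - y) / (a - y') = s ^+ n makes (a - x) / (a - x') a quotient of two
   linear polynomials in s ^+ n; each a arises from exactly n values of s. *)
Lemma card_two_ratio_le x x' y y' al : x != y -> x != y' -> x != x' -> y != y' ->
  (n * #|two_ratio_set x x' y y' al| * (n * k) <= p * (k + n))%N.
Proof.
move=> xy xy' xx yy.
have u0 : y - x != 0 by rewrite subr_eq0 eq_sym.
have u1 : y' - x != 0 by rewrite subr_eq0 eq_sym.
have det : (y - x) * (y' - x') != (y' - x) * (y - x').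
  rewrite -subr_eq0.
  have -> : (y - x) * (y' - x') - (y' - x) * (y - x') = (y - y') * (x - x') by ring.
  by rewrite mulf_neq0 // subr_eq0.
apply: leq_trans (card_fermat_quotient al u0 u1 det); rewrite leq_mul2r.
apply/orP; right; set T := [set _ | _].
set N := two_ratio_set _ _ _ _ _.
have -> : (n * #|N| = \sum_(a in N) n)%N by rewrite sum_nat_const mulnC.
apply: (@leq_trans (\sum_(a in N) \sum_(s : 'F_p | s ^+ n == (a - y) / (a - y')) 1)%N).
  apply: leq_sum => a; rewrite !inE => /andP[/and3P[a1 a2 /eqP a3] _].
  rewrite sum1dep_card; apply: card_roots_ge.
  by rewrite expr_div_n a3 divff // expf_neq0.
rewrite (exchange_big_dep xpredT) //= -sum1_card [in leqRHS]big_mkcond /=.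
apply: leq_sum => s _.
have H a : (a \in N) && (s ^+ n == (a - y) / (a - y')) ->
    (s \in T) && (a == (y - y' * s ^+ n) / (1 - s ^+ n)).
  case/andP; rewrite !inE => /andP[/and3P[a1 a2 a3] /and3P[a4 a5 /eqP a6]] /eqP sn.
  have E : s ^+ n * (a - y') = a - y by rewrite sn divfK.
  have s1 : 1 - s ^+ n != 0.
    rewrite subr_eq0; apply: contraNneq yy => s1; move: E; rewrite -s1 mul1r.
    by move/addrI/oppr_inj ->.
  have Ex z : (y - z) - (y' - z) * s ^+ n = (a - z) * (1 - s ^+ n).
    have -> : y = a - s ^+ n * (a - y') by rewrite E opprB addrC subrK.
    by ring.
  rewrite !Ex !mulf_neq0 //= !exprMn a6 mulrA eqxx /=.
  by rewrite eq_sym -(inj_eq (mulIf s1)) divfK // -subr_eq0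
    -[X in _ - X]subr0 -[y]subr0 -[y' in y' * _]subr0 Ex !subr0 subrr.
case: ifP => sT.
  apply: leq_trans (_ : \sum_(a : 'F_p | a == (y - y' * s ^+ n) / (1 - s ^+ n)) 1 <= 1)%N.
    by rewrite [leqLHS]big_mkcond [leqRHS]big_mkcond;
      apply: leq_sum => a _; case: ifP => // /H /andP[_ ->].
  by rewrite big_pred1_eq.
by rewrite big_pred0 // => a; apply/negP => /H; rewrite sT.
Qed.

(** The m-th power of (a - x) / (a - x') is one of the n powers of [a0 ^+ m], so these sets cover
    everything except possibly a = x and a = x', which account for the 2. *)
Lemma card_two_ratio_sum x x' y y' : y != y' ->
  (m.-1 <= \sum_(j < n) #|two_ratio_set x x' y y' ((a0 ^+ m) ^+ j)| + 2)%N.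
Proof.
move=> yy; rewrite -(card_same_coset_set yy).
apply: (@leq_trans (#|\bigcup_(j < n) two_ratio_set x x' y y' ((a0 ^+ m) ^+ j)|
   + #|[set x; x']|)%N); last first.
  rewrite leq_add //; last by rewrite cards2; case: eqP.
  apply: leq_trans (_ : \sum_(j < n) #|two_ratio_set x x' y y' ((a0 ^+ m) ^+ j)| <= _)%N => //.
  elim/big_rec2: _ => [|j s A _ IH]; first by rewrite cards0.
  by apply: leq_trans (leq_card_setU _ _) _; rewrite leq_add2l.
apply: leq_trans (leq_card_setU _ _); apply: subset_leq_card.
apply/fintype.subsetP => a aS; rewrite !inE orbC.
have [//|ax /=] := boolP (a == x); have [//|ax' /=] := boolP (a == x').
have a1 : a - x != 0 by rewrite subr_eq0.
have a2 : a - x' != 0 by rewrite subr_eq0.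
have : (((a - x) / (a - x')) ^+ m) ^+ n = 1.
  by rewrite -exprM mulnC Fp_exp_pred // mulf_neq0 ?invr_eq0.
move/(prim_rootP ha_n) => [j Ej]; apply/bigcupP; exists j => //.
rewrite inE aS a1 a2 /= -Ej expr_div_n divfK ?eqxx //; exact: expf_neq0.
Qed.

(** Stepanov's bound for the n - 1 values [al != 1] is subtracted from the total of about m - 1;
    what is left must lie in the class [al = 1]. *)
Lemma card_two_ratio_ge x x' y y' : x != y -> x != y' -> x != x' -> y != y' ->
  (n * m.-1 * (n * k) <=
   n * #|two_ratio_set x x' y y' 1%R| * (n * k) + n.-1 * (p * (k + n)) + 2 * n * (n * k))%N.
Proof.
move=> xy xy' xx yy; have := card_two_ratio_sum x x' yy.
have bd j : (n * #|two_ratio_set x x' y y' ((a0 ^+ m) ^+ j)| * (n * k) <= p * (k + n))%N.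
  exact: card_two_ratio_le.
rewrite (bigD1 (Ordinal n0)) //= expr0.
set N1 := #|two_ratio_set _ _ _ _ 1|.
set Q := (\sum_(_ < _ | _) _)%N => H.
have : (n * Q * (n * k) <= n.-1 * (p * (k + n)))%N.
  rewrite /Q big_distrr big_distrl /=.
  apply: (@leq_trans (\sum_(i in predC1 (Ordinal n0)) (p * (k + n))))%N.
    by apply: leq_sum => i _; apply: bd.
  by rewrite sum_nat_const cardC1 card_ord.
have : (n * m.-1 * (n * k) <= n * (N1 + Q + 2) * (n * k))%N.
  by rewrite leq_mul2r leq_mul2l H !orbT.
move: (n * k)%N (p * (k + n))%N => A B; nia.
Qed.

(* The sum of chi x * conj (chi y) over the nontrivial multiplicative characters
   chi with chi ^+ n = 1, where m = (p - 1) / n. *)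
Definition Kz (x y : 'F_p) : int :=
  if (x == 0) || (y == 0) then 0 else if x ^+ m == y ^+ m then n%:Z - 1 else - 1.

Lemma Kz_diag x : x != 0 -> Kz x x = n%:Z - 1.
Proof. by move=> x0; rewrite /Kz (negPf x0) eqxx. Qed.

Definition Ez (x x' y y' : 'F_p) : int :=
  \sum_a Kz (a - x) (a - x') * Kz (a - y) (a - y').

(* The contribution to Ez / p of the degenerate quadruples. *)
Definition Ez_main (x x' y y' : 'F_p) : int :=
  (n%:Z - 1) ^+ 2 * ((x == x') && (y == y'))%:Z
  + (n%:Z - 1) * (((x == y) && (x' == y'))%:Z + ((x == y') && (x' == y))%:Z)
  - 2 * (n%:Z - 1) * [&& x == x', y == y' & x == y]%:Z.

Definition avoid_set (y y' : 'F_p) := [set a : 'F_p | (a - y != 0) && (a - y' != 0)].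

Lemma Kz_sub a x x' : Kz (a - x) (a - x') =
  n%:Z * (a \in same_coset_set x x')%:Z - (a \in avoid_set x x')%:Z.
Proof.
rewrite /Kz !inE; case: eqP => _; rewrite ?mulr0 ?subr0 //=.
by case: eqP => _; rewrite ?mulr0 ?subr0 //=; case: ifP; rewrite ?mulr1 ?mulr0 ?sub0r.
Qed.

Lemma Ez_card x x' y y' : Ez x x' y y' =
  n%:Z ^+ 2 * #|same_coset_set x x' :&: same_coset_set y y'|%:Z
  - n%:Z * #|same_coset_set x x' :&: avoid_set y y'|%:Z
  - n%:Z * #|avoid_set x x' :&: same_coset_set y y'|%:Z
  + #|avoid_set x x' :&: avoid_set y y'|%:Z.
Proof.
have cE (A B : {set 'F_p}) : #|A :&: B|%:Z = \sum_a (a \in A)%:Z * (a \in B)%:Z.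
  rewrite -sum1_card big_mkcond /= (big_morph Posz PoszD (erefl 0)).
  apply: eq_bigr => a _; rewrite inE.
  by case: (a \in A); case: (a \in B).
rewrite !cE !mulr_sumr -!sumrB -big_split /=.
by apply: eq_bigr => a _; rewrite !Kz_sub; ring.
Qed.

Lemma card_setI_avoid (A : {set 'F_p}) y y' :
  (#|A| <= #|A :&: avoid_set y y'| + (y != y').+1)%N.
Proof.
rewrite addnC -(cards2 y y') addnC; apply: leq_trans (leq_card_setU _ _).
apply: subset_leq_card; apply/fintype.subsetP => a aA; rewrite !inE aA !subr_eq0 /=.
by case: (a == y); case: (a == y').
Qed.

Lemma card_avoid y y' : #|avoid_set y y'| = (p - (y != y').+1)%N.
Proof.
have -> : avoid_set y y' = ~: [set y; y'].
  by apply/setP => a; rewrite !inE !subr_eq0 negb_or.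
by have := cardsC [set y; y']; rewrite card_Fp // cards2 => E; rewrite -[X in (X - _)%N]E addKn.
Qed.

Lemma same_coset_set_sym x x' : same_coset_set x x' = same_coset_set x' x.
Proof. by apply/setP => a; rewrite !inE andbCA [in RHS](eq_sym _ ((a - x) ^+ m)). Qed.

Lemma avoid_set_sym x x' : avoid_set x x' = avoid_set x' x.
Proof. by apply/setP => a; rewrite !inE andbC. Qed.

Lemma same_coset_setxx x : same_coset_set x x = avoid_set x x.
Proof. by apply/setP => a; rewrite !inE eqxx andbT. Qed.

Lemma Ez_sym x x' y y' : Ez x x' y y' = Ez x' x y y'.
Proof. by rewrite !Ez_card (same_coset_set_sym x) (avoid_set_sym x). Qed.

(** The point [x'] may coincide with [y] or [y']. Hence, up to the symmetries of [Ez], this also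
    covers quadruples with [x != x'] and [y != y'] in which exactly one of the two pairs shares a
    point with the other. *)
Lemma Ez_generic x x' y y' : x != y -> x != y' -> x != x' -> y != y' ->
  k%:Z * `|Ez x x' y y'| <= n%:Z ^+ 2 * p%:Z + 16 * k%:Z * n%:Z ^+ 2.
Proof.
move=> xy xy' xx yy; have H1 := card_two_ratio_le 1 xy xy' xx yy.
have H2 := card_two_ratio_ge xy xy' xx yy.
have eN : two_ratio_set x x' y y' 1 = same_coset_set x x' :&: same_coset_set y y'.
  by apply/setP => a; rewrite !inE mul1r andbC.
rewrite eN in H1 H2; rewrite Ez_card.
have B1 := card_setI_avoid (same_coset_set x x') y y'.
have B2 := card_setI_avoid (same_coset_set y y') x x'.
have B3 := card_setI_avoid (avoid_set x x') y y'.
have B4 := subset_leq_card (finset.subsetIl (same_coset_set x x') (avoid_set y y')).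
have B5 := subset_leq_card (finset.subsetIr (avoid_set x x') (same_coset_set y y')).
have B6 := subset_leq_card (finset.subsetIl (avoid_set x x') (avoid_set y y')).
rewrite finset.setIC in B2.
rewrite !card_same_coset_set // card_avoid xx yy in B1 B2 B3 B4 B5 B6.
have pE : p = (n * m).+1 by rewrite -pnm prednK.
exact: (generic_arith pE m0 n0 H1 H2 B1 B2 B4 B5 B3 B6).
Qed.

Lemma Ez_swap x x' y y' : Ez x x' y y' = Ez y y' x x'.
Proof. by apply: eq_bigr => a _; rewrite mulrC. Qed.

(** For x = x' the first kernel is the constant n - 1 away from a = x, and the second one has almost
    zero sum: n (m - 1) from equal classes against p - 2. No term of order p survives. *)
Lemma Ez_degenerate x y y' : y != y' -> `|Ez x x y y'| <= 16 * n%:Z ^+ 2.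
Proof.
move=> yy; rewrite Ez_card same_coset_setxx.
have B1 := card_setI_avoid (same_coset_set y y') x x.
have B2 := card_setI_avoid (avoid_set y y') x x.
have B3 := subset_leq_card (finset.subsetIr (avoid_set x x) (same_coset_set y y')).
have B4 := subset_leq_card (finset.subsetIr (avoid_set x x) (avoid_set y y')).
rewrite finset.setIC in B1; rewrite finset.setIC in B2.
have pE : p = (n * m).+1 by rewrite -pnm prednK.
rewrite !card_same_coset_set // ?card_avoid eqxx yy /= in B1 B2 B3 B4.
move: #|_ :&: _| #|_ :&: _| B1 B2 B3 B4 => B A B1 B2 B3 B4.
have {}B1 : m%:Z <= A%:Z + 2 by lia.
have {}B3 : A%:Z <= m%:Z - 1 by have := m0; lia.
have {}B2 : n%:Z * m%:Z <= B%:Z + 2 by lia.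
have {}B4 : B%:Z <= n%:Z * m%:Z - 1 by have := m0; have := n0; nia.
have n1 : 1 <= n%:Z by have := n0; lia.
have -> : n%:Z ^+ 2 * A%:Z - n%:Z * B%:Z - n%:Z * A%:Z + B%:Z =
  (n%:Z - 1) * (n%:Z * A%:Z - B%:Z) by ring.
rewrite normrM (ger0_norm (_ : 0 <= n%:Z - 1)) ?subr_ge0 //.
have D : `|n%:Z * A%:Z - B%:Z| <= 2 * n%:Z + 2.
  by rewrite ler_norml; apply/andP; split; nia.
apply: le_trans (ler_wpM2l _ D) _; first by rewrite subr_ge0.
nia.
Qed.

Lemma Ez_pair x y : x != y -> `|Ez x y x y - p%:Z * (n%:Z - 1)| <= 16 * n%:Z ^+ 2.
Proof.
move=> xy; rewrite Ez_card !finset.setIid.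
have -> : same_coset_set x y :&: avoid_set x y = same_coset_set x y.
  by apply/finset.setIidPl/fintype.subsetP => a; rewrite !inE => /and3P[-> ->].
rewrite [avoid_set x y :&: _]finset.setIC.
have -> : same_coset_set x y :&: avoid_set x y = same_coset_set x y.
  by apply/finset.setIidPl/fintype.subsetP => a; rewrite !inE => /and3P[-> ->].
have pE : p = (n * m).+1 by rewrite -pnm prednK.
rewrite card_same_coset_set // card_avoid xy pE.
have -> : (((n * m).+1 - 2)%N)%:Z = n%:Z * m%:Z - 1.
  have := muln_gt0 n m; rewrite n0 m0; lia.
have -> : m.-1%:Z = m%:Z - 1 by have := m0; lia.
have -> : (n * m).+1%:Z = n%:Z * m%:Z + 1 by lia.
set N := n%:Z; set M := m%:Z.
have -> : N ^+ 2 * (M - 1) - N * (M - 1) - N * (M - 1) + (N * M - 1) - (N * M + 1) * (N - 1) =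
  - N ^+ 2 + N by ring.
have n1 : 1 <= N by have := n0; rewrite /N; lia.
by rewrite ler_norml; apply/andP; split; nia.
Qed.

Lemma Ez_diag x y : `|Ez x x y y - p%:Z * (n%:Z - 1) ^+ 2| <= 16 * n%:Z ^+ 2.
Proof.
rewrite Ez_card !same_coset_setxx; set A := #|_ :&: _|.
have B1 : (p - 1 <= A + 1)%N.
  by have := card_setI_avoid (avoid_set x x) y y; rewrite card_avoid !eqxx.
have B2 : (A <= p - 1)%N.
  by have := subset_leq_card (finset.subsetIl (avoid_set x x) (avoid_set y y));
    rewrite card_avoid !eqxx.
have -> : n%:Z ^+ 2 * A%:Z - n%:Z * A%:Z - n%:Z * A%:Z + A%:Z - p%:Z * (n%:Z - 1) ^+ 2 =
  - (p%:Z - A%:Z) * (n%:Z - 1) ^+ 2 by ring.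
have {}B1 : p%:Z - A%:Z <= 2 by lia.
have {}B2 : 0 <= p%:Z - A%:Z by lia.
rewrite mulNr normrN normrM (ger0_norm B2) (ger0_norm (sqr_ge0 _)).
have n1 : 1 <= n%:Z by have := n0; lia.
nia.
Qed.

(** When all four points coincide, the three pairings counted in [Ez_main] hold at once although the
    value is only about p (n - 1)^2; its last term removes the excess. *)
Theorem Ez_bound x x' y y' :
  k%:Z * `|Ez x x' y y' - p%:Z * Ez_main x x' y y'| <= n%:Z ^+ 2 * p%:Z + 16 * k%:Z * n%:Z ^+ 2.
Proof.
have weak (D : int) : `|D| <= 16 * n%:Z ^+ 2 ->
    k%:Z * `|D| <= n%:Z ^+ 2 * p%:Z + 16 * k%:Z * n%:Z ^+ 2.
  move=> H; rewrite -[leLHS]add0r lerD ?mulr_ge0 ?sqr_ge0 //.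
  by rewrite mulrAC [16 * _ * _]mulrC ler_wpM2l.
rewrite /Ez_main.
have [<-|xx] := eqVneq x x'; have [<-|yy] := eqVneq y y'.
- apply: weak.
  have -> : (n%:Z - 1) ^+ 2 * (true && true)%:Z + (n%:Z - 1) *
     (((x == y) && (x == y))%:Z + ((x == y) && (x == y))%:Z) -
     2 * (n%:Z - 1) * [&& true, true & x == y]%:Z = (n%:Z - 1) ^+ 2.
    by case: (x == y) => /=; ring.
  exact: Ez_diag.
- apply: weak; rewrite /= !mulr0 add0r subr0.
  have -> : (x == y) && (x == y') = false.
    by apply/negP => /andP[/eqP E1 /eqP E2]; rewrite -E1 -E2 eqxx in yy.
  have -> : (x == y') && (x == y) = false.
    by apply/negP => /andP[/eqP E1 /eqP E2]; rewrite -E1 -E2 eqxx in yy.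
  by rewrite !mulr0 subr0; exact: Ez_degenerate.
- apply: weak; rewrite /= !mulr0 add0r subr0.
  have -> : (x == y) && (x' == y) = false.
    by apply/negP => /andP[/eqP E /eqP E']; rewrite E E' eqxx in xx.
  by rewrite !mulr0 subr0 Ez_swap; exact: Ez_degenerate.
- rewrite /= !mulr0 subr0 add0r.
  have [E|xy] := eqVneq x y.
    subst y; have [<-|xy'] := eqVneq x' y'.
      rewrite (negPf xx) /= addr0 mulr1; apply: weak; exact: Ez_pair.
    rewrite (negPf yy) /= !mulr0 subr0 Ez_sym; apply: Ez_generic => //; by rewrite eq_sym.
  have [E|xy'] := eqVneq x y'; last first.
    by rewrite /= !mulr0 subr0; exact: Ez_generic.
  subst y'; have [<-|xy2] := eqVneq x' y.
    rewrite /= add0r mulr1; apply: weak.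
    by rewrite Ez_swap Ez_sym; exact: Ez_pair.
  rewrite /= !mulr0 subr0 Ez_sym; apply: Ez_generic => //; by rewrite eq_sym.
Qed.
End CyclotomicCount.

(** * Fourier analysis on F_p *)

Section ComplexAbs.
Variable R : realType.
Implicit Types x y z : R[i].

Definition cabs (z : R[i]) : R := Normc.normc z.

Lemma cabs2E z : (cabs2 z)%:C%C = z * conjc z.
Proof. by rewrite /cabs2 add_Re2_Im2 sqr_normc. Qed.

Lemma real_complex_inj : injective (real_complex R).
Proof. by move=> x y [->]. Qed.

Lemma cabs2_ge0 z : 0 <= cabs2 z.
Proof. by rewrite addr_ge0 // sqr_ge0. Qed.

Lemma cabs2M y z : cabs2 (y * z) = cabs2 y * cabs2 z.
Proof.
apply: real_complex_inj; rewrite rmorphM /= !cabs2E rmorphM /=; ring.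
Qed.

Lemma cabs2_conj z : cabs2 (conjc z) = cabs2 z.
Proof. by case: z => a b; rewrite /cabs2 /= sqrrN. Qed.

Lemma cabs2N z : cabs2 (- z) = cabs2 z.
Proof. by case: z => a b; rewrite /cabs2 /= !sqrrN. Qed.

Lemma cabs2_real (a : R) : cabs2 (a%:C)%C = a ^+ 2.
Proof. by rewrite /cabs2 /= expr0n addr0. Qed.

Lemma cabs2_0 : cabs2 (0 : R[i]) = 0.
Proof. by rewrite /cabs2 /= expr0n addr0. Qed.

Lemma cabs2_1 : cabs2 (1 : R[i]) = 1.
Proof. by rewrite /cabs2 /= expr0n addr0 expr1n. Qed.

Lemma cabs2X z k : cabs2 (z ^+ k) = cabs2 z ^+ k.
Proof. by elim: k => [|k IH]; rewrite ?expr0 ?cabs2_1 // !exprS cabs2M IH. Qed.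

Lemma cabs_sqr z : cabs z ^+ 2 = cabs2 z.
Proof.
by case: z => a b; rewrite /cabs /cabs2 /= sqr_sqrtr // addr_ge0 // sqr_ge0.
Qed.

Lemma cabs_ge0 z : 0 <= cabs z.
Proof. by case: z => a b; rewrite /cabs /= sqrtr_ge0. Qed.

Lemma cabsM y z : cabs (y * z) = cabs y * cabs z.
Proof. exact: Normc.normcM. Qed.

Lemma cabsD y z : cabs (y + z) <= cabs y + cabs z.
Proof. exact: le_normcD. Qed.

Lemma cabs_real (a : R) : cabs (a%:C)%C = `|a|.
Proof. by rewrite /cabs /= expr0n addr0 sqrtr_sqr. Qed.

Lemma cabs0 : cabs 0 = 0. Proof. exact: Normc.normc0. Qed.

Lemma cabs_sum (I : finType) (P : pred I) (F : I -> R[i]) :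
  cabs (\sum_(i | P i) F i) <= \sum_(i | P i) cabs (F i).
Proof.
elim/big_rec2: _ => [|i y z _ H]; first by rewrite cabs0.
by apply: le_trans (cabsD _ _) _; rewrite lerD2l.
Qed.

Lemma cabs_eq1 z : cabs2 z = 1 -> cabs z = 1.
Proof.
by move=> z1; apply/eqP; rewrite -(@eqrXn2 _ 2) ?cabs_ge0 // cabs_sqr z1 expr1n.
Qed.

Lemma cabs_conj z : cabs (conjc z) = cabs z.
Proof. by case: z => a b; rewrite /cabs /= sqrrN. Qed.

Lemma cabs2_add_le (eta : R) y z : 0 < eta ->
  cabs2 (y + z) <= (1 + eta) * cabs2 y + (1 + eta^-1) * cabs2 z.
Proof.
case: y z => [a b] [c d] e0; rewrite /cabs2 /=.
have H u v : (u + v) ^+ 2 <= (1 + eta) * u ^+ 2 + (1 + eta^-1) * v ^+ 2 :> R.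
  rewrite -subr_ge0.
  have -> : (1 + eta) * u ^+ 2 + (1 + eta^-1) * v ^+ 2 - (u + v) ^+ 2 =
    (eta * u - v) ^+ 2 / eta by field; rewrite gt_eqF.
  by rewrite divr_ge0 ?sqr_ge0 // ltW.
by have := H a c; have := H b d; lra.
Qed.

End ComplexAbs.

Section AdditiveCharacter.
Variables (R : realType) (p : nat) (z : R[i]).
Hypothesis pp : prime p.
Hypothesis zp : z ^+ p = - 1.
Hypothesis z1 : cabs2 z = 1.
Hypothesis zprim : (2 * p).-primitive_root z.

Let p0 : (0 < p)%N. Proof. exact: prime_gt0. Qed.

Definition echar (x : 'F_p) : R[i] := z ^+ (2 * x).

Lemma exp_z2p k : z ^+ (2 * p * k) = 1.
Proof. by rewrite exprM (prim_expr_order zprim) expr1n. Qed.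

Lemma echar_nat k : echar (k%:R) = z ^+ (2 * k).
Proof.
rewrite /echar val_Fp_nat //.
have -> : (2 * k = 2 * p * (k %/ p) + 2 * (k %% p))%N.
  by rewrite {1}(divn_eq k p) mulnDr [(k %/ p * p)%N]mulnC mulnA.
by rewrite exprD exp_z2p mul1r.
Qed.

Lemma echarD x y : echar (x + y) = echar x * echar y.
Proof. by rewrite -[x]natr_Zp -[y]natr_Zp -natrD !echar_nat mulnDr exprD. Qed.

Lemma echar0 : echar 0 = 1. Proof. by rewrite /echar muln0. Qed.

Lemma cabs2_echar x : cabs2 (echar x) = 1.
Proof. by rewrite cabs2X z1 expr1n. Qed.

Lemma conj_echar x : conjc (echar x) = echar (- x).
Proof.
have u : echar x * conjc (echar x) = 1 by rewrite -cabs2E cabs2_echar.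
have v : echar x * echar (- x) = 1 by rewrite -echarD subrr echar0.
have x0 : echar x != 0 by apply/eqP => E; move/eqP: u; rewrite E mul0r eq_sym oner_eq0.
by apply: (mulfI x0); rewrite u v.
Qed.

Lemma echar_neq1 x : x != 0 -> echar x != 1.
Proof.
move=> x0; rewrite /echar -(prim_order_dvd zprim) dvdn_pmul2l // gtnNdvd //.
  by rewrite lt0n.
by have := ltn_ord x; rewrite [X in (_ < X)%N](Fp_cast pp).
Qed.

Lemma sum_echar a : \sum_x echar (a * x) = if a == 0 then p%:R else 0.
Proof.
have [->|a0] := eqVneq a 0.
  rewrite (eq_bigr (fun=> 1)) => [|x _]; last by rewrite mul0r echar0.
  by rewrite sumr_const card_Fp.
have E : (\sum_x echar (a * x)) * echar a = \sum_x echar (a * x).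
  rewrite mulr_suml [RHS](reindex_inj (addIr 1)) /=.
  by apply: eq_bigr => x _; rewrite -echarD mulrDr mulr1.
apply/eqP; move/eqP: E; rewrite -subr_eq0 -{2}[\sum_x _]mulr1 -mulrBr mulf_eq0 subr_eq0.
by rewrite (negPf (echar_neq1 a0)) orbF.
Qed.

Lemma parseval (v : 'F_p -> R[i]) :
  \sum_x cabs2 (\sum_j v j * echar (x * j)) = p%:R * \sum_j cabs2 (v j).
Proof.
apply: real_complex_inj; rewrite rmorphM !rmorph_sum /= rmorph_nat.
under eq_bigr do rewrite cabs2E rmorph_sum /= big_distrlr /=.
rewrite exchange_big mulr_sumr /=; apply: eq_bigr => j _.
rewrite exchange_big /= (bigD1 j) //= [X in _ + X]big1 ?addr0.
  under eq_bigr do rewrite rmorphM /= conj_echar mulrACA -echarD subrr echar0 mulr1 -cabs2E.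
  by rewrite sumr_const card_Fp // mulr_natl.
move=> k kj.
under eq_bigr do rewrite rmorphM /= conj_echar mulrACA -echarD -mulrBr mulrC [_ * (j - k)]mulrC.
by rewrite -mulr_suml sum_echar subr_eq0 eq_sym (negPf kj) mul0r.
Qed.

Definition fhat (f : 'F_p -> R[i]) (a : 'F_p) := \sum_x f x * echar (a * x).

Lemma fhat_inv f x : f x = p%:R^-1 * \sum_a fhat f a * echar (- (a * x)).
Proof.
have pn0 : p%:R != 0 :> R[i] by rewrite pnatr_eq0 -lt0n.
apply: (mulfI pn0); rewrite mulrA divff // mul1r.
under eq_bigr do rewrite /fhat mulr_suml.
rewrite exchange_big /= (bigD1 x) //= [X in _ + X]big1 ?addr0.
  under eq_bigr do rewrite -mulrA -echarD subrr echar0 mulr1.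
  by rewrite sumr_const card_Fp // mulr_natl.
move=> k kj.
under eq_bigr do rewrite -mulrA -echarD -mulrBr [_ * (_ - _)]mulrC.
by rewrite -mulr_sumr sum_echar subr_eq0 (negPf kj) mulr0.
Qed.

Lemma sum_echar_neq0 c : \sum_(y | y != 0) echar (c * y) = (c == 0)%:R * p%:R - 1.
Proof.
have := sum_echar c; rewrite (bigD1 0) //= mulr0 echar0 => E.
rewrite -[LHS](addKr 1) E addrC; case: eqP => _; rewrite ?mul1r ?mul0r //.
Qed.

Variables (n m : nat) (a0 : 'F_p).
Hypothesis pnm : p.-1 = (n * m)%N.
Hypothesis n0 : (0 < n)%N.
Hypothesis m0 : (0 < m)%N.
Hypothesis ha0 : (p.-1).-primitive_root a0.

(** For y nonzero, the x in the class of y are h y with h an m-th root of unity. Summing over y then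
    leaves p times the number of h with a h = b, plus corrections that assemble into the -1 of the
    kernel. Equivalently, every nontrivial Gauss sum has squared modulus p. *)
Lemma Kz_hat a b :
  \sum_x \sum_y (Kz n m x y)%:~R * echar (a * x) * echar (- (b * y)) =
  p%:R * (Kz n m a b)%:~R :> R[i].
Proof.
have pE : p%:R = n%:R * m%:R + 1 :> R[i].
  by rewrite -natrM -pnm -[in LHS](prednK p0) -addn1 natrD.
pose mu := [set h : 'F_p | h ^+ m == 1].
have cmu : #|mu| = m := card_roots_m pnm m0 ha0.
have h0 h : h \in mu -> h != 0.
  by rewrite inE; apply: contraTneq => ->; rewrite expr0n gtn_eqF // eq_sym oner_eq0.
have inner y : y != 0 -> \sum_x (Kz n m x y)%:~R * echar (a * x) =
    n%:R * \sum_(h in mu) echar (a * h * y) - ((a == 0)%:R * p%:R - 1).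
  move=> y0; rewrite -sum_echar_neq0.
  have -> : \sum_(h in mu) echar (a * h * y) =
      \sum_(x | (x != 0) && (x ^+ m == y ^+ m)) echar (a * x).
    rewrite [RHS](reindex_inj (mulIf y0)) /=; apply: eq_big => [h|h _]; last by rewrite mulrA.
    rewrite inE exprMn -(inj_eq (mulIf (expf_neq0 m y0))) mul1r.
    case: eqP => [E|]; rewrite ?andbF // andbT; apply/esym/mulf_neq0 => //.
    apply: contra_eq_neq E => ->; rewrite expr0n gtn_eqF // mul0r eq_sym; exact: expf_neq0.
  rewrite mulr_sumr big_mkcondr /= -sumrB [RHS]big_mkcond /=.
  apply: eq_bigr => x _; rewrite /Kz (negPf y0) orbF.
  case: eqP => [|_] /=; first by rewrite mul0r.
  case: ifP => _; last by rewrite mulrN1z mulN1r sub0r.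
  by rewrite intrB mulrBl mul1r.
transitivity (\sum_(y | y != 0)
   (n%:R * \sum_(h in mu) echar (a * h * y) - ((a == 0)%:R * p%:R - 1)) * echar (- b * y)).
  rewrite exchange_big [RHS]big_mkcond /=; apply: eq_bigr => y _.
  have [->|y0] := eqVneq y 0.
    by apply: big1 => x _; rewrite /Kz eqxx orbT !mul0r.
  by rewrite -mulr_suml inner // mulNr.
under eq_bigr do rewrite mulrBl -mulrA.
rewrite sumrB -!mulr_sumr sum_echar_neq0.
under eq_bigr do rewrite mulr_suml.
rewrite exchange_big /=.
under eq_bigr do under eq_bigr do rewrite -echarD -mulrDl.
under eq_bigr do rewrite sum_echar_neq0 subr_eq0.
rewrite sumrB sumr_const cmu -mulr_suml oppr_eq0.
rewrite /Kz; have [->|a00] := eqVneq a 0; have [->|b0] := eqVneq b 0 => /=.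
- rewrite sumr_const cmu pE; ring.
- under eq_bigr do rewrite mul0r eq_sym (negPf b0).
  rewrite sumr_const cmu mul0rn pE; ring.
- under eq_bigr => h hmu do rewrite mulf_eq0 (negPf a00) (negPf (h0 h hmu)).
  rewrite sumr_const cmu mul0rn pE; ring.
- have -> : \sum_(h in mu) (a * h == b)%:R = (a ^+ m == b ^+ m)%:R :> R[i].
    have E h : (a * h == b) = (h == b / a).
      by rewrite -[RHS](inj_eq (mulIf a00)) divfK // [h * a]mulrC.
    under eq_bigr do rewrite E.
    rewrite big_mkcond (bigD1 (b / a)) //= big1 ?addr0; last first.
      by move=> h /negPf ->; case: ifP.
    rewrite eqxx inE expr_div_n -(inj_eq (mulIf (expf_neq0 m a00))) divfK ?expf_neq0 //.
    by rewrite mul1r eq_sym; case: eqP.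
  case: eqP => _; rewrite ?intrB ?mulrN1z pE /=; ring.
Qed.

Variables (I : finType) (f : I -> 'F_p -> R[i]).
Hypothesis Hf : forall x y, \sum_d f d x * conjc (f d y) = (Kz n m x y)%:~R.

Lemma sum_fhat a b :
  \sum_d fhat (f d) a * conjc (fhat (f d) b) = p%:R * (Kz n m a b)%:~R.
Proof.
rewrite -Kz_hat /fhat.
under eq_bigr do rewrite rmorph_sum /= big_distrlr /=.
rewrite exchange_big /=; apply: eq_bigr => x _.
rewrite exchange_big /=; apply: eq_bigr => y _.
rewrite -Hf !mulr_suml; apply: eq_bigr => d _.
by rewrite rmorphM /= conj_echar; ring.
Qed.

Definition fourth_moment (B : I -> 'F_p -> R[i]) : R := \sum_a (\sum_d cabs2 (B d a)) ^+ 2.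

Definition smear (k : 'F_p -> R[i]) (g : 'F_p -> R[i]) (a : 'F_p) : R[i] :=
  \sum_x k x * g (a - x).

(** The pairings of [Ez_main] contracted with k, conj k, k, conj k. Only the pairing x = y, x' = y'
    sees the phases of [k], through the modulus of the sum of squares; this is how the rotation
    enters the limit. *)
Definition smear_main (k : 'F_p -> R[i]) : R :=
  (n%:R - 1) ^+ 2 * (\sum_x cabs2 (k x)) ^+ 2 +
  (n%:R - 1) * (cabs2 (\sum_x k x ^+ 2) + (\sum_x cabs2 (k x)) ^+ 2
     - 2 * \sum_x cabs2 (k x) ^+ 2).

Lemma fourth_moment_fhat : fourth_moment (fun d => fhat (f d)) =
  p%:R ^+ 2 * (n%:R - 1) ^+ 2 * (p.-1)%:R.
Proof.
have E a : \sum_d cabs2 (fhat (f d) a) = (a != 0)%:R * (p%:R * (n%:R - 1)).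
  apply: real_complex_inj; rewrite rmorph_sum /=.
  under eq_bigr do rewrite cabs2E.
  rewrite sum_fhat; have [->|a00] := eqVneq a 0; first by rewrite /Kz eqxx mul0r mulr0.
  by rewrite Kz_diag // mul1r intrB rmorphM /= rmorphB /= !rmorph_nat.
rewrite /fourth_moment; under eq_bigr do rewrite E exprMn.
rewrite -mulr_suml exprMn mulrC; congr (_ * _).
rewrite (bigD1 0) //= expr0n add0r (eq_bigr (fun=> 1)); last first.
  by move=> x ->; rewrite expr1n.
by rewrite sumr_const; congr (_ *+ _); rewrite (eq_card (_ : _ =i predC1 0)) // cardC1 card_Fp.
Qed.

Lemma sum_delta (T : finType) (F : T -> R[i]) a : \sum_x F x * (a == x)%:R = F a.
Proof.
rewrite (bigD1 a) //= eqxx mulr1 big1 ?addr0 // => x xa.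
by rewrite eq_sym (negPf xa) mulr0.
Qed.

Lemma Ez_main_complex (x x' y y' : 'F_p) : (Ez_main n x x' y y')%:~R =
  (n%:R - 1) ^+ 2 * ((y == y')%:R * (x == x')%:R)
  + (n%:R - 1) * ((x' == y')%:R * (x == y)%:R + (x == y')%:R * (x' == y)%:R)
  - 2 * (n%:R - 1) * ((y == y')%:R * (x == y)%:R * (x == x')%:R) :> R[i].
Proof.
rewrite /Ez_main !expr2 intrB intrD !intrM !intrB intrD.
have B (b c : bool) : ((b && c)%:Z)%:~R = b%:R * c%:R :> R[i].
  by case: b; case: c; rewrite ?mulr1 ?mulr0.
rewrite !B -(mulnb (y == _)) natrM -!pmulrn; ring.
Qed.

Lemma Ez_main_sum_aux (A : 'F_p -> 'F_p -> 'F_p -> 'F_p -> R[i]) :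
  \sum_x \sum_x' \sum_y \sum_y' A x x' y y' * (Ez_main n x x' y y')%:~R =
  (n%:R - 1) ^+ 2 * (\sum_x \sum_y A x x y y)
  + (n%:R - 1) * ((\sum_x \sum_y A x y x y) + (\sum_x \sum_y A x y y x))
  - 2 * (n%:R - 1) * (\sum_x A x x x x).
Proof.
set N := n%:R - 1 : R[i].
transitivity (\sum_x \sum_x' \sum_y \sum_y'
   (N ^+ 2 * (A x x' y y' * (x == x')%:R * (y == y')%:R)
   + N * (A x x' y y' * (x == y)%:R * (x' == y')%:R)
   + N * (A x x' y y' * (x' == y)%:R * (x == y')%:R)
   - 2 * N * (A x x' y y' * (x == x')%:R * (x == y)%:R * (y == y')%:R))).
  do 4!(apply: eq_bigr => ? _); rewrite Ez_main_complex -/N; ring.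
rewrite !mulrDr addrA !mulr_sumr -!big_split -sumrB /=; apply: eq_bigr => x _.
under eq_bigr do under eq_bigr do rewrite sumrB !big_split /= -!mulr_sumr !sum_delta.
under eq_bigr do rewrite sumrB !big_split /= -!mulr_sumr !sum_delta -mulr_suml.
by rewrite sumrB !big_split /= -!mulr_sumr !sum_delta.
Qed.

Lemma Ez_main_sum (k : 'F_p -> R[i]) :
  \sum_x \sum_x' \sum_y \sum_y' k x * conjc (k x') * (k y * conjc (k y')) *
    (Ez_main n x x' y y')%:~R = (smear_main k)%:C%C.
Proof.
rewrite (Ez_main_sum_aux (fun x x' y y' => k x * conjc (k x') * (k y * conjc (k y')))).
have N2 : \sum_x k x * conjc (k x) = ((\sum_x cabs2 (k x))%:C)%C.
  by rewrite rmorph_sum; apply: eq_bigr => x _; rewrite /= cabs2E.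
have -> : \sum_x \sum_y k x * conjc (k x) * (k y * conjc (k y)) =
    ((\sum_x cabs2 (k x)) ^+ 2)%:C%C.
  by rewrite rmorphXn /= -N2 expr2 big_distrlr.
have -> : \sum_x \sum_y k x * conjc (k y) * (k x * conjc (k y)) =
    (cabs2 (\sum_x k x ^+ 2))%:C%C.
  rewrite cabs2E rmorph_sum /= big_distrlr /=.
  by apply: eq_bigr => x _; apply: eq_bigr => y _; rewrite rmorphXn /=; ring.
have -> : \sum_x \sum_y k x * conjc (k y) * (k y * conjc (k x)) =
    ((\sum_x cabs2 (k x)) ^+ 2)%:C%C.
  by rewrite rmorphXn /= -N2 expr2 big_distrlr /=; do 2!(apply: eq_bigr => ? _); ring.
have -> : \sum_x k x * conjc (k x) * (k x * conjc (k x)) =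
    (\sum_x cabs2 (k x) ^+ 2)%:C%C.
  by rewrite rmorph_sum /=; apply: eq_bigr => x _; rewrite rmorphXn /= cabs2E expr2.
have nE : (n%:R - 1 : R[i]) = (n%:R - 1)%:C%C by rewrite rmorphB /= rmorph_nat.
rewrite nE -[2](rmorph_nat (real_complex R)) /smear_main.
by rewrite -!(rmorphXn, rmorphM, rmorphD, rmorphB) /=; congr (_ %:C)%C; ring.
Qed.

Lemma fourth_moment_smear_expand (k : 'F_p -> R[i]) :
  (fourth_moment (fun d => smear k (fhat (f d))))%:C%C = p%:R ^+ 2 *
  \sum_x \sum_x' \sum_y \sum_y' k x * conjc (k x') * (k y * conjc (k y')) *
    (Ez n m x x' y y')%:~R.
Proof.
have E a : ((\sum_d cabs2 (smear k (fhat (f d)) a))%:C)%C =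
    p%:R * \sum_x \sum_x' k x * conjc (k x') * (Kz n m (a - x) (a - x'))%:~R.
  rewrite rmorph_sum /=; under eq_bigr do rewrite cabs2E rmorph_sum /= big_distrlr /=.
  rewrite exchange_big mulr_sumr /=; apply: eq_bigr => x _.
  rewrite exchange_big mulr_sumr /=; apply: eq_bigr => y _.
  rewrite mulrCA -sum_fhat mulr_sumr; apply: eq_bigr => d _.
  by rewrite rmorphM /=; ring.
rewrite /fourth_moment rmorph_sum /=.
under eq_bigr do rewrite rmorphXn /= E exprMn.
rewrite -mulr_sumr; congr (_ * _).
transitivity (\sum_a \sum_x \sum_x' \sum_y \sum_y' k x * conjc (k x') *
  (k y * conjc (k y')) * ((Kz n m (a - x) (a - x'))%:~R * (Kz n m (a - y) (a - y'))%:~R)).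
  apply: eq_bigr => a _; rewrite expr2 mulr_suml; apply: eq_bigr => x _.
  rewrite mulr_suml; apply: eq_bigr => x' _.
  rewrite mulr_sumr; apply: eq_bigr => y _.
  rewrite mulr_sumr; apply: eq_bigr => y' _.
  by rewrite mulrACA.
rewrite exchange_big /=; apply: eq_bigr => x _.
rewrite exchange_big /=; apply: eq_bigr => x' _.
rewrite exchange_big /=; apply: eq_bigr => y _.
rewrite exchange_big /=; apply: eq_bigr => y' _.
rewrite -mulr_sumr /Ez rmorph_sum /=; congr (_ * _).
by apply: eq_bigr => a _; rewrite intrM.
Qed.

Variable eps : R.
Hypothesis Heps : forall x x' y y' : 'F_p,
  `|(Ez n m x x' y y' - p%:Z * Ez_main n x x' y y')%:~R| <= eps.

(** The kernel is arbitrary because the estimate serves twice: for the interpolation kernel itself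
    and for the difference of two rotated ones. *)
Lemma fourth_moment_smear (k : 'F_p -> R[i]) :
  `|fourth_moment (fun d => smear k (fhat (f d))) - p%:R ^+ 3 * smear_main k| <=
  p%:R ^+ 2 * eps * (\sum_x cabs (k x)) ^+ 4.
Proof.
rewrite -cabs_real.
have -> : ((fourth_moment (fun d => smear k (fhat (f d))) - p%:R ^+ 3 * smear_main k)%:C)%C =
    ((fourth_moment (fun d => smear k (fhat (f d))))%:C)%C - p%:R ^+ 3 * (smear_main k)%:C%C.
  by rewrite rmorphB rmorphM rmorphXn rmorph_nat.
rewrite fourth_moment_smear_expand -Ez_main_sum.
set X := \sum_x cabs (k x).
have -> : (p%:R ^+ 3 : R[i]) = p%:R ^+ 2 * p%:R by rewrite exprSr.
rewrite -mulrA -mulrBr cabsM.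
have -> : cabs (p%:R ^+ 2 : R[i]) = p%:R ^+ 2.
  by rewrite -(rmorph_nat (real_complex R)) -rmorphXn cabs_real ger0_norm // exprn_ge0.
rewrite -mulrA ler_wpM2l ?exprn_ge0 //.
have -> : eps * X ^+ 4 = \sum_x \sum_x' \sum_y \sum_y'
   cabs (k x) * cabs (k x') * (cabs (k y) * cabs (k y')) * eps.
  rewrite [X ^+ 4](_ : _ = (X * X) * (X * X)); last by ring.
  rewrite {1 2}/X big_distrlr /= mulr_suml mulr_sumr; apply: eq_bigr => x _.
  rewrite mulr_suml mulr_sumr; apply: eq_bigr => x' _.
  rewrite !mulr_sumr; apply: eq_bigr => y _.
  rewrite !mulr_sumr; apply: eq_bigr => y' _; ring.
rewrite mulr_sumr -sumrB; apply: le_trans (cabs_sum _ _) _; apply: ler_sum => x _.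
rewrite mulr_sumr -sumrB; apply: le_trans (cabs_sum _ _) _; apply: ler_sum => x' _.
rewrite mulr_sumr -sumrB; apply: le_trans (cabs_sum _ _) _; apply: ler_sum => y _.
rewrite mulr_sumr -sumrB; apply: le_trans (cabs_sum _ _) _; apply: ler_sum => y' _.
have -> : k x * conjc (k x') * (k y * conjc (k y')) * (Ez n m x x' y y')%:~R -
  p%:R * (k x * conjc (k x') * (k y * conjc (k y')) * (Ez_main n x x' y y')%:~R) =
  k x * conjc (k x') * (k y * conjc (k y')) * (Ez n m x x' y y' - p%:Z * Ez_main n x x' y y')%:~R.
  by rewrite intrB intrM; ring.
rewrite !cabsM !cabs_conj ler_wpM2l ?mulr_ge0 ?cabs_ge0 //.
by apply: le_trans (Heps x x' y y'); rewrite -cabs_real rmorph_int.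
Qed.

End AdditiveCharacter.

(** * Interpolation at the odd frequencies *)

Section InterpolationKernel.
Variables (R : realType) (p : nat) (z : R[i]).
Hypothesis pp : prime p.
Hypothesis zp : z ^+ p = - 1.
Hypothesis z1 : cabs2 z = 1.
Hypothesis zprim : (2 * p).-primitive_root z.

Local Notation echar := (@echar R p z).
Let p0 : (0 < p)%N. Proof. exact: prime_gt0. Qed.
Let pR : (p%:R != 0 :> R). Proof. by rewrite pnatr_eq0 -lt0n. Qed.
Let pC : (p%:R != 0 :> R[i]). Proof. by rewrite pnatr_eq0 -lt0n. Qed.

(* The transform of a sequence at z ^+ (2 a + 1) is the convolution of its
   transform on the even powers of z with cker. *)
Definition cker (x : 'F_p) : R[i] := p%:R^-1 * \sum_(j : 'F_p) z ^+ j * echar (x * j).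
Definition rker (r x : 'F_p) : R[i] := cker x * echar (r * x).

Lemma ltn_Fp (x : 'F_p) : (x < p)%N.
Proof. by have := ltn_ord x; rewrite [X in (_ < X)%N](Fp_cast pp). Qed.

Lemma val_FpD (x y : 'F_p) : nat_of_ord (x + y)%R = ((x + y) %% p)%N.
Proof. by rewrite /= [X in (_ %% X)%N](Fp_cast pp). Qed.

(** This records the carry in addition of representatives modulo p. Since [z ^+ p = - 1], a carry
    turns into a sign. *)
Lemma val_FpB (k j : 'F_p) : (j + (k - j)%R)%N = (k + (k < j)%N * p)%N.
Proof.
have := val_FpD j (k - j); rewrite addrC subrK.
have := ltn_Fp j; have := ltn_Fp k; have := ltn_Fp (k - j).
set q := nat_of_ord (k - j)%R; move=> q1 q2 q3.
have [h|h] := ltnP (j + q) p.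
  rewrite modn_small // => ->; rewrite ltnNge leq_addr /= mul0n addn0 //.
move=> E; have {}E : nat_of_ord k = (j + q - p)%N.
  rewrite E -{1}(subnK h) modnDr modn_small //; lia.
have -> : (k < j)%N = true by rewrite E; lia.
by rewrite E mul1n subnK.
Qed.

Lemma sum_ltn_Fp d : (d <= p)%N -> (\sum_(j : 'F_p) (j < d) = d)%N.
Proof.
move=> dp; have dp' : (d <= (Zp_trunc (pdiv p)).+2)%N by rewrite (Fp_cast pp).
rewrite -[RHS](card_ord d) -sum1_card (big_ord_widen _ (fun=> 1%N) dp') [RHS]big_mkcond /=.
by apply: eq_bigr => j _; case: (_ < _)%N.
Qed.

Lemma cabs2_invp : cabs2 (p%:R^-1 : R[i]) = p%:R ^- 2.
Proof. by rewrite -(rmorph_nat (real_complex R)) -fmorphV cabs2_real exprVn. Qed.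

Lemma parseval_ker (v : 'F_p -> R[i]) :
  \sum_x cabs2 (p%:R^-1 * \sum_(j : 'F_p) v j * echar (x * j)) =
  p%:R^-1 * \sum_j cabs2 (v j).
Proof.
under eq_bigr do rewrite cabs2M cabs2_invp.
rewrite -mulr_sumr (parseval pp z1 zprim) mulrA; congr (_ * _).
by rewrite expr2 invfM -mulrA mulVf ?mulr1.
Qed.

Lemma cabs2_rker r x : cabs2 (rker r x) = cabs2 (cker x).
Proof. by rewrite cabs2M cabs2_echar // mulr1. Qed.

Lemma cabs_rker r x : cabs (rker r x) = cabs (cker x).
Proof. by rewrite cabsM (cabs_eq1 (cabs2_echar z1 _)) // mulr1. Qed.

Lemma sum_cabs2_cker : \sum_x cabs2 (cker x) = 1.
Proof.
rewrite parseval_ker (eq_bigr (fun=> 1)) => [|j _].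
  by rewrite sumr_const card_Fp // mulVf.
by rewrite cabs2X z1 expr1n.
Qed.

(** A signed count: of the pairs of representatives with sum k modulo p, the k + 1 pairs without
    carry contribute z^k and the p - 1 - k pairs with carry contribute -z^k. *)
Definition cweight (k : 'F_p) : R := (2 * k.+1)%:R - p%:R.

Lemma cker_sqr x : cker x ^+ 2 =
  p%:R^-1 * (p%:R^-1 * \sum_(k : 'F_p) (cweight k)%:C%C * z ^+ k * echar (x * k)).
Proof.
rewrite /cker expr2 mulrACA -mulrA; congr (_ * (_ * _)).
rewrite big_distrlr /= .
transitivity (\sum_(j : 'F_p) \sum_(k : 'F_p) z ^+ (k + (k < j)%N * p) * echar (x * k)).
  apply: eq_bigr => j _; rewrite (reindex_inj (addIr (- j))) /=.
  apply: eq_bigr => k _; rewrite -val_FpB exprD mulrACA -(echarD pp zprim) -mulrDr.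
  by rewrite [j + _]addrC subrK.
rewrite exchange_big /=; apply: eq_bigr => k _; rewrite -mulr_suml; congr (_ * _).
rewrite [RHS]mulrC /cweight.
have -> : \sum_(j : 'F_p) z ^+ (k + (k < j)%N * p) =
   z ^+ k * \sum_(j : 'F_p) (2 * (j < k.+1)%N%:R - 1).
  rewrite mulr_sumr; apply: eq_bigr => j _; rewrite exprD ltnS; congr (_ * _).
  by case: leqP => _; rewrite ?mul0n ?expr0 ?mul1n ?zp ?mulr1 ?mulr0 ?sub0r ?addrK.
congr (_ * _); rewrite sumrB sumr_const card_Fp // -mulr_sumr -natr_sum.
rewrite sum_ltn_Fp; last exact: ltn_Fp.
by rewrite rmorphB /= !rmorph_nat natrM.
Qed.

Lemma sum_cweight_sqr : \sum_(k : 'F_p) cweight k ^+ 2 = p%:R * (p%:R ^+ 2 + 2) / 3.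
Proof.
have H q : \sum_(k < q) ((2 * k.+1)%:R - p%:R) ^+ 2 =
    q%:R * (q%:R + 1) * (4 * q%:R + 2) / 3 - 2 * p%:R * q%:R * (q%:R + 1)
    + p%:R ^+ 2 * q%:R :> R.
  elim: q => [|q IH]; first by rewrite big_ord0; ring.
  by rewrite big_ord_recr /= IH natrM -!natr1; field.
have := H (Zp_trunc (pdiv p)).+2; rewrite /cweight => ->.
by rewrite (Fp_cast pp); field.
Qed.

Lemma cabs2_cweight k : cabs2 ((cweight k)%:C%C * z ^+ k) = cweight k ^+ 2.
Proof. by rewrite cabs2M cabs2X z1 expr1n mulr1 cabs2_real. Qed.

Lemma sum_cabs2_sqr_cker : \sum_x cabs2 (cker x) ^+ 2 = (p%:R ^+ 2 + 2) / (3 * p%:R ^+ 2).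
Proof.
under eq_bigr do rewrite -cabs2X cker_sqr cabs2M.
rewrite -mulr_sumr parseval_ker cabs2_invp.
under eq_bigr do rewrite cabs2_cweight.
by rewrite sum_cweight_sqr; field.
Qed.

(** Summing over x is Fourier inversion: in the expansion of [cker x ^+ 2] it selects the single
    index k = -2r, and the modulus of its weight is all that remains. *)
Lemma cabs2_sum_rker_sqr r :
  cabs2 (\sum_x rker r x ^+ 2) = (cweight (- (r + r)) / p%:R) ^+ 2.
Proof.
have -> : \sum_x rker r x ^+ 2 = p%:R^-1 * ((cweight (- (r + r)))%:C%C * z ^+ (- (r + r) : 'F_p)%R).
  under eq_bigr do rewrite exprMn cker_sqr -mulrA -mulrA mulr_suml.
  rewrite -!mulr_sumr; congr (_ * _); rewrite exchange_big /=.
  have E k : \sum_x (cweight k)%:C%C * z ^+ k * echar (x * k) * echar (r * x) ^+ 2 =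
     (cweight k)%:C%C * z ^+ k * (if k + (r + r) == 0 then p%:R else 0).
    rewrite -(sum_echar pp zprim) mulr_sumr; apply: eq_bigr => x _.
    by rewrite -mulrA expr2 -!(echarD pp zprim); congr (_ * echar _); ring.
  under eq_bigr do rewrite E.
  rewrite (bigD1 (- (r + r))) //= addNr eqxx big1 ?addr0; last first.
    by move=> k; rewrite -subr_eq0 opprK => /negPf ->; rewrite mulr0.
  by rewrite mulrC mulfK.
by rewrite cabs2M cabs2_cweight cabs2_invp expr_div_n mulrC.
Qed.

(* Moving the window by d changes the sign of z ^+ i for d residues i only. *)
Lemma rker_shift (r : 'F_p) (d : nat) : (d < p)%N ->
  \sum_x cabs2 (z ^+ d * rker (r + d%:R) x - rker r x) = 4 * d%:R / p%:R.
Proof.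
move=> dp; pose D : 'F_p := d%:R.
have vD : nat_of_ord D = d by rewrite /D val_Fp_nat // modn_small.
have E x : z ^+ d * rker (r + d%:R) x - rker r x =
   echar (r * x) * (p%:R^-1 * \sum_(i : 'F_p) (z ^+ (i + (i < d)%N * p) - z ^+ i) * echar (x * i)).
  rewrite /rker /cker -/D mulrDl (echarD pp zprim).
  rewrite [in RHS](eq_bigr (fun i : 'F_p => z ^+ (i + (i < d)%N * p) * echar (x * i) -
       z ^+ i * echar (x * i))); last by move=> i _; rewrite mulrBl.
  rewrite sumrB; have -> : \sum_(i : 'F_p) z ^+ (i + (i < d)%N * p) * echar (x * i) =
      z ^+ d * echar (D * x) * \sum_(j : 'F_p) z ^+ j * echar (x * j).
    rewrite mulr_sumr (reindex_inj (addrI D)); apply: eq_bigr => j _.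
    have E' : D + j - D = j by rewrite addrC addKr.
    have := val_FpB (D + j) D; rewrite E' vD => <-.
    by rewrite exprD mulrACA mulrDr (echarD pp zprim) [x * D]mulrC; ring.
  by ring.
under eq_bigr do rewrite E cabs2M cabs2_echar // mul1r.
rewrite parseval_ker mulrC; congr (_ / _).
rewrite (eq_bigr (fun i : 'F_p => 4 * ((i < d)%N)%:R)).
  by rewrite -mulr_sumr -natr_sum sum_ltn_Fp // ltnW.
move=> i _; case: ltnP => _; last by rewrite mul0n addn0 subrr cabs2_0 mulr0.
rewrite mul1n exprD zp mulrN1 mulr1.
have -> : - z ^+ i - z ^+ i = (- 2)%:C%C * z ^+ i.
  by rewrite rmorphN /= rmorph_nat; ring.
by rewrite cabs2M cabs2X z1 expr1n mulr1 cabs2_real; ring.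
Qed.

Hypothesis zRe : forall q, (p <= 2 * q)%N -> (q <= p)%N -> complex.Re (z ^+ q) <= 0.

Lemma cabs_zexp q : cabs (z ^+ q) = 1.
Proof. by rewrite cabs_eq1 // cabs2X z1 expr1n. Qed.

(* Doubling q at most doubles the distance |1 - z^q|, and that distance is at
   least 1 once z^q has a nonpositive real part. *)
Lemma cabs_1sub_zexp_ge q : (0 < q)%N -> (q <= p)%N -> q%:R / p%:R <= cabs (1 - z ^+ q).
Proof.
have [k] := ubnP (p - q)%N; elim: k q => // k IH q pqk q0 qp.
have [h|h] := leqP p (2 * q).
  apply: (@le_trans _ _ 1).
    by rewrite ler_pdivrMr ?ltr0n // mul1r ler_nat.
  rewrite -(@ler_pXn2r _ 2) ?nnegrE ?cabs_ge0 // expr1n cabs_sqr /cabs2.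
  have /= := zRe h qp; case: (z ^+ q) => a b /= a0.
  have := sqr_ge0 (0 - b); have := sqr_ge0 a; nra.
have := IH (2 * q)%N; rewrite muln_gt0 q0 => /(_ _ isT) H.
have {}H : (2 * q)%:R / p%:R <= cabs (1 - z ^+ (2 * q)) by apply: H; lia.
have E : 1 - z ^+ (2 * q) = (1 - z ^+ q) * (1 + z ^+ q).
  by rewrite mulnC exprM; ring.
have le2 : cabs (1 + z ^+ q) <= 2.
  apply: le_trans (cabsD _ _) _; rewrite cabs_zexp (cabs_eq1 (cabs2_1 R)).
  by lra.
move: H; rewrite E cabsM natrM => H.
rewrite -(ler_pM2l (_ : 0 < 2 :> R)) // mulrA; apply: le_trans H _.
by rewrite mulrC ler_wpM2r ?cabs_ge0.
Qed.

Lemma cabs_1sub_zexp_ge' q : (q < 2 * p)%N -> (p <= q)%N ->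
  (2 * p - q)%:R / p%:R <= cabs (1 - z ^+ q).
Proof.
move=> q2 pq.
have -> : cabs (1 - z ^+ q) = cabs (1 - z ^+ (2 * p - q)).
  rewrite -[LHS]cabs_conj rmorphB rmorph1 /=; congr cabs; congr (1 - _).
  have u : z ^+ q * conjc (z ^+ q) = 1 by rewrite -cabs2E cabs2X z1 expr1n.
  have z0 : z ^+ q != 0 by apply/eqP => E; move/eqP: u; rewrite E mul0r eq_sym oner_eq0.
  apply: (mulfI z0); rewrite u -exprD subnKC; last exact: ltnW.
  by rewrite (prim_expr_order zprim).
by apply: cabs_1sub_zexp_ge; lia.
Qed.

(** A geometric sum of ratio z^(2x+1), whose p-th power is -1; hence the numerator 2. *)
Lemma cker_closed x : cker x * (1 - z ^+ (2 * x).+1) = 2 / p%:R.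
Proof.
have E : \sum_(j : 'F_p) z ^+ j * echar (x * j) = \sum_(j < p) (z ^+ (2 * x).+1) ^+ j.
  transitivity (\sum_(j : 'F_p) (z ^+ (2 * x).+1) ^+ j); last first.
    move: (z ^+ _) => w; rewrite -!(big_mkord xpredT (fun j => w ^+ j)).
    by rewrite [X in index_iota 0 X](Fp_cast pp).
  apply: eq_bigr => j _.
  rewrite -[j in echar (x * j)]natr_Zp -{1}[x]natr_Zp -natrM (echar_nat pp zprim).
  by rewrite -exprD -exprM; congr (_ ^+ _); lia.
rewrite /cker E -mulrA mulrC; congr (_ / _).
rewrite -opprB mulrN mulrC -subrX1 -exprM mulSn [(2 * x * p)%N]mulnAC.
by rewrite exprD (exp_z2p zprim) zp; ring.
Qed.

Lemma harmonic_le l q : (q < 2 ^ l)%N -> \sum_(x < q) (x.+1%:R : R)^-1 <= l%:R.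
Proof.
elim: l q => [|l IH] q ql; first by rewrite (_ : q = 0%N) ?big_ord0 //; lia.
have [h|h] := ltnP q (2 ^ l).
  by apply: le_trans (IH _ h) _; rewrite ler_nat.
have e : (2 ^ l).-1.+1 = (2 ^ l)%N by rewrite prednK ?expn_gt0.
rewrite -(subnKC (_ : (2 ^ l).-1 <= q)%N); last by lia.
rewrite big_split_ord /= -[in leRHS]addn1 natrD lerD //.
  by apply: IH; rewrite e.
apply: (@le_trans _ _ (\sum_(i < q - (2 ^ l).-1) ((2 ^ l)%:R : R)^-1)).
  apply: ler_sum => i _; rewrite lef_pV2 ?posrE ?ltr0n ?expn_gt0 // ler_nat; lia.
rewrite sumr_const card_ord -[leLHS]mulr_natr mulrC ler_pdivrMr ?ltr0n ?expn_gt0 //.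
by rewrite mul1r ler_nat; move: ql; rewrite expnS; lia.
Qed.

(** The closed form bounds |c(x)| by 2 over the distance from 2x + 1 to the nearer of 0 and 2p. That
    distance is at least x + 1 in the first half and p - x in the second. Adding both reciprocals
    gives two harmonic sums, each with factor 2 and at most l. *)
Lemma sum_cabs_cker l : (p < 2 ^ l)%N -> \sum_x cabs (cker x) <= 4 * l%:R.
Proof.
move=> pl.
have bd (x : 'F_p) : cabs (cker x) <= 2 * (x.+1%:R)^-1 + 2 * ((p - x)%:R)^-1.
  have xp := ltn_Fp x.
  have := congr1 (@cabs R) (cker_closed x); rewrite cabsM.
  have -> : cabs (2 / p%:R : R[i]) = 2 / p%:R.
    by rewrite -(rmorph_nat (real_complex R)) -(rmorph_nat (real_complex R) p)
      -fmorphV -rmorphM cabs_real ger0_norm // divr_ge0.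
  have main (q d : nat) : (0 < q)%N -> (0 < d)%N -> (d <= q)%N ->
      q%:R / p%:R <= cabs (1 - z ^+ (2 * x).+1) ->
      cabs (cker x) * cabs (1 - z ^+ (2 * x).+1) = 2 / p%:R -> cabs (cker x) <= 2 * (d%:R)^-1.
    move=> q0 d0 dq h1 h2; rewrite ler_pdivlMr ?ltr0n //.
    have : cabs (cker x) * (d%:R / p%:R) <= 2 / p%:R.
      rewrite -h2 ler_wpM2l ?cabs_ge0 //; apply: le_trans h1.
      by rewrite ler_pM2r ?invr_gt0 ?ltr0n // ler_nat.
    by rewrite mulrA ler_pM2r // invr_gt0 ltr0n.
  have [h|h] := leqP (2 * x).+1 p.
    move=> H; apply: le_trans (main _ x.+1 _ _ _ (cabs_1sub_zexp_ge _ h) H) _ => //; first by lia.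
    by rewrite lerDl mulr_ge0 ?invr_ge0.
  move=> H; apply: le_trans (main _ (p - x)%N _ _ _ (cabs_1sub_zexp_ge' _ (ltnW h)) H) _; try lia.
  by rewrite lerDr mulr_ge0 ?invr_ge0.
apply: le_trans (ler_sum _ (fun x _ => bd x)) _.
rewrite big_split /= -!mulr_sumr.
have E1 : \sum_(x : 'F_p) (x.+1%:R : R)^-1 = \sum_(x < p) (x.+1%:R)^-1.
  rewrite -!(big_mkord xpredT (fun j => (j.+1%:R)^-1)).
  by rewrite [X in index_iota 0 X](Fp_cast pp).
have E2 : \sum_(x : 'F_p) ((p - x)%:R : R)^-1 = \sum_(x < p) (x.+1%:R)^-1.
  rewrite -E1 (reindex_inj rev_ord_inj) /=; apply: eq_bigr => x _.
  rewrite [X in (_ - (X - _))%N](Fp_cast pp); congr (_%:R^-1); have := ltn_Fp x; lia.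
by rewrite E1 E2; have := harmonic_le pl; lra.
Qed.

End InterpolationKernel.

(** * Hadamard plans and their rotated sequences *)

Section RootOfUnity.
Variables (R : realType) (p : nat).
Hypothesis p2 : (1 < p)%N.

Let p0 : (0 < p)%N. Proof. exact: ltnW. Qed.

Definition cis (t : R) : R[i] := (cos t +i* sin t)%C.

Lemma cisX t k : cis t ^+ k = cis (k%:R * t).
Proof.
elim: k => [|k IH]; first by rewrite expr0 mul0r /cis cos0 sin0.
by rewrite exprS IH /cis -natr1 mulrDl mul1r addrC cosD sinD; simpc; congr (_ +i* _)%C; ring.
Qed.

Definition root2p : R[i] := cis (pi / p%:R).

Lemma cabs2_root2p : cabs2 root2p = 1.
Proof. by rewrite /cabs2 /= cos2Dsin2. Qed.

Lemma root2p_p : root2p ^+ p = - 1.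
Proof.
rewrite cisX mulrC divfK ?pnatr_eq0 -?lt0n // /cis cospi sinpi.
by apply/eqP; rewrite eq_complex /= oppr0 !eqxx.
Qed.

Lemma Im_root2p k : (0 < k)%N -> (k < p)%N -> 0 < complex.Im (root2p ^+ k).
Proof.
move=> k0 kp; rewrite cisX /=; apply: sin_gt0_pi; apply/andP; split.
  by rewrite mulr_gt0 ?ltr0n ?divr_gt0 ?pi_gt0 ?ltr0n.
by rewrite mulrCA gtr_pMr ?pi_gt0 // ltr_pdivrMr ?ltr0n // mul1r ltr_nat.
Qed.

Lemma root2p_prim : (2 * p).-primitive_root root2p.
Proof.
apply/andP; split; first by rewrite muln_gt0.
have E k : (0 < k)%N -> (k < 2 * p)%N -> root2p ^+ k != 1.
  move=> k0 k2; have [kp|pk] := ltnP k p.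
    by apply/eqP => E; have := Im_root2p k0 kp; rewrite E /= ltxx.
  rewrite -(subnKC pk) exprD root2p_p mulN1r.
  have [->|kp] := eqVneq (k - p)%N 0%N.
    by rewrite expr0 -subr_eq0 -opprD oppr_eq0 (pnatr_eq0 _ 2).
  apply/eqP => E; have : 0 < complex.Im (root2p ^+ (k - p)) by apply: Im_root2p; lia.
  by rewrite -[root2p ^+ _]opprK E /= oppr0 ltxx.
apply/forallP => i; rewrite unity_rootE; apply/eqP.
have [ip|ip] := eqVneq i.+1 (2 * p)%N.
  by rewrite ip mulnC exprM root2p_p sqrrN expr1n eqxx.
by apply/negbTE/E => //; rewrite ltn_neqAle ip ltn_ord.
Qed.

Lemma Re_root2p q : (p <= 2 * q)%N -> (q <= p)%N -> complex.Re (root2p ^+ q) <= 0.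
Proof.
move=> pq qp; rewrite cisX /=; set t := _ * _.
have -> : cos t = - cos (pi - t) by rewrite cosB cospi sinpi; ring.
rewrite oppr_le0; apply: cos_ge0_pihalf.
have q1 : pi / 2 <= t.
  rewrite /t mulrCA ler_pM2l ?pi_gt0 // ler_pdivlMr ?ltr0n // mulrC ler_pdivrMr ?ltr0n //.
  by rewrite -natrM ler_nat mulnC.
have q2 : t <= pi.
  by rewrite /t mulrCA ger_pMr ?pi_gt0 // ler_pdivrMr ?ltr0n // mul1r ler_nat.
have := pi_gt0 R; lra.
Qed.

End RootOfUnity.

Section Hadamard.
Variables (R : realType) (n : nat) (D : {fset {ffun 'I_n -> R[i]}}).
Hypothesis n1 : (1 < n)%N.
Hypothesis hD : hadamard_plan D.

Lemma hadamard_card : #|{: D}| = n.-1.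
Proof. by rewrite -cardfE; case: hD. Qed.

(* The all-ones vector together with D is an orthogonal basis, so the matrix
   having these rows is also orthogonal column by column. *)
Lemma hadamard_dual (k l : 'I_n) :
  \sum_(d : D) val d k * conjc (val d l) = (k == l)%:R * n%:R - 1.
Proof.
case: hD => cD uD bD oD.
pose s := enum_fset D.
have ss : size s = n.-1 by rewrite -cD.
have sD i : (i < n.-1)%N -> nth [ffun=> 0] s i \in D.
  by move=> ilt; apply: (mem_nth [ffun=> 0] (s := s)); rewrite ss.
pose row_ (i : 'I_n) : {ffun 'I_n -> R[i]} :=
  if nat_of_ord i == 0%N then [ffun=> 1] else nth [ffun=> 0] s i.-1.
have rD (i : 'I_n) : nat_of_ord i != 0%N -> row_ i \in D.
  by move=> i0; rewrite /row_ (negPf i0); apply: sD; have := ltn_ord i; lia.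
pose U := \matrix_(i < n, j < n) row_ i j.
pose V := \matrix_(j < n, i < n) (n%:R^-1 * conjc (row_ i j)).
have nC : n%:R != 0 :> R[i] by rewrite pnatr_eq0; lia.
have UV : U *m V = 1%:M.
  apply/matrixP => i j; rewrite !mxE.
  under eq_bigr do rewrite !mxE mulrCA.
  rewrite -mulr_sumr; have [<-|ij] := eqVneq i j.
    rewrite (eq_bigr (fun=> 1)) ?sumr_const ?card_ord ?mulVf // => h _.
    have [i0|i0] := eqVneq (nat_of_ord i) 0%N.
      by rewrite /row_ i0 eqxx ffunE rmorph1 mulr1.
    by rewrite -sqr_normc uD ?expr1n // rD.
  suff -> : \sum_h row_ i h * conjc (row_ j h) = 0 by rewrite mulr0.
  have [i0|i0] := eqVneq (nat_of_ord i) 0%N; have [j0|j0] := eqVneq (nat_of_ord j) 0%N.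
  - by case/eqP: ij; apply: val_inj; rewrite /= i0 j0.
  - rewrite /row_ i0 eqxx -/(row_ j); under eq_bigr do rewrite ffunE mul1r.
    by rewrite -rmorph_sum bD ?rmorph0 // rD.
  - rewrite [row_ j]/row_ j0 eqxx; under eq_bigr do rewrite ffunE rmorph1 mulr1.
    by rewrite bD // rD.
  - apply: oD; rewrite ?rD // /row_ (negPf i0) (negPf j0).
    have li : (i.-1 < size s)%N by rewrite ss; have := ltn_ord i; lia.
    have lj : (j.-1 < size s)%N by rewrite ss; have := ltn_ord j; lia.
    rewrite (nth_uniq _ li lj) ?fset_uniq //.
    by apply: contra ij => /eqP e; apply/eqP/val_inj; rewrite /=; lia.
have /matrixP /(_ l k) := mulmx1C UV; rewrite !mxE.
under eq_bigr do rewrite !mxE -mulrA.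
rewrite -mulr_sumr => /(congr1 (fun u => n%:R * u)); rewrite mulrA mulfV // mul1r.
have n0 : (0 < n)%N by lia.
rewrite (bigD1 (Ordinal n0)) //= {1 2}/row_ /= !ffunE rmorph1 mul1r.
rewrite mulrC eq_sym => <-; rewrite [1 + _]addrC addrK.
rewrite -(big_seq_fsetE _ D xpredT (fun d : {ffun 'I_n -> R[i]} => d k * conjc (d l))) /=.
rewrite (big_nth [ffun=> 0]) -/s ss big_mkord.
pose g i := conjc (nth [ffun=> 0] s i.-1 l) * nth [ffun=> 0] s i.-1 k.
transitivity (\sum_(i < n | nat_of_ord i != 0%N) g i).
  rewrite -(big_mkord (fun i => i != 0%N) g) big_ltn_cond //= big_add1 big_mkord.
  by apply: eq_bigr => i _; rewrite /g /= mulrC.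
by apply: eq_bigr => i i0; rewrite /row_ (negPf i0) /g.
Qed.

Lemma hadamard_unimod (d : D) k : cabs2 (val d k) = 1.
Proof.
case: hD => _ uD _ _; apply: (@real_complex_inj R).
by rewrite cabs2E -sqr_normc uD ?expr1n // (valP d).
Qed.

Variables (p m : nat) (a0 : 'F_p) (f : D -> 'F_p -> R[i]).
Hypothesis pp : prime p.
Hypothesis pnm : p.-1 = (n * m)%N.
Hypothesis m0 : (0 < m)%N.
Hypothesis ha0 : (p.-1).-primitive_root a0.
Hypothesis Hf : forall d (k : 'I_n) (y : 'F_p), y != 0 ->
  f d (a0 ^+ k * y ^+ n) = val d k.

Let n0 : (0 < n)%N. Proof. exact: ltnW. Qed.

Lemma Fp_coset_decomp (x : 'F_p) : x != 0 ->
  exists (k : 'I_n) (y : 'F_p), y != 0 /\ x = a0 ^+ k * y ^+ n.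
Proof.
move=> x0; have := Fp_exp_pred pp pnm x0; rewrite -pnm.
move/(prim_rootP ha0) => [i ->].
exists (Ordinal (ltn_pmod i n0)), (a0 ^+ (i %/ n)); split.
  rewrite expf_neq0 // (prim_root_eq0 ha0); have := prime_gt1 pp; lia.
by rewrite /= -exprM -exprD [in LHS](divn_eq i n) addnC.
Qed.

(** With the entry at 0 erased, instances and unimodularized instances have the same Gram kernel
    [Kz]; the erased entry is treated later as a perturbation. *)
Definition core (d : D) (x : 'F_p) : R[i] := if x == 0 then 0 else f d x.

Lemma core_cabs2 d x : x != 0 -> cabs2 (f d x) = 1.
Proof.
by case/Fp_coset_decomp => k [y [y0 ->]]; rewrite Hf // hadamard_unimod.
Qed.

Lemma core_gram x y : \sum_d core d x * conjc (core d y) = (Kz n m x y)%:~R.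
Proof.
rewrite /core /Kz.
have [->|x0] := eqVneq x 0; first by apply: big1 => d _; rewrite mul0r.
have [->|y0] := eqVneq y 0; first by apply: big1 => d _; rewrite rmorph0 mulr0.
have [k [u [u0 ->]]] := Fp_coset_decomp x0.
have [l [v [v0 ->]]] := Fp_coset_decomp y0.
under eq_bigr do rewrite !Hf //.
rewrite hadamard_dual /=.
have ha_n : n.-primitive_root (a0 ^+ m).
  have d : (n %| p.-1)%N by rewrite pnm dvdn_mulr.
  by have := dvdn_prim_root ha0 d; rewrite pnm mulKn.
have E (w : 'F_p) (j : 'I_n) : w != 0 -> (a0 ^+ j * w ^+ n) ^+ m = (a0 ^+ m) ^+ j.
  by move=> w0; rewrite exprMn -!exprM (Fp_exp_pred pp pnm w0) mulr1 mulnC.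
rewrite !E // (eq_prim_root_expr ha_n) !modn_small //.
rewrite -[_ == l :> nat]/(k == l); case: eqP => _; first by rewrite mul1r intrB.
by rewrite mul0r sub0r mulrN1z.
Qed.

Lemma f_inj d d' : f d =1 f d' -> d = d'.
Proof.
move=> ff; apply/val_inj/ffunP => k.
by rewrite -(Hf d k (oner_neq0 _)) -(Hf d' k (oner_neq0 _)) ff.
Qed.

End Hadamard.

(** * Aperiodic correlations through 2p-th roots of unity *)

Lemma fsum_int (V : nmodType) (F : int -> V) (N M : nat) :
  (forall j : int, F j != 0 -> (- M%:Z <= j) && (j < N%:Z - M%:Z)) ->
  \sum_(j \in [set: int]) F j = \sum_(i < N) F (i%:Z - M%:Z).
Proof.
move=> H; rewrite (fsbigE [seq i%:Z - M%:Z | i <- iota 0 N]).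
  have -> : iota 0 N = index_iota 0 N by rewrite /index_iota subn0.
  rewrite big_map big_mkord.
  by apply: eq_bigl => i; rewrite in_setT.
- by rewrite map_inj_uniq ?iota_uniq // => i j /addIr [].
- by [].
- move=> j _; apply: contraNeq => /H /andP[j1 j2].
  apply/mapP; exists (absz (j + M%:Z)); last by lia.
  by rewrite mem_iota; lia.
Qed.

Lemma parseval_ord (R : realType) (N : nat) (z : R[i]) (c : 'I_N -> R[i]) :
  (0 < N)%N -> N.-primitive_root z -> cabs2 z = 1 ->
  \sum_(t < N) cabs2 (\sum_(i < N) c i * z ^+ (t * i)) = N%:R * \sum_i cabs2 (c i).
Proof.
move=> N0 zN z1.
have zu q : z ^+ q * conjc (z ^+ q) = 1 by rewrite -cabs2E cabs2X z1 expr1n.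
apply: real_complex_inj; rewrite rmorphM !rmorph_sum /= rmorph_nat.
under eq_bigr do rewrite cabs2E rmorph_sum /= big_distrlr /=.
rewrite exchange_big mulr_sumr /=; apply: eq_bigr => j _.
rewrite exchange_big /= (bigD1 j) //= [X in _ + X]big1 ?addr0.
  under eq_bigr do rewrite rmorphM /= mulrACA zu mulr1 -cabs2E.
  by rewrite sumr_const card_ord mulr_natl.
move=> k kj; set u := z ^+ j * conjc (z ^+ k).
have E t : c j * z ^+ (t * j) * conjc (c k * z ^+ (t * k)) = c j * conjc (c k) * u ^+ t.
  rewrite rmorphM /= mulrACA; congr (_ * _).
  by rewrite /u exprMn -rmorphXn -!exprM ![(_ * t)%N]mulnC.
under eq_bigr do rewrite E.
rewrite -mulr_sumr.
have zN1 q : z ^+ (q * N) = 1 by rewrite mulnC exprM (prim_expr_order zN) expr1n.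
have uN : u ^+ N = 1 by rewrite /u exprMn -rmorphXn -!exprM !zN1 rmorph1 mulr1.
have u1 : u - 1 != 0.
  rewrite subr_eq0; apply: contra kj => /eqP u1.
  have : z ^+ j == z ^+ k.
    by apply/eqP; rewrite -[LHS]mulr1 -(zu k) [z ^+ k * _]mulrC mulrA -/u u1 mul1r.
  by rewrite (eq_prim_root_expr zN) !modn_small // => /eqP /val_inj ->.
have := subrX1 u N; rewrite uN subrr => /esym/eqP.
by rewrite mulf_eq0 (negPf u1) => /eqP ->; rewrite mulr0.
Qed.

Section Rotations.
Variables (R : realType) (p : nat) (z : R[i]).
Hypothesis pp : prime p.
Hypothesis zp : z ^+ p = - 1.
Hypothesis z1 : cabs2 z = 1.
Hypothesis zprim : (2 * p).-primitive_root z.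
Implicit Types (f g : 'F_p -> R[i]) (r s : int).

Let p0 : (0 < p)%N. Proof. exact: prime_gt0. Qed.

Lemma rotation_in f r (j : nat) : (j < p)%N ->
  rotation f r j%:Z = f (r%:~R + j%:R).
Proof. by move=> jp; rewrite /rotation ltz_nat jp /= intrD. Qed.

Lemma rotation_neq0 f r (j : int) : rotation f r j != 0 -> (0 <= j) && (j < p%:Z).
Proof. by rewrite /rotation; case: ifP => // _; rewrite eqxx. Qed.

Lemma sum_Fp_shift (V : nmodType) (F : 'F_p -> V) (r : 'F_p) :
  \sum_(j < p) F (r + j%:R) = \sum_x F x.
Proof.
rewrite [RHS](reindex_inj (addrI r)) /=.
transitivity (\sum_(x : 'F_p) F (r + (nat_of_ord x)%:R)); last first.
  by apply: eq_bigr => x _; rewrite natr_Zp.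
rewrite -!(big_mkord xpredT (fun j => F (r + j%:R))).
by rewrite [in RHS](Fp_cast pp).
Qed.

Lemma crosscorrE f g r s (t : int) : crosscorr (rotation f r) (rotation g s) t =
  \sum_(k < p) rotation f r (k%:Z + t) * conjc (rotation g s k%:Z).
Proof.
rewrite /crosscorr (@fsum_int _ _ p 0).
  by apply: eq_bigr => k _; rewrite subr0.
move=> j; rewrite mulf_eq0 conjc_eq0 negb_or => /andP[_ /rotation_neq0].
by rewrite oppr0 subr0.
Qed.

Lemma energy_rotation f r : energy (rotation f r) = \sum_x cabs2 (f x).
Proof.
rewrite /energy crosscorrE.
have -> : \sum_(k < p) rotation f r (k%:Z + 0) * conjc (rotation f r k%:Z) =
   ((\sum_x cabs2 (f x))%:C)%C.
  rewrite rmorph_sum /= -(sum_Fp_shift (fun x => ((cabs2 (f x))%:C)%C) r%:~R).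
  by apply: eq_bigr => k _; rewrite addr0 rotation_in // cabs2E.
by [].
Qed.

Definition spectrum f r (t : nat) : R[i] := \sum_(j < p) f (r%:~R + j%:R) * z ^+ (t * j).

(** Correlations vanish outside (-p, p), so the 2p shifts in [-p, p) represent Z/2p once each and
    Parseval there suffers no wraparound. Moving the window by p only multiplies the transform by
    the unimodular [z ^+ (t * p)]. *)
Lemma sum_crosscorr f g r s :
  \sum_(t \in [set: int]) cabs2 (crosscorr (rotation f r) (rotation g s) t) =
  (2 * p)%:R^-1 * \sum_(t < 2 * p) cabs2 (spectrum f r t) * cabs2 (spectrum g s t).
Proof.
have p20 : (0 < 2 * p)%N by rewrite muln_gt0.
rewrite (@fsum_int _ _ (2 * p) p); last first.
  move=> t H; apply/negPn/negP => ht; move/negP: H; apply; apply/eqP.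
  rewrite crosscorrE big1 ?cabs2_0 // => k _.
  have -> : rotation f r (k%:Z + t) = 0; last by rewrite mul0r.
  apply/eqP; apply: contraNT ht => /rotation_neq0; have := ltn_ord k; lia.
set c := fun i : 'I_(2 * p) => crosscorr (rotation f r) (rotation g s) (i%:Z - p%:Z).
have pN : (2 * p)%:R != 0 :> R by rewrite pnatr_eq0 -lt0n.
apply: (mulfI pN); rewrite mulrA divff // mul1r -(parseval_ord c p20 zprim z1).
apply: eq_bigr => t _.
have -> : \sum_(i < 2 * p) c i * z ^+ (t * i) =
    z ^+ (t * p) * (spectrum f r t * conjc (spectrum g s t)).
  rewrite /c; under eq_bigr do rewrite crosscorrE mulr_suml.
  rewrite exchange_big /= /spectrum rmorph_sum /= mulr_sumr mulr_sumr.
  apply: eq_bigr => k _.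
  transitivity (\sum_(i < 2 * p) conjc (g (s%:~R + k%:R)) *
    (rotation f r (k%:Z + (i%:Z - p%:Z)) * z ^+ (t * i))).
    by apply: eq_bigr => i _; rewrite [rotation g s _]rotation_in //; ring.
  rewrite -mulr_sumr rmorphM /=.
  transitivity (conjc (g (s%:~R + k%:R)) * (z ^+ (t * p) *
      (\sum_(j < p) f (r%:~R + j%:R) * z ^+ (t * j)) * conjc (z ^+ (t * k)))); last by ring.
  congr (_ * _).
  have kp := ltn_ord k.
  have zk : conjc (z ^+ (t * k)) * z ^+ (t * k) = 1.
    by rewrite mulrC -cabs2E cabs2X z1 expr1n.
  (* For fixed k the rotated sequence is supported where i runs over [p - k, 2p - k), so j = i - (p
     - k). *)
  transitivity (\sum_(j < p) f (r%:~R + j%:R) * z ^+ (t * (j + (p - k)))).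
    pose F (i : nat) := rotation f r (k%:Z + (i%:Z - p%:Z)) * z ^+ (t * i).
    rewrite -[LHS]/(\sum_(i < 2 * p) F i).
    rewrite -(big_mkord xpredT F) (big_cat_nat (_ : 0 <= p - k)%N) /=; last lia; last by [].
    rewrite [X in X + _]big_nat_cond big1 ?add0r; last first.
      move=> i /andP[/andP[_ ik] _]; rewrite /F.
      have -> : rotation f r (k%:Z + (i%:Z - p%:Z)) = 0; last by rewrite mul0r.
      by apply/eqP/negPn/negP => /rotation_neq0; lia.
    rewrite (big_cat_nat (_ : p - k <= p + (p - k))%N) /=; try lia.
    rewrite [X in _ + X]big_nat_cond [X in _ + X]big1 ?addr0; last first.
      move=> i /andP[/andP[ik _] _]; rewrite /F.
      have -> : rotation f r (k%:Z + (i%:Z - p%:Z)) = 0; last by rewrite mul0r.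
      by apply/eqP/negPn/negP => /rotation_neq0; lia.
    rewrite -{1}[(p - k)%N]add0n big_addn addnK big_mkord.
    apply: eq_bigr => j _; rewrite /F -rotation_in //; congr (rotation _ _ _ * _); lia.
  rewrite mulr_sumr mulr_suml; apply: eq_bigr => j _.
  have -> : (t * p = t * (p - k) + t * k)%N by rewrite -mulnDr subnK // ltnW.
  rewrite mulnDr !exprD; apply/esym.
  transitivity (f (r%:~R + j%:R) * (z ^+ (t * j) * z ^+ (t * (p - k))) *
    (conjc (z ^+ (t * k)) * z ^+ (t * k))); first by ring.
  by rewrite zk mulr1.
by rewrite cabs2M cabs2X z1 expr1n mul1r cabs2M cabs2_conj.
Qed.

Lemma spectrum_even f r (a : 'F_p) :
  cabs2 (spectrum f r (2 * a)) = cabs2 (fhat z f a).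
Proof.
have -> : spectrum f r (2 * a) = echar z (- (a * r%:~R)) * fhat z f a; last first.
  by rewrite cabs2M cabs2_echar // mul1r.
rewrite /fhat -(sum_Fp_shift _ r%:~R) mulr_sumr; apply: eq_bigr => j _.
rewrite mulrCA -(echarD pp zprim) mulrDr addKr; congr (_ * _).
by rewrite -{2}[a]natr_Zp -natrM (echar_nat pp zprim) mulnA.
Qed.

(** Inversion attaches the phase of -b r to frequency b. Writing -b r = -a r + (a - b) r splits it
    into an outer phase and a modulation of the kernel, which turns [cker] into [rker]. *)
Lemma spectrum_odd f r (a : 'F_p) : spectrum f r (2 * a).+1 =
  echar z (- (a * r%:~R)) * smear (rker z r%:~R) (fhat z f) a.
Proof.
have pC : (p%:R != 0 :> R[i]) by rewrite pnatr_eq0 -lt0n.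
set rr : 'F_p := r%:~R.
transitivity (\sum_(j : 'F_p) f (rr + j) * (echar z (a * j) * z ^+ j)).
  pose F (j : nat) := f (rr + j%:R) * z ^+ ((2 * a).+1 * j).
  transitivity (\sum_(j : 'F_p) F j).
    rewrite -!(big_mkord xpredT F) /spectrum.
    by rewrite [in RHS](Fp_cast pp) big_mkord.
  apply: eq_bigr => j _; rewrite /F natr_Zp; congr (_ * _).
  rewrite -[j in echar z (a * j)]natr_Zp -{2}[a]natr_Zp -natrM (echar_nat pp zprim).
  by rewrite -exprD; congr (_ ^+ _); lia.
transitivity (\sum_b echar z (- (b * rr)) * cker z (a - b) * fhat z f b).
  transitivity (\sum_(j : 'F_p) \sum_b echar z (- (b * rr)) * fhat z f b *
    (p%:R^-1 * (z ^+ j * echar z ((a - b) * j)))).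
    apply: eq_bigr => j _; rewrite (fhat_inv pp zprim) mulrAC mulr_sumr.
    apply: eq_bigr => b _.
    have -> : - (b * (rr + j)) = - (b * rr) + (- (b * j)) by ring.
    by rewrite (mulrBl j a b) !(echarD pp zprim); ring.
  rewrite exchange_big /=; apply: eq_bigr => b _.
  by rewrite -mulr_sumr -mulr_sumr -/(cker z (a - b)) mulrAC.
rewrite /smear mulr_sumr (reindex_inj (inj_comp (addrI a) oppr_inj)) /=.
apply: eq_bigr => x _.
have -> : - ((a - x) * rr) = - (a * rr) + rr * x by ring.
by rewrite (echarD pp zprim) /rker opprB addrC subrK; ring.
Qed.

Lemma sum_even_odd (F : nat -> R) :
  \sum_(t < 2 * p) F t = \sum_(a : 'F_p) (F (2 * a)%N + F (2 * a).+1).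
Proof.
have H q : \sum_(t < 2 * q) F t = \sum_(a < q) (F (2 * a)%N + F (2 * a).+1).
  elim: q => [|q IH]; first by rewrite !big_ord0.
  by rewrite mulnS 2!big_ord_recr /= IH big_ord_recr /= addrA.
rewrite H -!(big_mkord xpredT (fun a => F (2 * a)%N + F (2 * a).+1)).
by rewrite [in RHS](Fp_cast pp).
Qed.

End Rotations.

(** * The fourth moment of the spectrum *)

Section FourthMoment.
Variables (R : realType) (p : nat) (I : finType).
Implicit Types B E X : I -> 'F_p -> R[i].

Lemma fourth_moment_ge0 B : 0 <= fourth_moment B.
Proof. by apply: sumr_ge0 => a _; rewrite sqr_ge0. Qed.

Lemma eq_fourth_moment B X : (forall d a, cabs2 (B d a) = cabs2 (X d a)) ->
  fourth_moment B = fourth_moment X.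
Proof.
move=> H; apply: eq_bigr => a _; congr (_ ^+ 2).
by apply: eq_bigr => d _.
Qed.

(** The weighted inequality for (u + v)^2 is used once on each entry and once on the sum over d,
    which is then squared: the exponent 3 is 2 + 1. Free [eta] lets a relatively small [E] change
    the moment by a relatively small amount. *)
Lemma fourth_moment_add_le B E (eta : R) : 0 < eta ->
  fourth_moment (fun d a => B d a + E d a) <=
  (1 + eta) ^+ 3 * fourth_moment B + (1 + eta^-1) ^+ 3 * fourth_moment E.
Proof.
move=> e0; rewrite !mulr_sumr -big_split /=; apply: ler_sum => a _.
set b := \sum_d cabs2 (B d a); set e := \sum_d cabs2 (E d a).
have b0 : 0 <= b by apply: sumr_ge0 => d _; rewrite cabs2_ge0.
have ee0 : 0 <= e by apply: sumr_ge0 => d _; rewrite cabs2_ge0.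
have i0 : 0 < eta^-1 by rewrite invr_gt0.
have H : \sum_d cabs2 (B d a + E d a) <= (1 + eta) * b + (1 + eta^-1) * e.
  rewrite !mulr_sumr -big_split /=; apply: ler_sum => d _; exact: cabs2_add_le.
have s0 : 0 <= \sum_d cabs2 (B d a + E d a) by apply: sumr_ge0 => d _; rewrite cabs2_ge0.
apply: (@le_trans _ _ (((1 + eta) * b + (1 + eta^-1) * e) ^+ 2)).
  by rewrite ler_pXn2r // nnegrE; apply: le_trans H.
set x := (1 + eta) * b; set y := (1 + eta^-1) * e.
have -> : (1 + eta) ^+ 3 * b ^+ 2 = (1 + eta) * x ^+ 2 by rewrite /x; ring.
have -> : (1 + eta^-1) ^+ 3 * e ^+ 2 = (1 + eta^-1) * y ^+ 2 by rewrite /y; ring.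
rewrite -subr_ge0.
have -> : (1 + eta) * x ^+ 2 + (1 + eta^-1) * y ^+ 2 - (x + y) ^+ 2 =
    (eta * x - y) ^+ 2 / eta by field; rewrite gt_eqF.
by rewrite divr_ge0 ?sqr_ge0 // ltW.
Qed.

Lemma fourth_moment_sub_le B E (eta : R) : 0 < eta ->
  fourth_moment B <=
  (1 + eta) ^+ 3 * fourth_moment (fun d a => B d a + E d a) + (1 + eta^-1) ^+ 3 * fourth_moment E.
Proof.
move=> e0; have := fourth_moment_add_le (fun d a => B d a + E d a) (fun d a => - E d a) e0.
have -> : fourth_moment (fun d a => - E d a) = fourth_moment E.
  by apply: eq_fourth_moment => d a; rewrite cabs2N.
by rewrite (@eq_fourth_moment _ B) // => d a; rewrite addrK.
Qed.

Lemma fourth_moment_unit_le E : prime p -> (forall d a, cabs2 (E d a) <= 1) ->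
  fourth_moment E <= p%:R * #|I|%:R ^+ 2.
Proof.
move=> pp H; apply: (@le_trans _ _ (\sum_(a : 'F_p) #|I|%:R ^+ 2)); last first.
  by rewrite sumr_const card_Fp // mulr_natl.
apply: ler_sum => a _.
have e0 : 0 <= \sum_d cabs2 (E d a) by apply: sumr_ge0 => d _; rewrite cabs2_ge0.
rewrite ler_pXn2r ?nnegrE //.
rewrite -[leRHS]mulr1 mulr_natl -sumr_const; exact: ler_sum.
Qed.

Lemma sqr_sum_le (c : I -> R) : (\sum_d c d) ^+ 2 <= #|I|%:R * \sum_d c d ^+ 2.
Proof.
have -> : #|I|%:R * \sum_d c d ^+ 2 = \sum_d \sum_e (c d ^+ 2 + c e ^+ 2) / 2.
  under [RHS]eq_bigr do rewrite -mulr_suml big_split /= sumr_const -[_ *+ _]mulr_natl.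
  by rewrite -mulr_suml big_split /= -mulr_sumr sumr_const -[_ *+ #|_|]mulr_natl; field.
rewrite expr2 big_distrlr /=; apply: ler_sum => d _; apply: ler_sum => e _.
rewrite -subr_ge0; have -> : (c d ^+ 2 + c e ^+ 2) / 2 - c d * c e = (c d - c e) ^+ 2 / 2 by field.
by rewrite divr_ge0 ?sqr_ge0.
Qed.

(** Intended for the difference of two rotated kernels: a small l2 norm makes the main term small
    without any information on the phases. *)
Lemma smear_main_le n (k : 'F_p -> R[i]) : (0 < n)%N ->
  0 <= \sum_x cabs2 (k x) -> 
  smear_main n k <= ((n%:R - 1) ^+ 2 + 2 * (n%:R - 1)) * (\sum_x cabs2 (k x)) ^+ 2.
Proof.
move=> n0 s0; rewrite /smear_main; set s := \sum_x cabs2 (k x).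
have n1 : 0 <= n%:R - 1 :> R by rewrite subr_ge0 ler1n.
have h1 : cabs2 (\sum_x k x ^+ 2) <= s ^+ 2.
  rewrite -cabs_sqr ler_pXn2r ?nnegrE ?cabs_ge0 //.
  apply: le_trans (cabs_sum _ _) _; apply: ler_sum => x _.
  by rewrite expr2 cabsM -expr2 cabs_sqr.
have h2 : 0 <= \sum_x cabs2 (k x) ^+ 2 by apply: sumr_ge0 => x _; rewrite sqr_ge0.
nra.
Qed.

End FourthMoment.

(** * Power of the spectrum at a fixed prime *)

Section FiniteEstimate.
Variables (R : realType) (n : nat) (D : {fset {ffun 'I_n -> R[i]}}).
Hypothesis n1 : (1 < n)%N.
Hypothesis hD : hadamard_plan D.
Variables (p m : nat) (a0 : 'F_p) (f : D -> 'F_p -> R[i]) (r : D -> int).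
Hypothesis pp : prime p.
Hypothesis pnm : p.-1 = (n * m)%N.
Hypothesis m0 : (0 < m)%N.
Hypothesis ha0 : (p.-1).-primitive_root a0.
Hypothesis Hf : forall d (k : 'I_n) (y : 'F_p), y != 0 ->
  f d (a0 ^+ k * y ^+ n) = val d k.
Hypothesis Hf0 : forall d, cabs2 (f d 0) <= 1.
Variable eps : R.
Hypothesis eps0 : 0 <= eps.
Hypothesis Heps : forall x x' y y' : 'F_p,
  `|(Ez n m x x' y y' - p%:Z * Ez_main n x x' y y')%:~R| <= eps.
Variables (l : nat) (d0 : D) (del : R).
Hypothesis pl : (p < 2 ^ l)%N.
Hypothesis Hdel : forall d, `|(r d - r d0)%:~R| <= del.
Hypothesis delp : del < p%:R.

Let z := root2p R p.
Let p1 : (1 < p)%N. Proof. exact: prime_gt1. Qed.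
Let p0 : (0 < p)%N. Proof. exact: prime_gt0. Qed.
Let zp : z ^+ p = - 1. Proof. exact: root2p_p. Qed.
Let z1 : cabs2 z = 1. Proof. exact: cabs2_root2p. Qed.
Let zprim : (2 * p).-primitive_root z. Proof. exact: root2p_prim. Qed.
Let n0 : (0 < n)%N. Proof. exact: ltnW. Qed.
Let N1 : R := n%:R - 1.
Let cf := core f.

Let cf_gram x y : \sum_d cf d x * conjc (cf d y) = (Kz n m x y)%:~R.
Proof. exact: (core_gram n1 hD pp pnm m0 ha0 Hf). Qed.

Let N1E : N1 = #|{: D}|%:R.
Proof. by rewrite hadamard_card // /N1 -subn1 natrB. Qed.

Let N1_ge1 : 1 <= N1.
Proof. have h : 2 <= n%:R :> R by rewrite ler_nat. by rewrite /N1; move: h; lra. Qed.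

Lemma f_core d x : f d x = cf d x + (x == 0)%:R * f d 0.
Proof.
by rewrite /cf /core; case: eqP => [->|_]; rewrite ?mul1r ?add0r // mul0r addr0.
Qed.

Lemma fhat_f d a : fhat z (f d) a = fhat z (cf d) a + f d 0.
Proof.
rewrite /fhat; under eq_bigr do rewrite f_core mulrDl.
rewrite big_split /=; congr (_ + _); rewrite (bigD1 0) //= big1 ?addr0.
  by rewrite mul1r mulr0 echar0 mulr1.
by move=> x /negPf ->; rewrite !mul0r.
Qed.

Lemma smear_const (k : 'F_p -> R[i]) c g a :
  smear k (fun b => g b + c) a = smear k g a + c * \sum_x k x.
Proof.
rewrite /smear; under eq_bigr do rewrite mulrDr.
by rewrite big_split /= -mulr_suml [c * _]mulrC.
Qed.

(** The entry at 0 adds a constant to the transform, and smearing multiplies a constant by this sum;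
    so its effect stays bounded at odd frequencies too. *)
Lemma cabs2_sum_rker (s : 'F_p) : cabs2 (\sum_x rker z s x) = 1.
Proof.
have pC : (p%:R != 0 :> R[i]) by rewrite pnatr_eq0 -lt0n.
suff -> : \sum_x rker z s x = z ^+ (- s : 'F_p)%R by rewrite cabs2X z1 expr1n.
rewrite /rker /cker; under eq_bigr do rewrite -mulrA mulr_suml.
rewrite -mulr_sumr exchange_big /=.
under eq_bigr => j _.
  under eq_bigr do rewrite -mulrA -(echarD pp zprim) [s * _]mulrC -mulrDr mulrC [_ * (j + s)]mulrC.
  rewrite -mulr_suml (sum_echar pp zprim).
  over.
rewrite (bigD1 (- s)) //= addNr eqxx big1 ?addr0 ?mulrA ?mulVf ?mul1r //.
by move=> j; rewrite -subr_eq0 opprK => /negPf ->; rewrite mul0r.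
Qed.

Let rd d : 'F_p := (r d)%:~R.

(* Up to a phase, replacing the rotation r d by the common rotation r d0 moves
   the interpolation kernel little in l2. *)
Lemma kernel_deviation d : exists u : R[i], cabs2 u = 1 /\
  \sum_x cabs2 (u * rker z (rd d) x - rker z (rd d0) x) <= 4 * del / p%:R.
Proof.
have key (s t : int) (q : nat) : s = t + q%:Z -> (q < p)%N ->
    \sum_(x : 'F_p) cabs2 (z ^+ q * rker z (s%:~R : 'F_p) x - rker z (t%:~R : 'F_p) x) =
    4 * q%:R / p%:R.
  move=> -> qp; rewrite intrD -(rker_shift pp zp z1 zprim t%:~R qp); by [].
have qle (q : nat) : `|(r d - r d0)%:~R| = q%:R :> R ->
    (q < p)%N /\ 4 * q%:R / p%:R <= 4 * del / p%:R.
  move=> E; have := Hdel d; rewrite E => qd; split.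
    by rewrite -(ltr_nat R); apply: le_lt_trans delp.
  by rewrite ler_pM2r ?invr_gt0 ?ltr0n // ler_pM2l.
have [h|h] := leP (r d0) (r d).
  have E : r d = r d0 + (absz (r d - r d0))%:Z by lia.
  have [|q1 q2] := qle (absz (r d - r d0)).
    by rewrite -intr_norm -abszE.
  exists (z ^+ absz (r d - r d0)); split; first by rewrite cabs2X z1 expr1n.
  by rewrite (key _ _ _ E q1).
have E : r d0 = r d + (absz (r d - r d0))%:Z by lia.
have [|q1 q2] := qle (absz (r d - r d0)).
  by rewrite -intr_norm -abszE.
set q := absz _ in E q1 q2.
have zq : z ^+ q * conjc (z ^+ q) = 1 by rewrite -cabs2E cabs2X z1 expr1n.
exists (conjc (z ^+ q)); split; first by rewrite cabs2_conj cabs2X z1 expr1n.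
rewrite (le_trans _ q2) // -(key _ _ _ E q1); apply: ler_sum => x _.
have -> : conjc (z ^+ q) * rker z (rd d) x - rker z (rd d0) x =
   - (conjc (z ^+ q) * (z ^+ q * rker z (rd d0) x - rker z (rd d) x)).
  by rewrite -[rker z (rd d0) x in LHS]mul1r -zq; ring.
by rewrite cabs2N cabs2M cabs2_conj cabs2X z1 expr1n mul1r.
Qed.

Definition power_sum : R :=
  \sum_(t < 2 * p) (\sum_d cabs2 (spectrum z (f d) (r d) t)) ^+ 2.

(** Close to 2t - 1, where t is the fractional part of -2 r / p. *)
Definition tau : R := cweight R (- (rd d0 + rd d0)) / p%:R.

Definition main_power : R :=
  N1 ^+ 2 + N1 * (tau ^+ 2 + 1 - 2 * ((p%:R ^+ 2 + 2) / (3 * p%:R ^+ 2))).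

Let Bev d a := fhat z (cf d) a.
Let Bod d a := smear (rker z (rd d0)) (fhat z (cf d)) a.

Let pr0 : 0 < p%:R :> R. Proof. by rewrite ltr0n. Qed.

Lemma main_power_estimate :
  `|fourth_moment Bev + fourth_moment Bod -
    (p%:R ^+ 2 * N1 ^+ 2 * (p.-1)%:R + p%:R ^+ 3 * main_power)| <=
  p%:R ^+ 2 * eps * (4 * l%:R) ^+ 4.
Proof.
have -> : fourth_moment Bev = p%:R ^+ 2 * N1 ^+ 2 * (p.-1)%:R.
  exact: (fourth_moment_fhat pp z1 zprim pnm m0 ha0 cf_gram).
rewrite [X in `|X|](_ : _ = fourth_moment Bod - p%:R ^+ 3 * main_power); last by ring.
have := fourth_moment_smear pp z1 zprim pnm m0 ha0 cf_gram Heps (rker z (rd d0)).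
have -> : smear_main n (rker z (rd d0)) = main_power.
  rewrite /smear_main (cabs2_sum_rker_sqr pp zp z1 zprim).
  under eq_bigr do rewrite (cabs2_rker z1).
  under [X in _ - 2 * X]eq_bigr do rewrite (cabs2_rker z1).
  rewrite (sum_cabs2_cker pp z1 zprim) (sum_cabs2_sqr_cker pp zp z1 zprim).
  by rewrite !expr1n mulr1.
move=> H; apply: le_trans H _.
have s1 : 0 <= \sum_x cabs (rker z (rd d0) x) by apply: sumr_ge0 => x _; rewrite cabs_ge0.
rewrite ler_wpM2l ?mulr_ge0 ?exprn_ge0 // ler_pXn2r ?nnegrE ?mulr_ge0 //.
under eq_bigr do rewrite (cabs_rker z1).
apply: (sum_cabs_cker pp zp z1 zprim _ pl); exact: Re_root2p.
Qed.

(** [Er] collects the deviations from the model with entry 0 at the origin and a common rotation.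
    The 9 is 1 + 8: one for the constant at even frequencies, 8 = (1 + 1)^3 for separating [e2] from
    [e1] with [eta] equal to 1. Of the factor N1^2 next to the second 8, one N1 is Cauchy-Schwarz
    over d and the other the sum over d. *)
Lemma spectral_estimate : exists (S Er : R),
  [/\ power_sum = S, 0 <= Er,
      Er <= 9 * p%:R * N1 ^+ 2 + 8 * N1 ^+ 2 *
        (p%:R ^+ 3 * ((N1 ^+ 2 + 2 * N1) * (4 * del / p%:R) ^+ 2)
          + p%:R ^+ 2 * eps * (8 * l%:R) ^+ 4) &
      forall eta : R, 0 < eta ->
        S <= (1 + eta) ^+ 3 * (fourth_moment Bev + fourth_moment Bod) + (1 + eta^-1) ^+ 3 * Er /\
        fourth_moment Bev + fourth_moment Bod <= (1 + eta) ^+ 3 * S + (1 + eta^-1) ^+ 3 * Er].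
Proof.
have /choice [u Hu] := kernel_deviation.
pose kd d x := u d * rker z (rd d) x - rker z (rd d0) x.
pose e1 d a := smear (kd d) (fhat z (cf d)) a.
pose e2 (d : D) (a : 'F_p) := u d * (f d 0 * \sum_x rker z (rd d) x).
pose Xod d a := Bod d a + (e1 d a + e2 d a).
pose Xev d a := Bev d a + f d 0.
have SE : power_sum = fourth_moment Xev + fourth_moment Xod.
  pose F t := (\sum_d cabs2 (spectrum z (f d) (r d) t)) ^+ 2.
  rewrite -[power_sum]/(\sum_(t < 2 * p) F t) sum_even_odd // big_split /=; congr (_ + _).
    apply: eq_bigr => a _; congr (_ ^+ 2); apply: eq_bigr => d _.
    by rewrite (spectrum_even pp z1 zprim) fhat_f.
  apply: eq_bigr => a _; congr (_ ^+ 2); apply: eq_bigr => d _.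
  rewrite (spectrum_odd pp zprim) cabs2M cabs2_echar // mul1r.
  have -> : Xod d a = u d * smear (rker z (rd d)) (fhat z (f d)) a.
    rewrite /Xod /Bod /e1 /e2.
    have -> : smear (rker z (rd d)) (fhat z (f d)) a =
        smear (rker z (rd d)) (fun b => fhat z (cf d) b + f d 0) a.
      by apply: eq_bigr => x _; rewrite fhat_f.
    rewrite smear_const mulrDr addrA; congr (_ + _).
    rewrite /smear -big_split mulr_sumr /=; apply: eq_bigr => x _.
    by rewrite /kd; ring.
  by rewrite cabs2M (Hu d).1 mul1r.
exists (fourth_moment Xev + fourth_moment Xod),
  (fourth_moment (fun d (a : 'F_p) => f d 0) +
   fourth_moment (fun d a => e1 d a + e2 d a)).
split => //.
- by rewrite addr_ge0 ?fourth_moment_ge0.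
- have le1 : fourth_moment (fun d (a : 'F_p) => f d 0) <= p%:R * N1 ^+ 2.
    by rewrite N1E; apply: fourth_moment_unit_le.
  have le2 : fourth_moment e2 <= p%:R * N1 ^+ 2.
    rewrite N1E; apply: fourth_moment_unit_le => // d a.
    by rewrite /e2 !cabs2M (Hu d).1 mul1r cabs2_sum_rker mulr1.
  set Y := p%:R ^+ 3 * ((N1 ^+ 2 + 2 * N1) * (4 * del / p%:R) ^+ 2)
          + p%:R ^+ 2 * eps * (8 * l%:R) ^+ 4.
  have le3 : fourth_moment e1 <= N1 ^+ 2 * Y.
    (* The kernel [kd d] varies with d, while the smeared moment takes one kernel for all sequences.
       So [kd d] is applied to every d', and only the term d' = d is retained. *)
    have dY d : \sum_a cabs2 (e1 d a) ^+ 2 <= Y.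
      apply: (@le_trans _ _ (fourth_moment (fun d' => smear (kd d) (fhat z (cf d'))))).
        apply: ler_sum => a _.
        have t0 : 0 <= \sum_d' cabs2 (smear (kd d) (fhat z (cf d')) a).
          by apply: sumr_ge0 => d' _; rewrite cabs2_ge0.
        rewrite ler_pXn2r // ?nnegrE ?cabs2_ge0 //.
        rewrite (bigD1 d) //= lerDl; apply: sumr_ge0 => d' _; exact: cabs2_ge0.
      have := fourth_moment_smear pp z1 zprim pnm m0 ha0 cf_gram Heps (kd d).
      set s4 := fourth_moment _ => H.
      have {}H : s4 <= p%:R ^+ 3 * smear_main n (kd d) +
          p%:R ^+ 2 * eps * (\sum_x cabs (kd d x)) ^+ 4.
        by move: H; rewrite ler_norml => /andP[_]; rewrite lerBlDr addrC.
      apply: le_trans H _; rewrite lerD //.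
        rewrite ler_pM2l ?exprn_gt0 //; apply: le_trans (smear_main_le _ _) _ => //.
          by apply: sumr_ge0 => x _; rewrite cabs2_ge0.
        have s0 : 0 <= \sum_x cabs2 (kd d x) by apply: sumr_ge0 => x _; rewrite cabs2_ge0.
        rewrite -/N1 ler_wpM2l //; first by have := N1_ge1; nra.
        have s2 := le_trans s0 (Hu d).2.
        by rewrite ler_pXn2r ?nnegrE // (Hu d).2.
      have s1 : 0 <= \sum_x cabs (kd d x) by apply: sumr_ge0 => x _; rewrite cabs_ge0.
      rewrite ler_wpM2l ?mulr_ge0 ?exprn_ge0 // ler_pXn2r ?nnegrE ?mulr_ge0 //.
      have bd x : cabs (kd d x) <= 2 * cabs (cker z x).
        apply: le_trans (cabsD _ _) _; rewrite cabsM (cabs_eq1 (Hu d).1) mul1r.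
        have -> : cabs (- rker z (rd d0) x) = cabs (rker z (rd d0) x).
          by rewrite -mulN1r cabsM (cabs_eq1 (_ : cabs2 (-1) = 1)) ?mul1r // cabs2N cabs2_1.
        by rewrite !(cabs_rker z1); lra.
      apply: le_trans (ler_sum _ (fun x _ => bd x)) _.
      rewrite -mulr_sumr (_ : 8 * l%:R = 2 * (4 * l%:R)); last by ring.
      rewrite ler_pM2l //; apply: (sum_cabs_cker pp zp z1 zprim _ pl); exact: Re_root2p.
    apply: (@le_trans _ _ (N1 * \sum_d \sum_a cabs2 (e1 d a) ^+ 2)).
      rewrite exchange_big mulr_sumr /=; apply: ler_sum => a _.
      by rewrite N1E; exact: sqr_sum_le.
    rewrite expr2 -mulrA ler_wpM2l //; first by have := N1_ge1; lra.
    by rewrite N1E mulr_natl -sumr_const; apply: ler_sum.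
  have := fourth_moment_add_le e1 e2 (ltr01 : 0 < 1 :> R); rewrite invr1.
  have -> : (1 + 1 : R) ^+ 3 = 8 by ring.
  rewrite -/Y; lra.
- move=> eta e0; rewrite !mulrDr.
  have H1 := fourth_moment_add_le Bev (fun d (a : 'F_p) => f d 0) e0.
  have H2 := fourth_moment_add_le Bod (fun d a => e1 d a + e2 d a) e0.
  have H3 := fourth_moment_sub_le Bev (fun d (a : 'F_p) => f d 0) e0.
  have H4 := fourth_moment_sub_le Bod (fun d a => e1 d a + e2 d a) e0.
  by rewrite -/Xev -/Xod in H1 H2 H3 H4 *; split; lra.
Qed.

End FiniteEstimate.

(** * Distinctness of the sequences and the demerit factor of the codebook *)

Section Codebook.
Variables (R : realType) (n : nat) (D : {fset {ffun 'I_n -> R[i]}}).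
Hypothesis n1 : (1 < n)%N.
Hypothesis hD : hadamard_plan D.
Variables (p m : nat) (a0 : 'F_p) (f : D -> 'F_p -> R[i]) (r : D -> int).
Hypothesis pp : prime p.
Hypothesis pnm : p.-1 = (n * m)%N.
Hypothesis m0 : (0 < m)%N.
Hypothesis ha0 : (p.-1).-primitive_root a0.
Hypothesis Hf : forall d (k : 'I_n) (y : 'F_p), y != 0 ->
  f d (a0 ^+ k * y ^+ n) = val d k.

Let p0 : (0 < p)%N. Proof. exact: prime_gt0. Qed.
Let cf := core f.
Let cf_gram x y : \sum_d cf d x * conjc (cf d y) = (Kz n m x y)%:~R.
Proof. exact: (core_gram n1 hD pp pnm m0 ha0 Hf). Qed.

Definition seqs d : int -> R[i] := rotation (f d) (r d).

Lemma seqs_eq d d' : seqs d = seqs d' ->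
  forall x, f d x = f d' (x + ((r d')%:~R - (r d)%:~R)).
Proof.
move=> E x; pose j : 'F_p := x - (r d)%:~R.
have := congr1 (fun g => g (nat_of_ord j)%:Z) E.
rewrite /seqs !rotation_in ?ltn_Fp // natr_Zp /j.
by rewrite addrC subrK => ->; congr (f d' _); ring.
Qed.

Lemma energy_seqs d : energy (seqs d) = (p.-1)%:R + cabs2 (f d 0).
Proof.
rewrite /seqs energy_rotation // (bigD1 0) //= addrC; congr (_ + _).
rewrite (eq_bigr (fun=> 1)); last first.
  by move=> x x0; exact: (core_cabs2 n1 hD pp pnm m0 ha0 Hf).
by rewrite sumr_const; congr (_ *+ _); rewrite (eq_card (_ : _ =i predC1 0)) // cardC1 card_Fp.
Qed.

(* Two distinct sequences of the codebook could only coincide if one were a shift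
   of another, which would give a cross-correlation of size about p. *)
Lemma cross_shift_le (c : 'F_p) d d' : 
  cabs2 (\sum_x cf d x * conjc (cf d' (x + c))) <=
  \sum_w (Ez n m 0 w (w - c) (- c))%:~R.
Proof.
have E : ((\sum_e \sum_e' cabs2 (\sum_x cf e x * conjc (cf e' (x + c))))%:C)%C =
   ((\sum_w (Ez n m 0 w (w - c) (- c))%:~R)%:C)%C.
  rewrite !rmorph_sum /=.
  transitivity (\sum_x \sum_y (\sum_e cf e x * conjc (cf e y)) *
     (\sum_e' cf e' (y + c) * conjc (cf e' (x + c)))).
    under eq_bigr do rewrite rmorph_sum /=.
    under eq_bigr do under eq_bigr do rewrite cabs2E rmorph_sum /= big_distrlr /=.
    under eq_bigr do rewrite exchange_big /=.
    rewrite exchange_big /=; apply: eq_bigr => x _.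
    under eq_bigr do rewrite exchange_big /=.
    rewrite exchange_big /=; apply: eq_bigr => y _.
    rewrite big_distrlr /=; apply: eq_bigr => e _; apply: eq_bigr => e' _.
    by rewrite rmorphM /= conjcK; ring.
  transitivity (\sum_x \sum_w (Kz n m x (x - w) * Kz n m (x - w + c) (x + c))%:~R : R[i]).
    apply: eq_bigr => x _; rewrite [LHS](reindex_inj (inj_comp (addrI x) oppr_inj)) /=.
    by apply: eq_bigr => w _; rewrite !cf_gram -intrM.
  rewrite exchange_big /=; apply: eq_bigr => w _.
  rewrite rmorph_int /Ez rmorph_sum /=; apply: eq_bigr => x _.
  by rewrite subr0 opprB opprK addrA [x + c - w]addrAC.
rewrite -(real_complex_inj E) (bigD1 d) //= (bigD1 d') //= -addrA lerDl.
rewrite addr_ge0 //; apply: sumr_ge0 => e _; first exact: cabs2_ge0.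
by apply: sumr_ge0 => e' _; exact: cabs2_ge0.
Qed.

Variable eps : R.
Hypothesis Heps : forall x x' y y' : 'F_p,
  `|(Ez n m x x' y y' - p%:Z * Ez_main n x x' y y')%:~R| <= eps.

(** As c is nonzero, [Ez_main] vanishes on these quadruples unless w = 0 or w = c, and it never
    exceeds n^2. *)
Lemma sum_Ez_shift_le (c : 'F_p) : c != 0 ->
  \sum_w (Ez n m 0 w (w - c) (- c))%:~R <= p%:R * eps + 2 * p%:R * n%:R ^+ 2.
Proof.
move=> c0.
have bd w : (Ez n m 0 w (w - c) (- c))%:~R <= eps + p%:R * n%:R ^+ 2 * ((w == 0)%:R + (w == c)%:R).
  have H := ler_normlW (Heps 0 w (w - c) (- c)).
  rewrite -lerBlDr; apply: le_trans H.
  rewrite intrB lerD2l lerN2 intrM -mulrA ler_pM2l ?ltr0n //.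
  have -> : n%:R ^+ 2 * ((w == 0)%:R + (w == c)%:R) =
     ((n%:Z ^+ 2) * ((w == 0)%:Z + (w == c)%:Z))%:~R :> R.
    by rewrite intrM intrD expr2 intrM -expr2.
  rewrite ler_int /Ez_main.
  have -> : (0 == - c) = false by rewrite eq_sym oppr_eq0; apply/negbTE.
  rewrite eq_sym [0 == w - c]eq_sym subr_eq0 -[w - c == - c](inj_eq (addIr c)) subrK addNr.
  have n1' : 2 <= n%:Z by [].
  case: (w == 0); case: (w == c) => //=; case: (w == - c) => /=; nia.
apply: le_trans (ler_sum _ (fun w _ => bd w)) _.
rewrite big_split /= sumr_const card_Fp // -mulr_sumr big_split /=.
have S1 (b : 'F_p) : \sum_w (w == b)%:R = 1 :> R.
  by rewrite (bigD1 b) //= eqxx big1 ?addr0 // => w /negPf ->.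
rewrite !S1 -[eps *+ p]mulr_natl lerD2l le_eqVlt; apply/orP; left; apply/eqP; ring.
Qed.

Lemma seqs_inj : p%:R * eps + 2 * p%:R * n%:R ^+ 2 < (p%:R - 2) ^+ 2 -> (2 < p)%N ->
  injective seqs.
Proof.
move=> big p2 d d' E; have H := seqs_eq E.
set c : 'F_p := _ - _ in H.
have [c0|c0] := eqVneq c 0.
  by apply: (f_inj Hf) => x; rewrite H c0 addr0.
have := le_trans (cross_shift_le c d d') (sum_Ez_shift_le c0).
move/(le_lt_trans)/(_ big).
have -> : \sum_x cf d x * conjc (cf d' (x + c)) = ((p%:R - 2 : R)%:C)%C.
  rewrite (bigD1 0) //= /cf /core eqxx mul0r add0r.
  rewrite (bigD1 (- c)) //= ?oppr_eq0 // addNr eqxx rmorph0 mulr0 add0r.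
  rewrite (eq_bigr (fun=> 1)); last first.
    move=> x /andP[x0 xc]; rewrite (negPf x0) -subr_eq0 subr0 -[x + c]opprK.
    rewrite opprK addr_eq0 (negPf xc) -H -cabs2E.
    by rewrite (core_cabs2 n1 hD pp pnm m0 ha0 Hf).
  rewrite sumr_const rmorphB /= !rmorph_nat -natrB //; last exact: ltnW.
  rewrite -[RHS]/((p - 2)%N%:R); congr (_ *+ _).
  rewrite (eq_card (_ : _ =i ~: [set 0; - c])).
    have := cardsC [set 0; - c]; rewrite card_Fp // cards2 eq_sym oppr_eq0 c0 => e.
    by rewrite -[in RHS]e addKn.
  by move=> x; rewrite !inE negb_or.
by rewrite cabs2_real ltxx.
Qed.

Hypothesis inj_seqs : injective seqs.
Variable E : R.
Hypothesis HE : forall d, energy (seqs d) = E.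

Let A : set (int -> R[i]) := [set g | exists d, seqs d = g]%classic.

Lemma fsum_codebook (F : (int -> R[i]) -> R) :
  \sum_(g \in A) F g = \sum_d F (seqs d).
Proof.
have -> : A = [set seqs d | d in [set` enum {: D}]]%classic.
  apply/seteqP; split => g.
    by case=> d <-; exists d => //=; rewrite mem_enum.
  by case=> d _ <-; exists d.
rewrite fsbig_image; last by move=> x y _ _ /inj_seqs.
by rewrite -fsbig_seq ?enum_uniq // big_enum.
Qed.

Lemma CDF_power_sum : CDF A =
  power_sum f r / (2 * p%:R * (n%:R - 1) ^+ 2 * E ^+ 2).
Proof.
have n0 := ltnW n1.
have N1E : n%:R - 1 = #|{: D}|%:R :> R by rewrite hadamard_card // -subn1 natrB.
rewrite /CDF /card_cb fsum_codebook sumr_const -N1E.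
under eq_fsbigr do rewrite fsum_codebook.
rewrite fsum_codebook.
have -> : \sum_d \sum_d' CDF2 (seqs d) (seqs d') =
   ((2 * p)%:R^-1 * power_sum f r) / (E ^+ 2).
  under eq_bigr do under eq_bigr do rewrite /CDF2 !HE
    (sum_crosscorr pp (cabs2_root2p R p) (root2p_prim R (prime_gt1 pp))) -expr2.
  under eq_bigr do rewrite -mulr_suml -mulr_sumr exchange_big /=.
  rewrite -mulr_suml -mulr_sumr; congr (_ * _ / _).
  rewrite exchange_big /=; apply: eq_bigr => t _.
  by rewrite expr2 big_distrlr /=.
rewrite natrM !invfM; ring.
Qed.

Lemma SDC_le : (0 < #|{: D}|)%N -> SDC A <= E.
Proof.
move/card_gt0P => [d _]; apply: ge_inf; last by exists (seqs d); [exists d|exact: HE].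
exists E => x [g [d' <-]] <-; by rewrite HE.
Qed.

End Codebook.

(** * Passage to the limit *)

Section Numerics.
Variable R : realType.

(** Here [s] is the true normalized power, [b] the model and [q] the correction of the
    normalization. The order of choices matters: [eta] is fixed from the target accuracy, and only
    then is [beta] made small enough to absorb (1 + 1/eta)^3. *)
Lemma squeeze_perturb (L eps : R) : 0 <= L -> 0 < eps -> exists2 beta : R, 0 < beta &
  forall s b er q : R, 0 <= s -> 0 <= er -> er <= beta -> `|b - L| <= beta ->
  `|q - 1| <= beta ->
  (forall eta : R, 0 < eta ->
     s <= (1 + eta) ^+ 3 * b + (1 + eta^-1) ^+ 3 * er /\
     b <= (1 + eta) ^+ 3 * s + (1 + eta^-1) ^+ 3 * er) ->
  `|s * q - L| < eps.
Proof.
move=> L0 e0.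
have [e [ee e1 ep]] : exists e : R, [/\ e <= eps, e <= 1 & 0 < e].
  by exists (Num.min eps 1); rewrite !ge_min !lexx orbT lt_min e0 ltr01.
have L2 : 0 < L + 2 by lra.
(* 56 = 7 * 8: for eta at most 1 the cube is at most 1 + 7 eta, and this part of the error is to be
   e / 8. *)
have [eta etap etaE] : exists2 eta : R, 0 < eta & eta * (56 * (L + 2)) = e.
  have d0 : 0 < 56 * (L + 2) by rewrite mulr_gt0.
  by exists (e / (56 * (L + 2))); [rewrite divr_gt0|rewrite divfK // gt_eqF].
have eta1 : eta <= 1 by nra.
have [C CE] : exists C, C = (1 + eta^-1) ^+ 3 by eexists.
have Cp : 1 <= C by rewrite CE exprn_ege1 // lerDl invr_ge0 ltW.
have Cp0 : 0 < C by apply: lt_le_trans Cp.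
have [beta betap betaE] : exists2 beta : R, 0 < beta & beta * (8 * (L + 2) * C) = e.
  have d0 : 0 < 8 * (L + 2) * C by rewrite mulr_gt0 // mulr_gt0.
  by exists (e / (8 * (L + 2) * C)); [rewrite divr_gt0|rewrite divfK // gt_eqF].
exists beta => // s b er q s0 er0 erb bL q1 H.
have {H} [H1 H2] := H eta etap; rewrite -CE in H1 H2.
have c3 : (1 + eta) ^+ 3 <= 1 + 7 * eta.
  have -> : (1 + eta) ^+ 3 = 1 + 3 * eta + 3 * (eta * eta) + eta * eta * eta by ring.
  nra.
have c3' : 1 <= (1 + eta) ^+ 3 by rewrite exprn_ege1 // lerDl ltW.
have betaC : beta * C * 16 <= e.
  have := mulr_ge0 (ltW betap) (le_trans ler01 Cp); nra.
have beta8 : beta * (8 * (L + 2)) <= e.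
  have := mulr_ge0 (ltW betap) (_ : 0 <= 8 * (L + 2)); nra.
have erC : C * er <= e / 16 by nra.
have eL : 7 * eta * (L + 2) = e / 8 by lra.
move: bL q1; rewrite !ler_norml => /andP[b1 b2] /andP[q1 q2].
have beta16 : beta <= e / 16 by nra.
have b0 : b <= L + 1 by lra.
have s1 : s <= L + e / 16 + e / 8 + e / 16.
  have [bn|bn] := leP 0 b; last by nra.
  by nra.
have sL1 : s <= L + 1 by lra.
have s2 : L - e / 16 - e / 8 - e / 16 <= s.
  by nra.
have sq : `|s * q - s| <= e / 8.
  rewrite -{2}[s]mulr1 -mulrBr normrM (ger0_norm s0).
  have : `|q - 1| <= beta by rewrite ler_norml; apply/andP; split; lra.
  have := normr_ge0 (q - 1); move: `|q - 1| => x x0 xb.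
  nra.
move: sq; rewrite ler_norml => /andP[sq1 sq2].
by rewrite ltr_norml; apply/andP; split; lra.
Qed.

(** Among integer translates, u (1 - u) is largest at the representative in [0, 1]. Comparing maxima
    in both directions makes the dependence on fractional parts continuous, with no case distinction
    where the floor jumps. *)
Lemma frac_parab_max (u : R) (m : int) : 0 <= u -> u <= 1 ->
  (u + m%:~R) * (1 - (u + m%:~R)) <= u * (1 - u).
Proof.
move=> u0 u1; rewrite -subr_ge0.
have -> : u * (1 - u) - (u + m%:~R) * (1 - (u + m%:~R)) = m%:~R * (m%:~R - 1 + 2 * u) by ring.
have [m0|m0] := leP 1 m.
  have m0' : 1 <= m%:~R :> R by rewrite (ler_int _ 1).
  by rewrite mulr_ge0 //; lra.
have [->|m1] := eqVneq m 0; first by rewrite mul0r.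
have : m <= -1 by lia.
rewrite -(ler_int R) rmorphN1 => m2.
by rewrite mulr_le0 //; lra.
Qed.

(** The square (2t - 1)^2 with t the fractional part of x. *)
Definition psi (x : R) : R := 2 * Phi x + 3^-1.

Lemma psi_close (x y kap : R) (j : int) : 0 <= kap -> kap <= 1 -> kap = j%:~R - y ->
  `|(2 * kap - 1) ^+ 2 - psi x| <= 4 * (`|y - x| + (y - x) ^+ 2).
Proof.
move=> k0 k1 kE; set t := x - (Num.floor x)%:~R.
have t0 : 0 <= t by rewrite subr_ge0 floor_le_tmp.
have t1 : t <= 1 by rewrite lerBlDr addrC -[1]/(1%:~R) -intrD ltW // floorD1_gt.
have -> : psi x = (2 * t - 1) ^+ 2.
  by rewrite /psi /Phi -/t; field.
set e := y - x.
have H1 := frac_parab_max (j - 1 - Num.floor x) (_ : 0 <= 1 - kap) (_ : 1 - kap <= 1).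
have {}H1 : (t + e) * (1 - (t + e)) <= kap * (1 - kap).
  have -> : t + e = 1 - kap + (j - 1 - Num.floor x)%:~R.
    by rewrite /t /e kE !intrB; ring.
  by apply: le_trans (H1 _ _) _; lra.
have H2 := frac_parab_max (Num.floor x + 1 - j) t0 t1.
have {}H2 : (1 - kap - e) * (1 - (1 - kap - e)) <= t * (1 - t).
  have -> : 1 - kap - e = t + (Num.floor x + 1 - j)%:~R.
    by rewrite /t /e kE intrB intrD; ring.
  exact: H2.
have a1 := ler_norm e; have a2 : - e <= `|e| by rewrite -normrN ler_norm.
have a3 := normr_ge0 e.
rewrite ler_norml; apply/andP; split; nra.
Qed.

(** With j = l / 20 one has 2^l >= (j + 1)^20; ten of these factors match l^10 up to 20^10, and the
    other ten beat the constants. The exponent 10 arises because k = l^5 occurs squared in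
    Stepanov's condition. *)
Lemma exp_beats_pow (c : nat) : exists l1 : nat, forall l, (l1 <= l)%N -> (c * l ^ 10 < 2 ^ l)%N.
Proof.
exists (20 * (20 * c.+1))%N => l h.
set j := (l %/ 20)%N.
have lj : (l <= 20 * j.+1)%N by have := ltn_ceil l (isT : (0 < 20)%N); rewrite mulnC => /ltnW.
have jl : (j * 20 <= l)%N by exact: leq_trunc_div.
have jc : (20 * c.+1 <= j)%N by rewrite /j leq_divRL // mulnC.
apply: (@leq_trans (2 ^ (j * 20))); last by rewrite leq_exp2l.
apply: (@leq_trans (j.+1 ^ 20)); last first.
  by rewrite expnM leq_exp2r // ltn_expl.
apply: (@leq_ltn_trans (c * (20 * j.+1) ^ 10)).
  by rewrite leq_mul2l leq_exp2r // lj orbT.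
have -> : (20 = 10 + 10)%N by [].
rewrite expnD expnMn mulnA ltn_pmul2r ?expn_gt0 //.
apply: (@leq_trans ((20 * c.+1) ^ 10)); last by rewrite leq_exp2r // leqW.
rewrite expnMn [(c * _)%N]mulnC ltn_pmul2l ?expn_gt0 //.
by apply: leq_trans (_ : c.+1 <= c.+1 ^ 10)%N; rewrite // -{1}[c.+1]expn1 leq_pexp2l.
Qed.

End Numerics.

Lemma large_prime_regime (n l0 : nat) : (0 < n)%N -> exists M : nat, forall p, (M < p)%N ->
  exists l : nat, [/\ (l0 <= l)%N, (0 < l)%N, (p < 2 ^ l)%N &
    (n * l ^ 5 * (2 * n * (n * l ^ 5) + (l ^ 5).+1) < p.-1)%N].
Proof.
(* The left side of the condition is at most 4 n^3 k^2. The 8 allows for 2^l being as large as 2p,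
   and the 4 leaves room to pass from p to p - 1. *)
move=> n0; pose c := (8 * n ^ 3 + 4)%N.
have [l1 Hl1] := exp_beats_pow c.
exists (2 ^ (l0 + l1).+1)%N => p Mp; exists (trunc_log 2 p).+1.
have p0 : (0 < p)%N by apply: leq_ltn_trans Mp.
have t1 : ((l0 + l1).+1 <= trunc_log 2 p)%N.
  by apply: trunc_log_max => //; apply: ltnW.
have [t2 t3] : (2 ^ trunc_log 2 p <= p)%N /\ (p < 2 ^ (trunc_log 2 p).+1)%N.
  by split; [exact: trunc_logP|exact: trunc_log_ltn].
split => //; first by lia.
set l := (trunc_log 2 p).+1 in t3 *.
have h : (c * l ^ 10 < 2 ^ l)%N by apply: Hl1; rewrite /l; lia.
have {}h : (c * l ^ 10 < 2 * p)%N.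
  by apply: leq_trans h _; rewrite /l expnS leq_mul2l t2.
have kk : (l ^ 10 = l ^ 5 * l ^ 5)%N by rewrite -expnD.
have k0 : (0 < l ^ 5)%N by rewrite expn_gt0.
move: h; rewrite kk /c; move: (l ^ 5)%N k0 => k k0.
have -> : (n ^ 3 = n * (n * n))%N by rewrite !expnS expn0 muln1.
move=> h.
have e1 : (n * k <= n * (k * k))%N by rewrite leq_mul2l leq_pmulr ?orbT.
have e2 : (n * (k * k) <= n * (n * n) * (k * k))%N.
  by rewrite leq_mul2r leq_pmulr ?muln_gt0 ?n0 ?orbT.
have -> : (n * k * (2 * n * (n * k) + k.+1) =
  2 * (n * (n * n) * (k * k)) + n * (k * k) + n * k)%N by ring.
have k1 : (1 <= k * k)%N by rewrite muln_gt0 k0.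
rewrite mulnDl -mulnA in h.
move: h e1 e2 k1; move: (n * (n * n) * (k * k))%N (n * (k * k))%N (n * k)%N (k * k)%N; lia.
Qed.

Lemma Ez_bound_real (R : realType) (p n m k : nat) (a0 : 'F_p) :
  prime p -> p.-1 = (n * m)%N -> (0 < n)%N -> (0 < m)%N -> (p.-1).-primitive_root a0 ->
  (0 < k)%N -> (n * k * (2 * n * (n * k) + k.+1) < p.-1)%N ->
  forall x x' y y' : 'F_p, `|(Ez n m x x' y y' - p%:Z * Ez_main n x x' y y')%:~R| <=
    (n%:R ^+ 2 * p%:R + 16 * k%:R * n%:R ^+ 2) / k%:R :> R.
Proof.
move=> pp pnm n0 m0 ha0 k0 pk x x' y y'.
have := Ez_bound pp pnm n0 m0 ha0 k0 pk x x' y y'.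
move: (Ez n m x x' y y' - p%:Z * Ez_main n x x' y y') => X.
rewrite -(ler_int R) intrM intr_norm => H.
rewrite ler_pdivlMr ?ltr0n // mulrC; apply: le_trans H _.
by rewrite !expr2 intrD !intrM.
Qed.

Lemma intr_Fp_eq0 (p : nat) (x : int) : prime p ->
  x%:~R = 0 :> 'F_p -> exists j : int, x = j * p%:Z.
Proof.
move=> pp h.
have key (q : nat) : (q%:R == 0 :> 'F_p) -> exists j : int, q%:Z = j * p%:Z.
  by rewrite -(dvdn_pcharf (pchar_Fp pp)) => /dvdnP[j ->]; exists j%:Z.
case: x h => q h; first by apply: key; apply/eqP.
have [|j jE] := key q.+1; first by rewrite -oppr_eq0; apply/eqP.
by exists (- j); rewrite mulNr -jE NegzE.
Qed.

(** * The demerit factor at one large prime *)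

Section PrimeEstimate.
Variables (R : realType) (n : nat) (D : {fset {ffun 'I_n -> R[i]}}).
Hypothesis n1 : (1 < n)%N.
Hypothesis hD : hadamard_plan D.
Variable rho : R.

Definition limit_CDF (x : R) : R :=
  1 + (3 * (n.-1)%:R)^-1 + ((n.-1)%:R)^-1 * Phi (2 * x).

Variables (p m : nat) (a0 : 'F_p) (f : D -> 'F_p -> R[i]) (r : D -> int) (u : bool).
Hypothesis pp : prime p.
Hypothesis pnm : p.-1 = (n * m)%N.
Hypothesis ha0 : (p.-1).-primitive_root a0.
Hypothesis Hf : forall d (k : 'I_n) (y : 'F_p), y != 0 ->
  f d (a0 ^+ k * y ^+ n) = val d k.
Hypothesis Hf0 : forall d, cabs2 (f d 0) = u%:R.
(** One small parameter dominates all errors: the deviation of the rotations and 1/l, and through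
    the latter also 1/p and the relative error of [Ez]. *)
Variable w : R.
Hypothesis w1 : w <= 1.
Hypothesis Hr : forall d, `|(r d)%:~R / p%:R - rho| <= w.
Variable l : nat.
Hypothesis l0 : (0 < l)%N.
Hypothesis pl : (p < 2 ^ l)%N.
Hypothesis pk : (n * l ^ 5 * (2 * n * (n * l ^ 5) + (l ^ 5).+1) < p.-1)%N.
Hypothesis lw : l%:R^-1 <= w.
Hypothesis wsmall : 200 * n%:R ^+ 2 * w <= 1.

Let n0 : (0 < n)%N. Proof. exact: ltnW. Qed.
Let p1 : (1 < p)%N. Proof. exact: prime_gt1. Qed.
Let m0 : (0 < m)%N.
Proof. by have : (0 < p.-1)%N; [lia|rewrite pnm muln_gt0 => /andP[]]. Qed.
Let k := (l ^ 5)%N.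
Let k0 : (0 < k)%N. Proof. by rewrite expn_gt0 l0. Qed.
Let P : R := p%:R.
Let P0 : 0 < P. Proof. by rewrite ltr0n ltnW. Qed.
Let lR : 1 <= l%:R :> R. Proof. by rewrite ler1n. Qed.
Let nR : 2 <= n%:R :> R. Proof. by rewrite ler_nat. Qed.

Let n_sqr_ge4 : 4 <= n%:R ^+ 2 :> R.
Proof.
have -> : (4 : R) = 2 ^+ 2 by ring.
by rewrite ler_pXn2r // nnegrE.
Qed.

Definition Ez_err : R := (n%:R ^+ 2 * P + 16 * k%:R * n%:R ^+ 2) / k%:R.

Lemma Ez_err_bound (x x' y y' : 'F_p) :
  `|(Ez n m x x' y y' - p%:Z * Ez_main n x x' y y')%:~R| <= Ez_err.
Proof.
exact: (Ez_bound_real R pp pnm n0 m0 ha0 k0 pk).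
Qed.

Let Ez_err_ge0 : 0 <= Ez_err.
Proof.
have h : 0 <= n%:R ^+ 2 :> R by rewrite exprn_ge0.
by rewrite /Ez_err divr_ge0 // addr_ge0 ?mulr_ge0 ?(ltW P0).
Qed.

Let kp : (k <= p)%N.
Proof.
apply: ltnW; apply: leq_trans (leq_pred p); apply: leq_trans pk.
by rewrite ltnS -mulnA mulnC -mulnA leq_pmulr // muln_gt0 n0 addnS.
Qed.

Let y : R := P^-1.
Let y0 : 0 < y. Proof. by rewrite invr_gt0. Qed.
Let yw : y <= w.
Proof.
have h : l%:R <= P.
  by rewrite ler_nat; apply: leq_trans kp; have := leq_pexp2l l0 (isT : (1 <= 5)%N); rewrite expn1.
by apply: le_trans lw; rewrite /y lef_pV2 ?posrE // ltr0n.
Qed.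

(** The relative error of [Ez] times the fourth power of the l1 norm, up to a constant. For k = l^5
    it is n^2 / l plus 16 n^2 l^4 / p, which explains the 17 in its bound. *)
Let Z : R := Ez_err * l%:R ^+ 4 / P.

Let Z0 : 0 <= Z.
Proof.
apply: divr_ge0; last exact: ltW.
by apply: mulr_ge0 => //; apply: exprn_ge0; rewrite ler0n.
Qed.

Let ZE : Ez_err * l%:R ^+ 4 = Z * P. Proof. by rewrite /Z divfK // gt_eqF. Qed.

Let Zw : Z <= 17 * n%:R ^+ 2 * w.
Proof.
have l5 : k%:R = l%:R ^+ 5 :> R by rewrite natrX.
have lp : l%:R ^+ 5 <= P by rewrite -l5 ler_nat.
have lnz : l%:R != 0 :> R by rewrite pnatr_eq0 -lt0n.
have -> : Z = n%:R ^+ 2 * (l%:R^-1 + 16 * (l%:R ^+ 4 / P)).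
  by rewrite /Z /Ez_err l5; field; rewrite lnz gt_eqF.
have h : l%:R ^+ 4 / P <= l%:R^-1.
  by rewrite ler_pdivrMr // mulrC ler_pdivlMr ?ltr0n // -exprSr.
have -> : 17 * n%:R ^+ 2 * w = n%:R ^+ 2 * (17 * w) by ring.
apply: ler_wpM2l; first by rewrite exprn_ge0.
by move: h lw; lra.
Qed.

Lemma energy_val d : energy (seqs f r d) = (p.-1)%:R + u%:R.
Proof. by rewrite (energy_seqs n1 hD r pp pnm m0 ha0 Hf) Hf0. Qed.

Lemma seqs_injective : injective (seqs f r).
Proof.
apply: (seqs_inj n1 hD pp pnm m0 ha0 Hf Ez_err_bound).
  have e1 : Ez_err <= Z * P by rewrite -ZE ler_peMr ?exprn_ege1.
  have e2 : Z * P <= P / 8.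
    by rewrite mulrC ler_pM2l //; move: Zw wsmall; lra.
  have e3 : 1 <= w * P by rewrite -ler_pdivrMr // mul1r.
  have e4 : 200 * n%:R ^+ 2 <= P.
    apply: (@le_trans _ _ (200 * n%:R ^+ 2 * (w * P))).
      by rewrite ler_peMr // mulr_ge0 // exprn_ge0.
    by rewrite mulrA ler_piMl // ltW.
  have e5 := n_sqr_ge4.
  rewrite -/P; nra.
have : (0 < n * k * (2 * n * (n * k) + k.+1))%N.
  by rewrite muln_gt0 addnS andbT muln_gt0 n0; exact: k0.
by move/leq_ltn_trans => /(_ _ pk) h; rewrite -(prednK (ltnW p1)) ltnS.
Qed.

Variable d0 : D.
Let N1 : R := n%:R - 1.
Let N1_ge1 : 1 <= N1. Proof. by move: nR; rewrite /N1; lra. Qed.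

Let w0 : 0 < w. Proof. exact: lt_le_trans yw. Qed.
Let w8 : 800 * w <= 1. Proof.
have h : 0 <= (n%:R ^+ 2 - 4) * w by rewrite mulr_ge0 ?subr_ge0 // ltW.
by move: h wsmall; lra.
Qed.

Let r_close d : `|(r d - r d0)%:~R| <= 2 * w * P.
Proof.
have E e : (r e)%:~R = ((r e)%:~R / P) * P :> R by rewrite divfK // gt_eqF.
rewrite intrB E [X in _ - X]E -mulrBl normrM (gtr0_norm P0) ler_pM2r //.
have := Hr d; have := Hr d0; rewrite -/P !ler_norml => /andP[a1 a2] /andP[b1 b2].
by apply/andP; split; lra.
Qed.

Lemma tau_close : `|tau p r d0 ^+ 2 - psi (2 * rho)| <= 32 * w.
Proof.
pose kap := nat_of_ord (- ((r d0)%:~R + (r d0)%:~R) : 'F_p).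
have [j jE] : exists j : int, kap%:Z + 2 * r d0 = j * p%:Z.
  apply: intr_Fp_eq0 => //; rewrite intrD -pmulrn natr_Zp intrM; ring.
have kap_lt : (kap < p)%N by exact: ltn_Fp.
set kp' := kap%:R / P.
have k1 : 0 <= kp' by rewrite divr_ge0 // ltW.
have k2 : kp' <= 1 by rewrite ler_pdivrMr // mul1r ler_nat ltnW.
set v := (r d0)%:~R / P.
have kE : kp' = j%:~R - 2 * v.
  have : (kap%:R + 2 * (r d0)%:~R = j%:~R * P :> R).
    by move/(congr1 (fun x : int => x%:~R : R)): jE; rewrite intrD !intrM.
  move=> h; have Pn := lt0r_neq0 P0.
  have -> : j%:~R = (kap%:R + 2 * (r d0)%:~R) / P by rewrite h mulfK.
  by rewrite /kp' /v; field.
have H := psi_close (2 * rho) k1 k2 kE.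
(* The k + 1 in [cweight], instead of k, becomes the extra 2 / p. *)
have tE : tau p r d0 = 2 * kp' - 1 + 2 * y.
  rewrite /tau /cweight -/kap natrM -natr1 /kp' /y -/P; field; exact: lt0r_neq0.
have := Hr d0; rewrite -/P -/v ler_norml => /andP[v1 v2].
have e1 : `|2 * v - 2 * rho| <= 2 * w by rewrite ler_norml; apply/andP; split; lra.
have e2 : (2 * v - 2 * rho) ^+ 2 <= w.
  move: e1; rewrite ler_norml => /andP[x1 x2].
  have ww : 800 * (w * w) <= w by rewrite mulrA ler_piMl // ltW.
  have h : 0 <= (2 * w - (2 * v - 2 * rho)) * (2 * w + (2 * v - 2 * rho)).
    by rewrite mulr_ge0 //; lra.
  by move: h ww w0; lra.
have {H} : `|(2 * kp' - 1) ^+ 2 - psi (2 * rho)| <= 12 * w by apply: le_trans H _; lra.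
have y1 := y0; have y2 := yw; have w9 := w8.
rewrite tE !ler_norml => /andP[h1 h2]; apply/andP; split; nra.
Qed.

Lemma limit_CDF_psi : limit_CDF rho = 1 + (3^-1 + psi (2 * rho)) / (2 * N1).
Proof.
have nE : n.-1%:R = N1 by rewrite /N1 -subn1 natrB.
rewrite /limit_CDF nE /psi; field; apply: lt0r_neq0; exact: lt_le_trans N1_ge1.
Qed.

Variables (eps beta : R).
(** A generous constant: the largest demand is 128 * 128 * 17 n^2 w, from the differences of rotated
    kernels. *)
Hypothesis beta_w : 1000 * 1000 * n%:R ^+ 2 * w <= beta.
Hypothesis squeeze : forall s b er q : R, 0 <= s -> 0 <= er -> er <= beta ->
  `|b - limit_CDF rho| <= beta -> `|q - 1| <= beta ->
  (forall eta : R, 0 < eta ->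
     s <= (1 + eta) ^+ 3 * b + (1 + eta^-1) ^+ 3 * er /\
     b <= (1 + eta) ^+ 3 * s + (1 + eta^-1) ^+ 3 * er) ->
  `|s * q - limit_CDF rho| < eps.

Lemma CDF_close :
  `|CDF [set g | exists d, seqs f r d = g]%classic - limit_CDF rho| < eps.
Proof.
have Hf0' d : cabs2 (f d 0) <= 1 by rewrite Hf0; case: u.
have Ez0 := Ez_err_ge0.
have delp : 2 * w * P < P by rewrite gtr_pMl //; have := w8; lra.
have [S [Er [SE Er0 Erle Hpert]]] := spectral_estimate n1 hD pp pnm m0 ha0 Hf Hf0' Ez0
  Ez_err_bound pl r_close delp.
have := main_power_estimate n1 hD r pp pnm m0 ha0 Hf Ez0 Ez_err_bound d0 pl.
set B := _ + fourth_moment _ in Hpert *; rewrite -/N1 -/P => HB.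
rewrite (CDF_power_sum n1 hD pp seqs_injective energy_val) SE -/N1 -/P.
set E := _ + u%:R.
have Pn : P != 0 by exact: lt0r_neq0.
have Nn : N1 != 0 by apply: lt0r_neq0; exact: lt_le_trans N1_ge1.
have P2 : 2 <= P by rewrite /P ler_nat.
have pP : (p.-1)%:R = P - 1 :> R by rewrite -subn1 natrB // ltnW.
have E1 : P - 1 <= E by rewrite /E pP lerDl ler0n.
have E2 : E <= P by rewrite /E pP; case: u => /=; rewrite ?mulr1n ?mulr0n; lra.
have E0 : 0 < E by lra.
(* The denominator of the demerit factor with the energy replaced by p; the ratio p^2 / E^2 is split
   off as [q]. *)
pose c := 2 * P ^+ 3 * N1 ^+ 2.
have c0 : 0 < c by rewrite !mulr_gt0 ?exprn_gt0 //; exact: lt_le_trans N1_ge1.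
have -> : S / (2 * P * N1 ^+ 2 * E ^+ 2) = (S / c) * (P ^+ 2 / E ^+ 2).
  by rewrite /c; field; rewrite Pn Nn lt0r_neq0.
have nN : N1 ^+ 2 + 2 * N1 <= n%:R ^+ 2 by rewrite /N1; lra.
have N2 : 1 <= N1 ^+ 2 by rewrite exprn_ege1.
have n4 := n_sqr_ge4.
have ww := w0; have w9 := w8; have Zw' := Zw; have Z0' := Z0; have y1 := y0; have y2 := yw.
have nw : 4 * w <= n%:R ^+ 2 * w by rewrite ler_pM2r.
apply: (squeeze (b := B / c) (er := Er / c)).
- rewrite divr_ge0 ?(ltW c0) // -SE; apply: sumr_ge0 => t _; exact: sqr_ge0.
- by rewrite divr_ge0 // ltW.
- rewrite ler_pdivrMr //; apply: le_trans Erle _; rewrite -/N1 -/P.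
  have -> : P ^+ 2 * Ez_err * (8 * l%:R) ^+ 4 = 64 * 64 * P ^+ 3 * Z.
    transitivity (64 * 64 * P ^+ 2 * (Ez_err * l%:R ^+ 4)); first by ring.
    by rewrite ZE; ring.
  have -> : 4 * (2 * w * P) / P = 8 * w by field.
  have -> : 9 * P * N1 ^+ 2 = c * (9 / 2 * y ^+ 2) by rewrite /c /y; field.
  have -> : 8 * N1 ^+ 2 * (P ^+ 3 * ((N1 ^+ 2 + 2 * N1) * (8 * w) ^+ 2) + 64 * 64 * P ^+ 3 * Z) =
     c * (256 * ((N1 ^+ 2 + 2 * N1) * w ^+ 2) + 128 * 128 * Z) by rewrite /c; ring.
  rewrite -mulrDr [leRHS]mulrC ler_pM2l //; apply: le_trans beta_w.
  have h1 : y ^+ 2 <= w by nra.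
  have h2 : (N1 ^+ 2 + 2 * N1) * w ^+ 2 <= n%:R ^+ 2 * w.
    apply: ler_pM => //; last by nra.
      by have := N1_ge1; nra.
    exact: sqr_ge0.
  lra.
- have -> : B / c - limit_CDF rho =
    (B - (P ^+ 2 * N1 ^+ 2 * p.-1%:R + P ^+ 3 * main_power p r d0)) / c +
    ((P ^+ 2 * N1 ^+ 2 * p.-1%:R + P ^+ 3 * main_power p r d0) / c - limit_CDF rho) by ring.
  apply: le_trans (ler_normD _ _) _.
  have h1 : `|(B - (P ^+ 2 * N1 ^+ 2 * p.-1%:R + P ^+ 3 * main_power p r d0)) / c| <= 128 * Z.
    rewrite normrM (ger0_norm (_ : 0 <= c^-1)) ?invr_ge0 ?(ltW c0) //.
    rewrite ler_pdivrMr //; apply: le_trans HB _.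
    have -> : P ^+ 2 * Ez_err * (4 * l%:R) ^+ 4 = 256 * P ^+ 3 * Z.
      transitivity (256 * P ^+ 2 * (Ez_err * l%:R ^+ 4)); first by ring.
      by rewrite ZE; ring.
    have -> : 128 * Z * c = 256 * P ^+ 3 * Z * N1 ^+ 2 by rewrite /c; ring.
    rewrite ler_peMr //; apply: mulr_ge0 => //; apply: mulr_ge0 => //.
    by apply: exprn_ge0; exact: ltW.
  (* Even frequencies contribute about 1/2 and odd ones about 1/2 + (tau^2 + 1 - 2/3) / (2 N1),
     which add up to the limit once tau^2 is close to [psi (2 * rho)]. *)
  have h2 : `|(P ^+ 2 * N1 ^+ 2 * p.-1%:R + P ^+ 3 * main_power p r d0) / c -
      limit_CDF rho| <= 20 * w.
    rewrite limit_CDF_psi pP /main_power -/N1 -/P.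
    have := tau_close; set t := tau _ _ _; set ps := psi _ => ht.
    have -> : (P ^+ 2 * N1 ^+ 2 * (P - 1) +
       P ^+ 3 * (N1 ^+ 2 + N1 * (t ^+ 2 + 1 - 2 * ((P ^+ 2 + 2) / (3 * P ^+ 2))))) / c -
       (1 + (3^-1 + ps) / (2 * N1)) =
       - (y / 2) + ((t ^+ 2 - ps) / 2 - 2 / 3 * y ^+ 2) / N1.
      by rewrite /c /y; field; rewrite Pn Nn.
    have hy : y ^+ 2 <= w by nra.
    move: ht; rewrite !ler_norml => /andP[ht1 ht2].
    set q := _ / 2 - _.
    have q1 : `|q| <= 17 * w.
      by rewrite ler_norml /q; have := sqr_ge0 y; move=> ?; apply/andP; split; lra.
    have : `|q / N1| <= 17 * w.
      rewrite normrM (ger0_norm (_ : 0 <= N1^-1)) ?invr_ge0; last by have := N1_ge1; lra.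
      rewrite ler_pdivrMr; last exact: lt_le_trans N1_ge1.
      by apply: le_trans q1 _; rewrite ler_peMr //; lra.
    by rewrite ler_norml => /andP[q2 q3]; apply/andP; split; lra.
  have h3 := lerD h1 h2; apply: le_trans h3 _; apply: le_trans beta_w; lra.
- have -> : P ^+ 2 / E ^+ 2 - 1 = (P ^+ 2 - E ^+ 2) / E ^+ 2 by field; rewrite lt0r_neq0.
  rewrite ger0_norm; last by rewrite divr_ge0 ?sqr_ge0 // subr_ge0 ler_pXn2r ?nnegrE // ltW.
  rewrite ler_pdivrMr ?exprn_gt0 //.
  have yP : y * P = 1 by rewrite /y mulVf.
  have b8 : 8 * y <= beta by apply: le_trans beta_w; lra.
  have : P ^+ 2 - E ^+ 2 <= 8 * y * E ^+ 2.
    have : P / 2 <= E by lra.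
    move=> hE; have : 8 * y * (P / 2 * (P / 2)) <= 8 * y * (E * E).
      by rewrite ler_pM2l ?mulr_gt0 // ler_pM //; lra.
    have -> : 8 * y * (P / 2 * (P / 2)) = 2 * (y * P) * P by field.
    rewrite yP -expr2; have : (P - 1) ^+ 2 <= E ^+ 2 by rewrite ler_pXn2r // ?nnegrE; lra.
    lra.
  by move=> h; apply: le_trans h _; rewrite ler_pM2r ?exprn_gt0.
move=> eta e0; have [H1 H2] := Hpert eta e0.
rewrite !mulrA -!mulrDl !ler_pM2r ?invr_gt0 //.
Qed.

End PrimeEstimate.

Local Open Scope classical_set_scope.

(** * The minimum of the limit, and convergence along the family *)

Lemma limit_CDF_sqr (R : realType) (n : nat) (x : R) : (1 < n)%N ->
  limit_CDF n x = 1 + (6 * (n.-1)%:R)^-1 +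
    2 * (2 * x - (Num.floor (2 * x))%:~R - 2^-1) ^+ 2 / (n.-1)%:R.
Proof.
move=> n1; have nn : (n.-1)%:R != 0 :> R by rewrite pnatr_eq0 -lt0n -subn1 subn_gt0.
by rewrite /limit_CDF /Phi; field.
Qed.

Lemma limit_CDF_ge (R : realType) (n : nat) (x : R) : (1 < n)%N ->
  1 + (6 * (n.-1)%:R)^-1 <= limit_CDF n x.
Proof.
by move=> n1; rewrite limit_CDF_sqr // lerDl divr_ge0 // mulr_ge0 // sqr_ge0.
Qed.

Lemma limit_CDF_eq_min (R : realType) (n : nat) (x : R) : (1 < n)%N ->
  limit_CDF n x = 1 + (6 * (n.-1)%:R)^-1 <-> exists m : int, x = (2 * m + 1)%:~R / 4.
Proof.
move=> n1; have nn : (n.-1)%:R != 0 :> R by rewrite pnatr_eq0 -lt0n -subn1 subn_gt0.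
rewrite limit_CDF_sqr //; split.
  move=> h.
  have : 2 * (2 * x - (Num.floor (2 * x))%:~R - 2^-1) ^+ 2 / (n.-1)%:R = 0.
    by apply: (addrI (1 + (6 * (n.-1)%:R)^-1)); rewrite addr0.
  move/eqP; rewrite mulf_eq0 invr_eq0 (negPf nn) orbF mulf_eq0 pnatr_eq0 /= sqrf_eq0.
  move/eqP => e; exists (Num.floor (2 * x)).
  by rewrite intrD intrM; move: e; move: (_%:~R) => v e; lra.
case=> m ->; have -> : Num.floor (2 * ((2 * m + 1)%:~R / 4) : R) = m.
  apply: floor_def; apply/andP; split; rewrite !intrD intrM; lra.
by rewrite intrD intrM; field.
Qed.

Lemma CDF_limit (R : realType) (alpha : forall p : nat, 'F_p)
  (halpha : forall p : nat, prime p -> (p.-1).-primitive_root (alpha p))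
  (n : nat) (n1 : (1 < n)%N) (D : {fset {ffun 'I_n -> R[i]}})
  (hD : hadamard_plan D) (rho : R) (unimod : bool) (I : Type)
  (A : I -> set (int -> R[i])) :
  coherently_rotated unimod alpha D rho A ->
  forall eps : R, 0 < eps -> exists M : R, forall i : I,
    M < SDC (A i) -> `|CDF (A i) - limit_CDF n rho| < eps.
Proof.
case=> p [r [f [Hp _ Hper HA Hr]]] eps e0.
have n0 : (0 < n)%N by exact: ltnW.
have L0 : 0 <= limit_CDF n rho.
  by apply: le_trans (limit_CDF_ge rho n1); rewrite addr_ge0 // invr_ge0 mulr_ge0.
have [beta b0 Hsq] := squeeze_perturb L0 e0.
have nR : 1 <= n%:R ^+ 2 :> R by rewrite exprn_ege1 // ler1n.
have nR0 : 0 < n%:R ^+ 2 :> R by apply: lt_le_trans nR.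
have [w [w0 w1 w2 w3]] : exists w : R, [/\ 0 < w, w <= 1, 200 * n%:R ^+ 2 * w <= 1
    & 1000 * 1000 * n%:R ^+ 2 * w <= beta].
  have c1 : 0 < 200 * n%:R ^+ 2 :> R by rewrite mulr_gt0.
  have c2 : 0 < 1000 * 1000 * n%:R ^+ 2 :> R by rewrite mulr_gt0 // mulr_gt0.
  exists (Num.min (1 / (200 * n%:R ^+ 2)) (beta / (1000 * 1000 * n%:R ^+ 2))).
  split.
  - by rewrite lt_min divr_gt0 //= divr_gt0.
  - rewrite ge_min; apply/orP; left; rewrite ler_pdivrMr // mul1r; lra.
  - by rewrite mulrC -ler_pdivlMr // ge_min lexx.
  - by rewrite mulrC -ler_pdivlMr // ge_min lexx orbT.
pose l0 := Num.bound w^-1.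
have l0w : w^-1 < l0%:R by apply: archi_boundP; rewrite invr_ge0 ltW.
have [M1 HM1] := large_prime_regime l0 n0.
have /choice [M2 HM2] : forall d : D, exists M : nat, forall i, (M < p i)%N ->
    `|(r i (val d))%:~R / (p i)%:R - rho| < w.
  by move=> d; apply: Hr => //; exact: valP.
(* Coherence gives one threshold for each pattern; as [D] is finite, their maximum serves for
   all. *)
pose M := maxn M1 (\max_(d : D) M2 d).
exists M%:R => i; have [pp pn] := Hp i.
pose m := ((p i).-1 %/ n)%N.
have pnm : (p i).-1 = (n * m)%N.
  rewrite /m mulnC divnK // -subn1 -eqn_mod_dvd ?prime_gt0 //; exact/eqP.
have m0 : (0 < m)%N.
  have : (0 < (p i).-1)%N by rewrite -subn1 subn_gt0 prime_gt1.
  by rewrite pnm muln_gt0 => /andP[].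
have ha0 := halpha _ pp.
pose f' (d : D) := f i (val d); pose r' (d : D) := r i (val d).
have Hf (d : D) (k : 'I_n) (y : 'F_(p i)) : y != 0 ->
    f' d (alpha (p i) ^+ k * y ^+ n) = val d k.
  have := Hper i (val d) (valP d).
  by case: (unimod) => -[_ h]; exact: h.
have Hf0 (d : D) : cabs2 (f' d 0) = unimod%:R.
  have := Hper i (val d) (valP d); rewrite /f'.
  case: (unimod) => -[h _]; last by rewrite h cabs2_0.
  by apply: real_complex_inj; rewrite cabs2E -sqr_normc h expr1n.
have AE : A i = [set g | exists d, seqs f' r' d = g].
  rewrite HA; apply/seteqP; split => g.
    by case=> d dD <-; exists [` dD]%fset.
  by case=> d <-; exists (val d) => //; exact: valP.
rewrite AE => HS.
have Mp : (M < p i)%N.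
  rewrite -(ltr_nat R); apply: lt_le_trans HS _.
  have HE d : energy (seqs f' r' d) = ((p i).-1)%:R + unimod%:R.
    by rewrite (energy_seqs n1 hD r' pp pnm m0 ha0 Hf) Hf0.
  apply: le_trans (SDC_le HE _) _.
    by rewrite hadamard_card // -subn1 subn_gt0.
  rewrite -natrD ler_nat -[leqRHS](prednK (prime_gt0 pp)) -addn1 leq_add2l.
  by case: (unimod).
have M1p : (M1 < p i)%N by exact: leq_ltn_trans (leq_maxl _ _) Mp.
have [l [l0l lp pl pk]] := HM1 _ M1p.
have lw : l%:R^-1 <= w.
  rewrite -[w]invrK lef_pV2 ?posrE ?invr_gt0 ?ltr0n //.
  by apply: le_trans (ltW l0w) _; rewrite ler_nat.
have Hr' d : `|(r' d)%:~R / (p i)%:R - rho| <= w.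
  apply: ltW; apply: HM2; apply: leq_ltn_trans Mp.
  by apply: leq_trans (leq_maxr _ _); exact: (leq_bigmax (F := M2) d).
have [d0 _] : exists d : D, true.
  have : (0 < #|{: D}|)%N by rewrite hadamard_card // -subn1 subn_gt0.
  by case/card_gt0P => d _; exists d.
exact: (CDF_close n1 hD pp pnm ha0 Hf Hf0 w1 Hr' lp pl pk lw w2 d0 w3 Hsq).
Qed.

Theorem theorem1p2 (R : realType) (alpha : forall p : nat, 'F_p)
  (halpha : forall p : nat, prime p -> (p.-1).-primitive_root (alpha p))
  (n : nat) (hn : (1 < n)%N) (D : {fset {ffun 'I_n -> R[i]}})
  (hD : hadamard_plan D) (rho : R) :
  let L := fun rho' : R =>
    1 + (3 * (n.-1)%:R)^-1 + ((n.-1)%:R)^-1 * Phi (2 * rho') in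
  (forall (unimod : bool) (I : Type) (A : I -> set (int -> R[i])),
     coherently_rotated unimod alpha D rho A ->
     forall eps : R, 0 < eps -> exists M : R, forall i : I,
       M < SDC (A i) -> `|CDF (A i) - L rho| < eps) /\
  ((forall rho' : R, 1 + (6 * (n.-1)%:R)^-1 <= L rho') /\
   (L rho = 1 + (6 * (n.-1)%:R)^-1 <->
      exists m : int, rho = (2 * m + 1)%:~R / 4)).
Proof.
move=> L; split; last by split; [move=> x; exact: limit_CDF_ge|exact: limit_CDF_eq_min].
move=> unimod I A; exact: CDF_limit.
Qed.
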